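(* Let $\Bbbk$ be a field of characteristic zero, $t\in\Bbbk$ and $n\in\mathbb N$. The inflation functor $\Psi=\Psi_{n,t}:\mathbb S(n,t)\text{-mod}\to U(\mathfrak{gl}_n(\Bbbk))\text{-mod}$ restricts to a fully faithful functor $$\Psi:\mathbb S(n,t)\text{-mod}_{\mathrm{fg}}\to\mathcal P_t$$ from the category of finitely generated $\mathbb S(n,t)$-modules.
   Context: Lie theory. $\mathfrak{gl}_n(\Bbbk)$ has matrix units $E_{i,j}$, $e_i=E_{i,i+1}$, $f_i=E_{i+1,i}$, Cartan subalgebra $\mathfrak h$ of diagonal matrices, $\varepsilon_i:\mathfrak h\to\Bbbk$ the $i$th diagonal entry, $\alpha_i=\varepsilon_i-\varepsilon_{i+1}$. $\mathcal P_t$ is the full subcategory of finitely generated $U(\mathfrak{gl}_n(\Bbbk))$-modules having an $\mathfrak h$-weight space decomposition with all weights in $\Lambda(n)_t$, where $\beta\in\Lambda(n)_t$ is identified with $\sum_i\beta_i\varepsilon_i$. Combinatorics. $\mathbb N=\{1,2,\dots\}$, $[1,n]=\{1,\dots,n\}$. $\Lambda(n)_t$ is the set of $\beta=(\beta_1,\dots,\beta_n)$ with $\beta_1\in t-\mathbb Z$, $\beta_i\in\mathbb Z_{\ge0}$ for $i\ge2$, $\sum_i\beta_i=t$. $\mathcal{M}at_n(\delta,\beta)_t$ is the set of $n\times n$ matrices $q$ with $q_{1,1}\in t-\mathbb Z$, all other entries in $\mathbb Z_{\ge0}$, total sum $t$, column sums $\sum_iq_{i,j}=\beta_j$ and row sums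 $\sum_jq_{i,j}=\delta_i$. The category $\operatorname{Perm}$. $\mathfrak S_\infty$ is the group of all bijections of $\Omega=\mathbb N$, with the topology in which the pointwise stabilizers of finite subsets of $\Omega$ form a base of open neighborhoods of the identity. An action of an open subgroup $U$ on a set is smooth if all point stabilizers are open. A finitary $\widehat{\mathfrak S}_\infty$-set is a set with a smooth action of some open subgroup $U\subseteq\mathfrak S_\infty$ having finitely many orbits (one may shrink $U$); a finitary $\mathfrak S_\infty$-set is a smooth $\mathfrak S_\infty$-set with finitely many orbits. Let $\mathfrak S(p)$ be the pointwise stabilizer of $\{1,\dots,p\}$. For a finitary $\widehat{\mathfrak S}_\infty$-set $X$ there is a unique polynomial $p_X\in\mathbb Q[T]$ with $p_X(p)=|X^{\mathfrak S(p)}|$ for all sufficiently large integers $p$; set $\mu_t(X)=p_X(t)$. If $f:X\to\Bbbk$ is constant on the orbits of such an open subgroup, put $\int_X f(x)\,dx=\sum_c c\,\mu_t(f^{-1}(c))$, the sum being over the finitely many values $c$ of $f$. The category $\operatorname{Perm}(\mathfrak S_\infty;\mu_t)$ has as objects the finitary $\mathfrak S_\infty$-sets; $\operatorname{Hom}(X,Y)$ is the space of functions $Y\times X\to\Bbbk$ constant on the diagonal $\mathfrak S_\infty$-orbits; composition is $(g\circ f)(z,x)=\int_Y g(z,y)f(y,x)\,dy$. The algebra and its modules. For $\beta\in\Lambda(n)_t$ and $k\ge2$ let $\{\beta\}_k=[1+\sum_{i=2}^{k-1}\beta_i,\ \sum_{i=2}^{k}\beta_i]\subset\Omega$ and $\{\beta\}_1=\Omega\setminus\bigcup_{k\ge2}\{\beta\}_k$.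 $\mathfrak S_\beta\le\mathfrak S_\infty$ is the subgroup preserving each $\{\beta\}_k$, and $\mathcal X^\beta=\mathfrak S_\infty/\mathfrak S_\beta$. $\mathbb S(n,t)=\bigoplus_{\beta,\delta\in\Lambda(n)_t}\operatorname{Hom}_{\operatorname{Perm}(\mathfrak S_\infty;\mu_t)}(\mathcal X^\beta,\mathcal X^\delta)$, with product given by composition (zero if not composable); $1_\beta$ is the identity of $\mathcal X^\beta$. For $q\in\mathcal{M}at_n(\delta,\beta)_t$, $\xi_q\in\operatorname{Hom}(\mathcal X^\beta,\mathcal X^\delta)$ is the indicator function of the $\mathfrak S_\infty$-orbit of $(\mathfrak S_\delta,\sigma\mathfrak S_\beta)$, where $\sigma$ is any element with $|\{\delta\}_i\cap\sigma(\{\beta\}_j)|=q_{i,j}$ for $(i,j)\ne(1,1)$. An $\mathbb S(n,t)$-module is a module $M$ with $M=\bigoplus_{\beta\in\Lambda(n)_t}1_\beta M$. The functor $\Psi$. For $\lambda\in\Lambda(n)_t$ and $i\in[1,n-1]$ with $\lambda+\alpha_i\in\Lambda(n)_t$, let $q_i^{\lambda,+}\in\mathcal{M}at_n(\lambda+\alpha_i,\lambda)_t$ (resp. $q_i^{\lambda,-}\in\mathcal{M}at_n(\lambda,\lambda+\alpha_i)_t$) be the matrix with diagonal $(\lambda_1,\dots,\lambda_i,\lambda_{i+1}-1,\lambda_{i+2},\dots,\lambda_n)$, entry $1$ in position $(i,i+1)$ (resp. $(i+1,i)$), and zeros elsewhere. For an $\mathbb S(n,t)$-module $M$, $\Psi(M)$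 is $M$ as a vector space, with $\mathfrak h$ acting on $1_\beta M$ with weight $\beta$ and, for $m\in1_\beta M$: $e_im=\xi_{q_i^{\beta,+}}m$ if $\beta+\alpha_i\in\Lambda(n)_t$ and $0$ otherwise; $f_im=\xi_{q_i^{\beta-\alpha_i,-}}m$ if $\beta-\alpha_i\in\Lambda(n)_t$ and $0$ otherwise. $\Psi$ is the identity on morphisms. (This is inflation along the surjection from the idempotented enveloping algebra of $\mathfrak{gl}_n$ to $\mathbb S(n,t)$.) *)

(* Defs.v *)
From HB Require Import structures.
From mathcomp Require Import all_boot all_order all_algebra.
From mathcomp Require Import mathcomp_extra boolp classical_sets functions.
From mathcomp Require Import cardinality fsbigop generic_quotient.

Set Implicit Arguments.
Unset Strict Implicit.
Unset Printing Implicit Defensive.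

Import GRing.Theory.

Local Open Scope classical_set_scope.
Local Open Scope ring_scope.
Local Open Scope card_scope.

(** * The group of all bijections of Omega

    Omega = {1, 2, ...} is represented by [nat] through x |-> x - 1, so that
    the subset {1, ..., p} becomes [`I_p = [set i | i < p]].  Likewise the
    coordinates 1, ..., N of a vector become the elements of ['I_N]. *)

Record Sinf : Type := MkSinf {
  sfun :> nat -> nat;
  sinv : nat -> nat;
  sfunK : cancel sfun sinv;
  sinvK : cancel sinv sfun
}.

Lemma SinfP (s u : Sinf) : sfun s =1 sfun u -> s = u.
Proof.
case: s u => [f f' fK f'K] [g g' gK g'K] /= fg.
have efg : f = g by apply: funext.
subst g; have efg' : f' = g' by apply: funext => x; rewrite -{1}[x]g'K fK.
by subst g'; rewrite (Prop_irrelevance fK gK) (Prop_irrelevance f'K g'K).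
Qed.

HB.instance Definition _ := gen_eqMixin Sinf.
HB.instance Definition _ := gen_choiceMixin Sinf.

Definition Sinf_one : Sinf := @MkSinf id id (fun _ => erefl) (fun _ => erefl).

Definition Sinf_mul (s u : Sinf) : Sinf :=
  MkSinf (can_comp (@sfunK s) (@sfunK u)) (can_comp (@sinvK u) (@sinvK s)).

Definition Sinf_inv (s : Sinf) : Sinf := MkSinf (@sinvK s) (@sfunK s).

Lemma Sinf_mulA : associative Sinf_mul.
Proof. by move=> s u v; apply: SinfP. Qed.
Lemma Sinf_mul1 : left_id Sinf_one Sinf_mul.
Proof. by move=> s; apply: SinfP. Qed.
Lemma Sinf_mulr1 : right_id Sinf_one Sinf_mul.
Proof. by move=> s; apply: SinfP. Qed.
Lemma Sinf_mulV : left_inverse Sinf_one Sinf_inv Sinf_mul.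
Proof. by move=> s; apply: SinfP => x /=; rewrite sfunK. Qed.
Lemma Sinf_mulrV : right_inverse Sinf_one Sinf_inv Sinf_mul.
Proof. by move=> s; apply: SinfP => x /=; rewrite sinvK. Qed.

HB.instance Definition _ := isGroup.Build Sinf
  Sinf_mulA Sinf_mul1 Sinf_mulr1 Sinf_mulV Sinf_mulrV.

Lemma SinfM (s u : Sinf) x : (s * u)%g x = s (u x). Proof. by []. Qed.
Lemma Sinf1 x : (1 : Sinf)%g x = x. Proof. by []. Qed.

Definition pstab (F : set nat) : set Sinf := [set s | forall x, F x -> s x = x].

(** Open sets of the group topology in which the subgroups [pstab F], F finite,
    form a base of neighborhoods of the identity. *)
Definition Sinf_open (U : set Sinf) : Prop :=
  forall u, U u ->
    exists2 F : set nat, finite_set F & forall s, pstab F s -> U (u * s)%g.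

(** * Finitary sets *)

Record finitary : Type := Finitary {
  fcar :> Type;
  fact : Sinf -> fcar -> fcar;
  fact1 : forall x, fact 1%g x = x;
  factM : forall s u x, fact (s * u)%g x = fact s (fact u x);
  fsmooth : forall x, Sinf_open [set s | fact s x = x];
  ffinite : finite_set (range (fun x => [set fact s x | s in [set: Sinf]]))
}.

Lemma factK (X : finitary) (s : Sinf) : cancel (fact (f:=X) s) (fact s^-1%g).
Proof. by move=> x; rewrite -factM mulVg fact1. Qed.
Lemma factVK (X : finitary) (s : Sinf) : cancel (fact (f:=X) s^-1%g) (fact s).
Proof. by move=> x; rewrite -factM mulgV fact1. Qed.

(** * The measure [mu_t] and integration

    The sets to be measured are the subsets [A] of a finitary set that are
    stable under some open subgroup.  As soon as [pstab `I_p] is contained in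
    that subgroup, [fixed_points A p] is the set of fixed points of [pstab `I_p]
    in its action on [A].  The polynomial chosen in [mu] is unique when it
    exists, which is the case for every such [A]. *)

Section Measure.
Variables (k : fieldType) (t : k) (X : finitary).

Definition fixed_points (A : set X) (p : nat) : set X :=
  A `&` [set x | forall s, pstab `I_p s -> fact s x = x].

Definition counting_poly (A : set X) (P : {poly rat}) : Prop :=
  exists N : nat, forall p, (N <= p)%N ->
    exists2 m : nat, fixed_points A p #= `I_m & P.[p%:R] = m%:R.

Definition mu (A : set X) : k :=
  (map_poly ratr (xget 0 [set P | counting_poly A P])).[t].

Definition integral (f : X -> k) : k :=
  \sum_(c \in range f) c * mu (f @^-1` [set c]).

End Measure.

(** Invariance of [mu] under the action of the whole group; it is what makes
    the composition of the category Perm well defined. *)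

Lemma extend_perm (s : Sinf) (p0 p : nat) :
    (forall i, (i < p0)%N -> (i < p)%N /\ (s i < p)%N) ->
  exists r : Sinf, (forall i, (i < p0)%N -> r i = s i) /\
    (forall i, (r i < p)%N = (i < p)%N).
Proof.
elim: p0 => [|p0 IH] H; first by exists 1%g; split.
have [i ip|r [rs rp]] := IH; first by apply: H; exact: ltnW.
have [p0p sp] := H p0 (ltnSn _).
pose w (x : nat) := if x == r p0 then s p0 else if x == s p0 then r p0 else x.
have wK : cancel w w.
  move=> x; rewrite /w; case: (altP (x =P r p0)) => [->|xr].
    by case: (altP (s p0 =P r p0)) => [->//|_]; rewrite eqxx.
  case: (altP (x =P s p0)) => [->|xs]; first by rewrite eqxx.
  by rewrite (negPf xr) (negPf xs).
have wlt x : (w x < p)%N = (x < p)%N.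
  rewrite /w; case: (altP (x =P r p0)) => [->|_]; first by rewrite sp rp p0p.
  by case: (altP (x =P s p0)) => [->|//]; rewrite sp rp p0p.
exists (MkSinf wK wK * r)%g; split=> i; last by rewrite SinfM /= wlt rp.
rewrite ltnS leq_eqVlt SinfM /= /w => /orP[/eqP->|ip]; first by rewrite eqxx.
have ni : i != p0 by rewrite neq_ltn ip.
rewrite (inj_eq (can_inj (@sfunK r))) (negPf ni) rs//.
by rewrite (inj_eq (can_inj (@sfunK s))) (negPf ni).
Qed.

Lemma card_inj_image (T U : Type) (A : set T) (f : T -> U) :
  injective f -> f @` A #= A.
Proof.
move=> fI; have fA : {in A &, injective f} by move=> x y _ _; exact: fI.
have [g eg] := Pinj fA.
by rewrite eg; exact: card_image.
Qed.

Lemma finite_set_nat_bound (F : set nat) :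
  finite_set F -> exists N, F `<=` `I_N.
Proof.
move=> /finite_seqP[l ->]; exists (\max_(i <- l) i).+1 => x /= xl.
by rewrite ltnS; apply: leq_bigmax_seq.
Qed.

Lemma Sinf_open_pstab (U : set Sinf) :
  Sinf_open U -> U 1%g -> exists N, pstab `I_N `<=` U.
Proof.
move=> oU /oU[F /finite_set_nat_bound[N FN] FU]; exists N => s sN.
by rewrite -(mul1g s); apply: FU => x /FN /sN.
Qed.

Section Invariance.
Variables (k : fieldType) (t : k) (X : finitary).

Lemma counting_poly_translate (A : set X) (p0 : nat) (s : Sinf) P :
    (forall u x, pstab `I_p0 u -> A x -> A (fact u x)) ->
  counting_poly A P -> counting_poly [set x | A (fact s^-1%g x)] P.
Proof.
move=> stA [N NP]; pose b := (\max_(i < p0) s i).+1.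
exists (maxn N (maxn p0 b)) => p; rewrite !geq_max => /and3P[Np p0p bp].
have [m cm Pm] := NP _ Np; exists m => //.
have [i ip0|r [rs rp]] := @extend_perm s p0 p.
  split; first exact: leq_trans p0p.
  by apply: leq_trans bp; rewrite ltnS (leq_bigmax (Ordinal ip0)).
have rp' i : ((r^-1)%g i < p)%N = (i < p)%N by rewrite -rp /= sinvK.
have AE x : A (fact s^-1%g x) <-> A (fact r^-1%g x).
  split=> Ax.
    have -> : r^-1%g = (r^-1 * s * s^-1)%g by rewrite -mulgA mulgV mulg1.
    rewrite factM; apply: stA => // i /= ip.
    by rewrite -(rs _ ip) /= sfunK.
  have -> : s^-1%g = (s^-1 * r * r^-1)%g by rewrite -mulgA mulgV mulg1.
  rewrite factM; apply: stA => // i /= ip.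
  by rewrite (rs _ ip) /= sfunK.
suff -> : fixed_points [set x | A (fact s^-1%g x)] p
          = [set fact r x | x in fixed_points A p].
  apply: card_eq_trans cm; apply: card_inj_image.
  exact: can_inj (@factK _ _).
apply/seteqP; split=> [x [/= /AE Ax fx]|_ [x [Ax fx] <-]].
  exists (fact r^-1%g x); last exact: factVK.
  split=> // u up; have /= e : fact (r * u * r^-1)%g x = x.
    apply: fx => i ip; rewrite !SinfM up; first exact: sinvK.
    by rewrite /= -rp sinvK.
  by rewrite -[in RHS]e -!factM !mulgA mulVg mul1g.
split; first by apply/AE; rewrite factK.
move=> u up /=; have e : fact (r^-1 * u * r)%g x = x.
  by apply: fx => i ip; rewrite !SinfM up ?[LHS]sfunK // /= rp.
by rewrite -[in RHS]e -!factM !mulgA mulgV mul1g.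
Qed.

Lemma mu_translate (A : set X) (p0 : nat) (s : Sinf) :
    (forall u x, pstab `I_p0 u -> A x -> A (fact u x)) ->
  mu t [set x | A (fact s x)] = mu t A.
Proof.
move=> stA; suff e : counting_poly [set x | A (fact s x)] = counting_poly A.
  by rewrite /mu; under eq_fun do rewrite e.
apply/seteqP; split=> P; last first.
  by move=> /(@counting_poly_translate A p0 s^-1%g P stA); rewrite invgK.
pose p1 := (\max_(i < p0) (s^-1)%g i).+1.
have stA' u x : pstab `I_p1 u -> A (fact s x) -> A (fact s (fact u x)).
  move=> up Ax; have -> : fact s (fact u x) = fact (s * u * s^-1)%g (fact s x).
    by rewrite -!factM -mulgA mulVg mulg1.
  apply: stA => // i /= ip; rewrite up /= ?sinvK// ltnS.
  exact: (@leq_bigmax _ (fun i : 'I_p0 => (s^-1)%g i) (Ordinal ip)).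
move=> /(@counting_poly_translate _ p1 s P stA') /=.
by under eq_set do rewrite factVK.
Qed.

Lemma integral_translate (f : X -> k) (p0 : nat) (s : Sinf) :
    (forall u x, pstab `I_p0 u -> f (fact u x) = f x) ->
  integral t (fun x => f (fact s x)) = integral t f.
Proof.
move=> fu; rewrite /integral.
have -> : range (fun x => f (fact s x)) = range f.
  apply/seteqP; split=> _ [x _ <-]; first by exists (fact s x).
  by exists (fact s^-1%g x); rewrite ?factVK.
apply: eq_fsbigr => c _; congr (_ * _).
apply: (@mu_translate (f @^-1` [set c]) p0) => u x up /= <-; exact: fu.
Qed.

End Invariance.

(** * The category Perm(S_infty; mu_t) *)

Section Perm.
Variables (k : fieldType) (t : k).

Definition invariant (X Y : finitary) (f : Y * X -> k^o) : Prop :=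
  forall s y x, f (fact s y, fact s x) = f (y, x).

Definition Hom_pred (X Y : finitary) : {pred (Y * X -> k^o)} :=
  fun f => `[< invariant f >].

Lemma Hom_predP (X Y : finitary) (f : Y * X -> k^o) :
  reflect (invariant f) (f \in @Hom_pred X Y).
Proof. exact: asboolP. Qed.

Lemma Hom_submod (X Y : finitary) : submod_closed (@Hom_pred X Y).
Proof.
split=> [|a f g /Hom_predP fi /Hom_predP gi]; apply/Hom_predP => s y x//.
by rewrite !fctE fi gi.
Qed.

HB.instance Definition _ (X Y : finitary) :=
  GRing.isSubmodClosed.Build k (Y * X -> k^o) (@Hom_pred X Y)
    (@Hom_submod X Y).

Record Hom (X Y : finitary) : Type := MkHom {
  hfun :> Y * X -> k^o;
  hfun_inv : hfun \in @Hom_pred X Y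
}.

HB.instance Definition _ (X Y : finitary) := [isSub for @hfun X Y].
HB.instance Definition _ (X Y : finitary) := [Choice of Hom X Y by <:].
HB.instance Definition _ (X Y : finitary) :=
  [SubChoice_isSubLmodule of Hom X Y by <:].

Lemma HomP (X Y : finitary) (f g : Hom X Y) : f =1 g -> f = g.
Proof. by move=> fg; apply: val_inj; apply: funext. Qed.

Lemma id_subproof (X : finitary) :
  (fun yx => `[< yx.1 = yx.2 >]%:R) \in @Hom_pred X X.
Proof.
apply/Hom_predP => s y x /=; congr (nat_of_bool _)%:R.
by apply/asbool_equiv_eq; split=> [/(can_inj (@factK _ _))|->].
Qed.

Definition Hom_id (X : finitary) : Hom X X := MkHom (@id_subproof X).

Lemma comp_subproof (X Y Z : finitary) (g : Hom Y Z) (f : Hom X Y) :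
  (fun zx => integral t (fun y => g (zx.1, y) * f (y, zx.2)))
    \in @Hom_pred X Z.
Proof.
have /Hom_predP gi := hfun_inv g; have /Hom_predP fi := hfun_inv f.
apply/Hom_predP => s z x /=.
have [Nz zN] := Sinf_open_pstab (@fsmooth Z z) (fact1 z).
have [Nx xN] := Sinf_open_pstab (@fsmooth X x) (fact1 x).
rewrite -[RHS](@integral_translate _ _ _ _ (maxn Nz Nx) s^-1%g).
  congr integral; apply: funext => y.
  by rewrite -[in LHS](factVK s y) gi fi.
move=> u y up.
have /zN uz : pstab `I_Nz u.
  by move=> i /= iN; apply: up; rewrite /= leq_max iN.
have /xN ux : pstab `I_Nx u.
  by move=> i /= iN; apply: up; rewrite /= leq_max iN orbT.
by rewrite -{1}uz -{1}ux gi fi.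
Qed.

Definition Hom_comp (X Y Z : finitary) (g : Hom Y Z) (f : Hom X Y) : Hom X Z :=
  MkHom (comp_subproof g f).

End Perm.

(** * Weights, Young subgroups, and the objects X^beta

    Throughout, the rank is [n.+1], and ['I_n.+1] indexes the coordinates
    1, ..., n + 1. *)

Section Weights.
Variables (k : fieldType) (t : k) (n : nat).

(** The set Lambda(n.+1)_t: [whead] is the first coordinate, [wtail] lists the
    remaining ones. *)
Record Lambda : Type := MkLambda {
  whead : k;
  wtail : {ffun 'I_n -> nat};
  whead_int : exists z : int, whead = t - z%:~R;
  wsum : whead + \sum_(i < n) (wtail i)%:R = t
}.

Lemma LambdaP (b c : Lambda) : wtail b = wtail c -> b = c.
Proof.
case: b c => [h u hi hs] [h' u' hi' hs'] /= e; subst u'.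
have e : h = h' by apply: (addIr (\sum_(i < n) (u i)%:R)); rewrite hs hs'.
subst h'; congr MkLambda; exact: Prop_irrelevance.
Qed.

HB.instance Definition _ := gen_eqMixin Lambda.
HB.instance Definition _ := gen_choiceMixin Lambda.

Definition wt (b : Lambda) (i : 'I_n.+1) : k :=
  if unlift ord0 i is Some j then (wtail b j)%:R else whead b.

(** [tail_block b j] is {b}_{j + 2}, the (j + 2)-nd coordinate being
    [wtail b j]. *)
Definition tail_block (b : Lambda) (j : 'I_n) : set nat :=
  [set x | (\sum_(i < n | (i < j)%N) wtail b i <= x
            < \sum_(i < n | (i <= j)%N) wtail b i)%N].

Definition block (b : Lambda) (i : 'I_n.+1) : set nat :=
  if unlift ord0 i is Some j then tail_block b j
  else ~` \bigcup_(j in [set: 'I_n]) tail_block b j.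

Definition young (b : Lambda) : set Sinf :=
  [set s | forall i, [set s x | x in block b i] = block b i].

Lemma young1 b : young b 1%g.
Proof. by move=> i; rewrite image_id. Qed.

Lemma young_pstab b : exists p, pstab `I_p `<=` young b.
Proof.
exists (\sum_(i < n) wtail b i)%N => s sp.
have tailp j x : tail_block b j x -> s x = x.
  move=> /andP[_ xj]; apply: sp => /=; apply: leq_trans xj _.
  by rewrite [leqRHS](bigID (fun i : 'I_n => (i <= j)%N)) /= leq_addr.
have fixb (A : set nat) : (forall x, A x -> s x = x) -> [set s x | x in A] = A.
  by move=> As; rewrite (eq_imagel (f' := id)) ?image_id.
move=> i; rewrite /block; case: unlift => [j|]; first exact/fixb/tailp.
set U := \bigcup_(j in _) _; have fU x : U x -> s x = x by move=> [j _ /tailp].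
apply/seteqP; split=> [_ [x nx <-] sx|x nx].
  by apply: nx; rewrite -(can_inj (@sfunK s) (fU _ sx)).
exists (sinv s x); last exact: sinvK.
by move=> Uy; apply: nx; rewrite -[x](@sinvK s) fU.
Qed.

Definition young_coset (s : Sinf) (b : Lambda) : set Sinf :=
  [set (s * u)%g | u in young b].

Definition cosets (b : Lambda) : Type :=
  {A : set Sinf | exists s, A = young_coset s b}.

Definition coset (b : Lambda) (s : Sinf) : cosets b :=
  exist _ (young_coset s b) (ex_intro _ s erefl).

Lemma cosetsP b (A B : cosets b) : sval A = sval B -> A = B.
Proof. by case: A B => [A hA] [B hB] /= e; exact: eq_exist. Qed.

Lemma coset_act_subproof (s : Sinf) b (A : cosets b) :
  exists u, [set (s * v)%g | v in sval A] = young_coset u b.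
Proof.
have [u ->] := svalP A; exists (s * u)%g; apply/seteqP; split=> x /=.
  by move=> [_ [v vb <-] <-]; exists v; rewrite ?mulgA.
by move=> [v vb <-]; exists (u * v)%g; [exists v|rewrite mulgA].
Qed.

Definition coset_act b (s : Sinf) (A : cosets b) : cosets b :=
  exist _ [set (s * v)%g | v in sval A] (coset_act_subproof s A).

Lemma coset_act_coset b (s u : Sinf) :
  coset_act s (coset b u) = coset b (s * u)%g.
Proof.
apply: cosetsP; apply/seteqP; split=> x /=.
  by move=> [_ [v vb <-] <-]; exists v; rewrite ?mulgA.
by move=> [v vb <-]; exists (u * v)%g; [exists v|rewrite mulgA].
Qed.

Lemma cosets_ind b (P : cosets b -> Prop) :
  (forall s, P (coset b s)) -> forall A, P A.
Proof.
move=> H [A hA]; have [s e] := hA; suff -> : exist _ A hA = coset b s by [].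
exact: cosetsP.
Qed.

Lemma coset_act1 b (A : cosets b) : coset_act 1%g A = A.
Proof. by elim/cosets_ind: A => u; rewrite coset_act_coset mul1g. Qed.

Lemma coset_actM b (s u : Sinf) (A : cosets b) :
  coset_act (s * u)%g A = coset_act s (coset_act u A).
Proof. by elim/cosets_ind: A => v; rewrite !coset_act_coset mulgA. Qed.

Lemma young_mul b (s u : Sinf) : young b s -> young b u -> young b (s * u)%g.
Proof.
move=> sb ub i; rewrite -[in RHS](sb i) -[in RHS](ub i).
by rewrite image_comp.
Qed.

Lemma coset_young b (s u : Sinf) : young b u -> coset b (s * u)%g = coset b s.
Proof.
move=> ub; have uVb : young b u^-1%g.
  move=> i; rewrite -{1}(ub i); apply/seteqP; split=> [_ [_ [x xi <-] <-]|x xi].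
    by rewrite /= sfunK.
  by exists (u x); [exists x|rewrite /= sfunK].
apply: cosetsP; apply/seteqP; split=> _ [v vb <-].
  by exists (u * v)%g; [exact: young_mul|rewrite mulgA].
by exists (u^-1 * v)%g; [exact: young_mul|rewrite mulgA mulgK].
Qed.

Lemma coset_smooth b (A : cosets b) : Sinf_open [set s | coset_act s A = A].
Proof.
elim/cosets_ind: A => u v; rewrite /= coset_act_coset => vA.
have [p yp] := young_pstab b.
exists [set u x | x in `I_p]; first exact/finite_image/finite_II.
move=> s sF; rewrite /= coset_act_coset -[RHS]vA.
have -> : (v * s * u = v * u * (u^-1 * s * u))%g.
  by rewrite !mulgA mulgK.
apply: coset_young; apply: yp => x xp.
by rewrite !SinfM sF ?sfunK//=; [rewrite sfunK|exists x].
Qed.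

Lemma coset_finite b :
  finite_set
    (range (fun A : cosets b => [set coset_act s A | s in [set: Sinf]])).
Proof.
apply: (@sub_finite_set _ _ [set setT]); last exact: finite_set1.
move=> _ [A _ <-] /=; apply/seteqP; split=> // B _.
elim/cosets_ind: A => u; elim/cosets_ind: B => v.
by exists (v * u^-1)%g => //; rewrite coset_act_coset mulgVK.
Qed.

(** The object X^b = S_infty / S_b. *)
Definition Xset (b : Lambda) : finitary :=
  Finitary (@coset_act1 b) (@coset_actM b) (@coset_smooth b) (coset_finite b).

End Weights.

(** * The algebra S(n.+1, t) *)

Section Algebra.
Variables (k : fieldType) (t : k) (n : nat).

Local Notation L := (Lambda t n).

(** The index [db = (d, b)] stands for Hom(X^b, X^d). *)
Definition HomX (db : L * L) : lmodType k := Hom k (Xset db.2) (Xset db.1).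

Record Salg : Type := MkSalg {
  scoef :> forall db : L * L, HomX db;
  sfinite : finite_set [set db | scoef db <> 0]
}.

Lemma SalgP (a b : Salg) : (forall db, a db = b db) -> a = b.
Proof.
case: a b => [a ha] [b hb] /= ab.
have e : a = b by exact: functional_extensionality_dep.
by subst b; congr MkSalg; exact: Prop_irrelevance.
Qed.

HB.instance Definition _ := gen_eqMixin Salg.
HB.instance Definition _ := gen_choiceMixin Salg.

Lemma Salg0_subproof : finite_set [set db : L * L | (0 : HomX db) <> 0].
Proof. by apply: (@sub_finite_set _ _ set0) => // db /=. Qed.

Definition Salg0 : Salg := MkSalg Salg0_subproof.

Lemma Salg_lin_subproof (c : k) (a b : Salg) :
  finite_set [set db | c *: a db + b db <> 0].
Proof.
have h : finite_set ([set db | a db <> 0] `|` [set db | b db <> 0]).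
  by rewrite finite_setU; split; exact: sfinite.
apply: sub_finite_set h => db /= nz; apply: contrapT => /not_orP[].
by move=> /contrapT a0 /contrapT b0; apply: nz; rewrite a0 b0 scaler0 addr0.
Qed.

Definition Salg_lin (c : k) (a b : Salg) : Salg :=
  MkSalg (Salg_lin_subproof c a b).

Definition Salg_add (a b : Salg) : Salg := Salg_lin 1 a b.
Definition Salg_scale (c : k) (a : Salg) : Salg := Salg_lin c a Salg0.
Definition Salg_opp (a : Salg) : Salg := Salg_scale (-1) a.

Lemma Salg_addA : associative Salg_add.
Proof. by move=> a b c; apply: SalgP => db /=; rewrite !scale1r addrA. Qed.
Lemma Salg_addC : commutative Salg_add.
Proof. by move=> a b; apply: SalgP => db /=; rewrite !scale1r addrC. Qed.
Lemma Salg_add0 : left_id Salg0 Salg_add.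
Proof. by move=> a; apply: SalgP => db /=; rewrite scale1r add0r. Qed.
Lemma Salg_addN : left_inverse Salg0 Salg_opp Salg_add.
Proof.
by move=> a; apply: SalgP => db /=; rewrite scale1r addr0 scaleN1r addNr.
Qed.

HB.instance Definition _ := GRing.isZmodule.Build Salg
  Salg_addA Salg_addC Salg_add0 Salg_addN.

Lemma SalgD (a b : Salg) db : (a + b) db = a db + b db.
Proof. by rewrite -[a db]scale1r. Qed.

Lemma Salg_scaleA c d (a : Salg) :
  Salg_scale c (Salg_scale d a) = Salg_scale (c * d) a.
Proof. by apply: SalgP => db /=; rewrite !addr0 scalerA. Qed.
Lemma Salg_scale1 : left_id 1 Salg_scale.
Proof. by move=> a; apply: SalgP => db /=; rewrite addr0 scale1r. Qed.
Lemma Salg_scaleDr : right_distributive Salg_scale +%R.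
Proof.
by move=> c a b; apply: SalgP => db; rewrite SalgD /= !addr0 scale1r scalerDr.
Qed.
Lemma Salg_scaleDl a : {morph Salg_scale^~ a : c d / c + d}.
Proof.
by move=> c d; apply: SalgP => db; rewrite SalgD /= !addr0 scalerDl.
Qed.

HB.instance Definition _ := GRing.Zmodule_isLmodule.Build k Salg
  Salg_scaleA Salg_scale1 Salg_scaleDr Salg_scaleDl.

Lemma Hom_comp0l (X Y Z : finitary) (f : Hom k X Y) :
  Hom_comp t (0 : Hom k Y Z) f = 0.
Proof.
apply: HomP => -[z x] /=; rewrite /integral /=.
by apply: fsbig1 => c [y _ <-]; rewrite mul0r mul0r.
Qed.

Lemma Hom_comp0r (X Y Z : finitary) (g : Hom k Y Z) :
  Hom_comp t g (0 : Hom k X Y) = 0.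
Proof.
apply: HomP => -[z x] /=; rewrite /integral /=.
by apply: fsbig1 => c [y _ <-]; rewrite mulr0 mul0r.
Qed.

Definition Salg_comp (a b : Salg) (db : L * L) (c : L) : HomX db :=
  Hom_comp t (a (db.1, c)) (b (c, db.2)).

Lemma Salg_mul_subproof (a b : Salg) :
  finite_set [set db | \sum_(c \in [set: L]) Salg_comp a b db c <> 0].
Proof.
pose A := [set db | a db <> 0]; pose B := [set db | b db <> 0].
have h : finite_set ([set x.1 | x in A] `*` [set x.2 | x in B]).
  by apply: finite_setX; apply: finite_image; exact: sfinite.
apply: sub_finite_set h => -[d e] /= nz.
have [c hc] : exists c, Salg_comp a b (d, e) c <> 0.
  apply: contrapT => /forallNP H; apply: nz; apply: fsbig1 => c _.
  by apply: contrapT; exact: H.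
split; [exists (d, c) => // a0|exists (c, e) => // b0]; apply: hc.
  by rewrite /Salg_comp /= a0 Hom_comp0l.
by rewrite /Salg_comp /= b0 Hom_comp0r.
Qed.

Definition Salg_mul (a b : Salg) : Salg := MkSalg (Salg_mul_subproof a b).

Lemma Salg_in_subproof (db : L * L) (f : HomX db) :
  finite_set [set x | @dfwith _ (fun x => HomX x) (fun=> 0) db f x <> 0].
Proof.
apply: (@sub_finite_set _ _ [set db]); last exact: finite_set1.
by move=> x /=; case: dfwithP.
Qed.

Definition Salg_in (d b : L) (f : Hom k (Xset b) (Xset d)) : Salg :=
  MkSalg (@Salg_in_subproof (d, b) f).

Definition Salg_id (b : L) : Salg := Salg_in (Hom_id k (Xset b)).

(** [xi d b q] is the indicator function of the orbit of
    (S_d, s S_b), for any s such that the intersection of the i-th block of d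
    with the image under s of the j-th block of b has q i j elements,
    (i, j) <> (0, 0); all such s yield the same orbit.  It is meant for matrices
    q with row sums d, column sums b, and natural entries outside (0, 0). *)
Definition xi_set (d b : L) (q : 'M[k]_n.+1) : set (Xset d * Xset b) :=
  [set yx | exists s g : Sinf,
     (forall i j, (i, j) != (ord0, ord0) ->
        exists2 m : nat, block d i `&` [set s x | x in block b j] #= `I_m
                       & q i j = m%:R) /\
     yx = (fact g (coset d 1%g : Xset d), fact g (coset b s : Xset b))].

Lemma xi_subproof (d b : L) (q : 'M[k]_n.+1) :
  (fun yx => `[< xi_set q yx >]%:R) \in @Hom_pred k (Xset b) (Xset d).
Proof.
apply/Hom_predP => u y x; congr (nat_of_bool _)%:R; apply/asbool_equiv_eq.
split=> -[s [g [H e]]].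
  have ey : fact u y = fact g (coset d 1%g : Xset d) := congr1 fst e.
  have ex : fact u x = fact g (coset b s : Xset b) := congr1 snd e.
  exists s, (u^-1 * g)%g; split=> //.
  by rewrite !factM -[in RHS]ey -[in RHS]ex !factK.
have ey : y = fact g (coset d 1%g : Xset d) := congr1 fst e.
have ex : x = fact g (coset b s : Xset b) := congr1 snd e.
by exists s, (u * g)%g; split=> //; rewrite ey ex !factM.
Qed.

Definition xi (d b : L) (q : 'M[k]_n.+1) : Salg :=
  Salg_in (MkHom (xi_subproof d b q)).

End Algebra.

(** * The universal enveloping algebra of gl_N *)

Section Enveloping.
Variables (k : fieldType) (N : nat).

(** Expressions in the elements of gl_N, to be
    divided by the smallest congruence [ueq] that makes them an associative
    unital k-algebra in which [UGen] is linear and carries the bracket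
    A B - B A of gl_N to the commutator. *)
Inductive uterm : Type :=
  | UScal of k
  | UGen of 'M[k]_N
  | UAdd of uterm & uterm
  | UMul of uterm & uterm.

Inductive ueq : uterm -> uterm -> Prop :=
  | ueq_refl x : ueq x x
  | ueq_sym x y : ueq x y -> ueq y x
  | ueq_trans y x z : ueq x y -> ueq y z -> ueq x z
  | ueq_add x x' y y' : ueq x x' -> ueq y y' -> ueq (UAdd x y) (UAdd x' y')
  | ueq_mul x x' y y' : ueq x x' -> ueq y y' -> ueq (UMul x y) (UMul x' y')
  | ueq_addA x y z : ueq (UAdd x (UAdd y z)) (UAdd (UAdd x y) z)
  | ueq_addC x y : ueq (UAdd x y) (UAdd y x)
  | ueq_add0 x : ueq (UAdd (UScal 0) x) x
  | ueq_addN x : ueq (UAdd (UMul (UScal (-1)) x) x) (UScal 0)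
  | ueq_mulA x y z : ueq (UMul x (UMul y z)) (UMul (UMul x y) z)
  | ueq_mul1 x : ueq (UMul (UScal 1) x) x
  | ueq_mulDl x y z : ueq (UMul (UAdd x y) z) (UAdd (UMul x z) (UMul y z))
  | ueq_mulDr x y z : ueq (UMul x (UAdd y z)) (UAdd (UMul x y) (UMul x z))
  | ueq_scalD c d : ueq (UScal (c + d)) (UAdd (UScal c) (UScal d))
  | ueq_scalM c d : ueq (UScal (c * d)) (UMul (UScal c) (UScal d))
  | ueq_scalC c x : ueq (UMul (UScal c) x) (UMul x (UScal c))
  | ueq_genD A B : ueq (UGen (A + B)) (UAdd (UGen A) (UGen B))
  | ueq_genZ c A : ueq (UGen (c *: A)) (UMul (UScal c) (UGen A))
  | ueq_bracket A B : ueq (UMul (UGen A) (UGen B))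
      (UAdd (UMul (UGen B) (UGen A)) (UGen (A *m B - B *m A))).

HB.instance Definition _ := gen_eqMixin uterm.
HB.instance Definition _ := gen_choiceMixin uterm.

Definition ueqb (x y : uterm) : bool := `[< ueq x y >].

Lemma ueqb_refl : reflexive ueqb.
Proof. by move=> x; apply/asboolP; exact: ueq_refl. Qed.
Lemma ueqb_sym : symmetric ueqb.
Proof. by move=> x y; apply/asbool_equiv_eq; split; exact: ueq_sym. Qed.
Lemma ueqb_trans : transitive ueqb.
Proof.
by move=> y x z /asboolP xy /asboolP yz; apply/asboolP; exact: ueq_trans yz.
Qed.

Canonical ueqb_equiv := EquivRel ueqb ueqb_refl ueqb_sym ueqb_trans.

Definition Ugl : Type := {eq_quot ueqb}%qT.
HB.instance Definition _ := Choice.on Ugl.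
HB.instance Definition _ := EqQuotient.on Ugl.


Definition Ucl (x : uterm) : Ugl := (\pi_Ugl x)%qT.

Lemma Ucl_eq x y : Ucl x = Ucl y <-> ueq x y.
Proof. by split=> [/eqmodP/asboolP|xy]; last exact/eqmodP/asboolP. Qed.

Lemma Ucl_repr u : Ucl (repr u) = u. Proof. exact: reprK. Qed.

Lemma repr_Ucl x : ueq (repr (Ucl x)) x. Proof. exact/Ucl_eq/Ucl_repr. Qed.

Lemma Ucl_ind (P : Ugl -> Prop) : (forall x, P (Ucl x)) -> forall u, P u.
Proof. by move=> H u; rewrite -(Ucl_repr u). Qed.

Definition Uscal (c : k) : Ugl := Ucl (UScal c).
Definition Ugen (A : 'M[k]_N) : Ugl := Ucl (UGen A).
Definition Uadd (u v : Ugl) : Ugl := Ucl (UAdd (repr u) (repr v)).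
Definition Umul (u v : Ugl) : Ugl := Ucl (UMul (repr u) (repr v)).
Definition Uscale (c : k) (u : Ugl) : Ugl := Umul (Uscal c) u.
Definition Uopp (u : Ugl) : Ugl := Uscale (-1) u.

Lemma UaddE x y : Uadd (Ucl x) (Ucl y) = Ucl (UAdd x y).
Proof. by apply/Ucl_eq; apply: ueq_add; exact: repr_Ucl. Qed.
Lemma UmulE x y : Umul (Ucl x) (Ucl y) = Ucl (UMul x y).
Proof. by apply/Ucl_eq; apply: ueq_mul; exact: repr_Ucl. Qed.

Lemma UaddA : associative Uadd.
Proof.
elim/Ucl_ind=> x; elim/Ucl_ind=> y; elim/Ucl_ind=> z.
by rewrite !UaddE; apply/Ucl_eq; constructor.
Qed.
Lemma UaddC : commutative Uadd.
Proof.
elim/Ucl_ind=> x; elim/Ucl_ind=> y.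
by rewrite !UaddE; apply/Ucl_eq; apply: ueq_addC.
Qed.
Lemma Uadd0 : left_id (Uscal 0) Uadd.
Proof.
by elim/Ucl_ind=> x; rewrite UaddE; apply/Ucl_eq; constructor.
Qed.
Lemma UmulA : associative Umul.
Proof.
elim/Ucl_ind=> x; elim/Ucl_ind=> y; elim/Ucl_ind=> z.
by rewrite !UmulE; apply/Ucl_eq; constructor.
Qed.
Lemma Umul1 : left_id (Uscal 1) Umul.
Proof. by elim/Ucl_ind=> x; rewrite UmulE; apply/Ucl_eq; constructor. Qed.
Lemma UscalC c u : Umul (Uscal c) u = Umul u (Uscal c).
Proof. by elim/Ucl_ind: u => x; rewrite !UmulE; apply/Ucl_eq; constructor. Qed.
Lemma Umul1r : right_id (Uscal 1) Umul.
Proof. by move=> u; rewrite -UscalC Umul1. Qed.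
Lemma UmulDl : left_distributive Umul Uadd.
Proof.
elim/Ucl_ind=> x; elim/Ucl_ind=> y; elim/Ucl_ind=> z.
by rewrite !(UmulE, UaddE); apply/Ucl_eq; constructor.
Qed.
Lemma UmulDr : right_distributive Umul Uadd.
Proof.
elim/Ucl_ind=> x; elim/Ucl_ind=> y; elim/Ucl_ind=> z.
by rewrite !(UmulE, UaddE); apply/Ucl_eq; constructor.
Qed.
Lemma UscalD c d : Uscal (c + d) = Uadd (Uscal c) (Uscal d).
Proof. by rewrite UaddE; apply/Ucl_eq; constructor. Qed.
Lemma UscalM c d : Uscal (c * d) = Umul (Uscal c) (Uscal d).
Proof. by rewrite UmulE; apply/Ucl_eq; constructor. Qed.
Lemma UaddN : left_inverse (Uscal 0) Uopp Uadd.
Proof.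
elim/Ucl_ind=> x; rewrite /Uopp /Uscale UmulE UaddE.
by apply/Ucl_eq; constructor.
Qed.

Fixpoint ucst (x : uterm) : k :=
  match x with
  | UScal c => c
  | UGen _ => 0
  | UAdd x y => ucst x + ucst y
  | UMul x y => ucst x * ucst y
  end.

Lemma ucst_ueq x y : ueq x y -> ucst x = ucst y.
Proof.
elim=> //= *; try congruence.
- exact: addrA.
- exact: addrC.
- exact: add0r.
- by rewrite mulN1r addNr.
- exact: mulrA.
- exact: mul1r.
- exact: mulrDl.
- exact: mulrDr.
- exact: mulrC.
- by rewrite addr0.
- by rewrite mulr0.
- by rewrite mulr0 addr0.
Qed.

Lemma Uone_neq0 : Uscal 1 != Uscal 0.
Proof. by apply/eqP => /Ucl_eq/ucst_ueq/eqP; rewrite oner_eq0. Qed.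

HB.instance Definition _ := GRing.isZmodule.Build Ugl UaddA UaddC Uadd0 UaddN.
HB.instance Definition _ := GRing.Zmodule_isNzRing.Build Ugl
  UmulA Umul1 Umul1r UmulDl UmulDr Uone_neq0.

Lemma UscaleA c d u : Uscale c (Uscale d u) = Uscale (c * d) u.
Proof. by rewrite /Uscale UscalM UmulA. Qed.
Lemma UscaleDr : right_distributive Uscale +%R.
Proof. by move=> c u v; exact: UmulDr. Qed.
Lemma UscaleDl u : {morph Uscale^~ u : c d / c + d}.
Proof. by move=> c d; rewrite /Uscale UscalD; exact: UmulDl. Qed.

HB.instance Definition _ := GRing.Zmodule_isLmodule.Build k Ugl
  UscaleA Umul1 UscaleDr UscaleDl.

Lemma UscaleAl c (u v : Ugl) : c *: (u * v) = (c *: u) * v.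
Proof. exact: UmulA. Qed.
HB.instance Definition _ := GRing.Lmodule_isLalgebra.Build k Ugl UscaleAl.

Lemma UscaleAr c (u v : Ugl) : c *: (u * v) = u * (c *: v).
Proof.
by rewrite UscaleAl; rewrite -[c *: u]/(Umul _ _) UscalC; apply/esym/UmulA.
Qed.
HB.instance Definition _ := GRing.Lalgebra_isAlgebra.Build k Ugl UscaleAr.

End Enveloping.

(** * Modules *)

Section DirectSum.
Variables (k : fieldType) (V : lmodType k) (I : choiceType).

(** [V] is the direct sum of the subspaces [W i]. *)
Definition internal_dsum (W : I -> set V) : Prop :=
  forall v : V, exists! u : I -> V,
    [/\ forall i, W i (u i), finite_set [set i | u i <> 0]
      & v = \sum_(i \in [set: I]) u i].

End DirectSum.

(** Categories, functors, and their restriction to full subcategories. *)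

Record category : Type := Category {
  ob :> Type;
  hom : ob -> ob -> Type;
  idh : forall x, hom x x;
  comph : forall x y z, hom y z -> hom x y -> hom x z;
  comph1 : forall x y (f : hom x y), comph f (idh x) = f;
  comp1h : forall x y (f : hom x y), comph (idh y) f = f;
  comphA : forall x y z w (h : hom z w) (g : hom y z) (f : hom x y),
    comph h (comph g f) = comph (comph h g) f
}.

Record functor (C D : category) : Type := Functor {
  Fob :> C -> D;
  Fhom : forall x y, hom x y -> hom (Fob x) (Fob y);
  Fid : forall x, Fhom (idh x) = idh (Fob x);
  Fcomp : forall x y z (g : hom y z) (f : hom x y),
    Fhom (comph g f) = comph (Fhom g) (Fhom f)
}.

Definition full_subcategory (C : category) (P : C -> Prop) : category :=
  @Category {x : C | P x} (fun x y => hom (sval x) (sval y))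
    (fun x => idh (sval x)) (fun x y z g f => comph g f)
    (fun x y f => comph1 f) (fun x y f => comp1h f)
    (fun x y z w h g f => comphA h g f).

Definition restrict_functor (C D : category) (F : functor C D)
    (P : C -> Prop) (Q : D -> Prop) (PQ : forall x, P x -> Q (F x)) :
  functor (full_subcategory P) (full_subcategory Q) :=
  @Functor (full_subcategory P) (full_subcategory Q)
    (fun x => exist _ (F (sval x)) (PQ _ (svalP x)))
    (fun x y f => Fhom F f) (fun x => Fid F (sval x))
    (fun x y z g f => Fcomp F g f).

Definition fully_faithful (C D : category) (F : functor C D) : Prop :=
  forall x y : C, bijective (@Fhom C D F x y).

Section Modules.
Variables (k : fieldType) (t : k) (n : nat).

Local Notation L := (Lambda t n).
Local Notation S := (Salg t n).
Local Notation U := (Ugl k n.+1).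

Record Sstruct (V : lmodType k) : Type := MkSstruct {
  sact : S -> V -> V;
  sact_linl : forall c a b v, sact (c *: a + b) v = c *: sact a v + sact b v;
  sact_linr : forall c a v w, sact a (c *: v + w) = c *: sact a v + sact a w;
  sactM : forall a b v, sact (Salg_mul a b) v = sact a (sact b v);
  sact_dsum : internal_dsum (fun b : L => range (sact (Salg_id b)))
}.

Record Ustruct (V : lmodType k) : Type := MkUstruct {
  uact : U -> V -> V;
  uact_linl : forall c a b v, uact (c *: a + b) v = c *: uact a v + uact b v;
  uact_linr : forall c a v w, uact a (c *: v + w) = c *: uact a v + uact a w;
  uact1 : forall v, uact 1 v = v;
  uactM : forall a b v, uact (a * b) v = uact a (uact b v)
}.

Record Smod : Type := MkSmod { scar :> lmodType k; sstr : Sstruct scar }.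
Record Umod : Type := MkUmod { ucar :> lmodType k; ustr : Ustruct ucar }.

Record Shom (M N : Smod) : Type := MkShom {
  sfunction :> M -> N;
  shom_linear : linear sfunction;
  shom_act : forall a m,
    sfunction (sact (sstr M) a m) = sact (sstr N) a (sfunction m)
}.

Record Uhom (M N : Umod) : Type := MkUhom {
  ufunction :> M -> N;
  uhom_linear : linear ufunction;
  uhom_act : forall a m,
    ufunction (uact (ustr M) a m) = uact (ustr N) a (ufunction m)
}.

Lemma ShomP (M N : Smod) (f g : Shom M N) : f =1 g -> f = g.
Proof.
case: f g => [f fl fa] [g gl ga] /= /funext fg; subst g.
by congr MkShom; exact: Prop_irrelevance.
Qed.

Lemma UhomP (M N : Umod) (f g : Uhom M N) : f =1 g -> f = g.
Proof.
case: f g => [f fl fa] [g gl ga] /= /funext fg; subst g.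
by congr MkUhom; exact: Prop_irrelevance.
Qed.

Definition Shom_id (M : Smod) : Shom M M :=
  @MkShom M M id (fun _ _ _ => erefl) (fun _ _ => erefl).

Definition Uhom_id (M : Umod) : Uhom M M :=
  @MkUhom M M id (fun _ _ _ => erefl) (fun _ _ => erefl).

Lemma Shom_comp_linear (M N P : Smod) (g : Shom N P) (f : Shom M N) :
  linear (g \o f).
Proof. by move=> c v w /=; rewrite !shom_linear. Qed.
Lemma Shom_comp_act (M N P : Smod) (g : Shom N P) (f : Shom M N) a m :
  (g \o f) (sact (sstr M) a m) = sact (sstr P) a ((g \o f) m).
Proof. by rewrite /= !shom_act. Qed.
Lemma Uhom_comp_linear (M N P : Umod) (g : Uhom N P) (f : Uhom M N) :
  linear (g \o f).
Proof. by move=> c v w /=; rewrite !uhom_linear. Qed.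
Lemma Uhom_comp_act (M N P : Umod) (g : Uhom N P) (f : Uhom M N) a m :
  (g \o f) (uact (ustr M) a m) = uact (ustr P) a ((g \o f) m).
Proof. by rewrite /= !uhom_act. Qed.

Definition Shom_comp (M N P : Smod) (g : Shom N P) (f : Shom M N) :
  Shom M P := MkShom (Shom_comp_linear g f) (Shom_comp_act g f).

Lemma Shom_comp1 (M N : Smod) (f : Shom M N) : Shom_comp f (Shom_id M) = f.
Proof. exact: ShomP. Qed.
Lemma Shom_1comp (M N : Smod) (f : Shom M N) : Shom_comp (Shom_id N) f = f.
Proof. exact: ShomP. Qed.
Lemma Shom_compA (M N P Q : Smod) (h : Shom P Q) (g : Shom N P)
    (f : Shom M N) :
  Shom_comp h (Shom_comp g f) = Shom_comp (Shom_comp h g) f.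
Proof. exact: ShomP. Qed.

Definition Smod_cat : category :=
  Category Shom_comp1 Shom_1comp Shom_compA.

Definition Uhom_comp (M N P : Umod) (g : Uhom N P) (f : Uhom M N) :
  Uhom M P := MkUhom (Uhom_comp_linear g f) (Uhom_comp_act g f).

Lemma Uhom_comp1 (M N : Umod) (f : Uhom M N) : Uhom_comp f (Uhom_id M) = f.
Proof. exact: UhomP. Qed.
Lemma Uhom_1comp (M N : Umod) (f : Uhom M N) : Uhom_comp (Uhom_id N) f = f.
Proof. exact: UhomP. Qed.
Lemma Uhom_compA (M N P Q : Umod) (h : Uhom P Q) (g : Uhom N P)
    (f : Uhom M N) :
  Uhom_comp h (Uhom_comp g f) = Uhom_comp (Uhom_comp h g) f.
Proof. exact: UhomP. Qed.

Definition Umod_cat : category :=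
  Category Uhom_comp1 Uhom_1comp Uhom_compA.

(** Every element of a module over the non-unital algebra S(n.+1, t) is of the
    form [a m], so the submodule generated by the [g i] is the sum of the
    [S g i]. *)
Definition Smod_fg (M : Smod) : Prop :=
  exists (r : nat) (g : 'I_r -> M), forall m, exists a : 'I_r -> S,
    m = \sum_(i < r) sact (sstr M) (a i) (g i).

Definition Umod_fg (M : Umod) : Prop :=
  exists (r : nat) (g : 'I_r -> M), forall m, exists a : 'I_r -> U,
    m = \sum_(i < r) uact (ustr M) (a i) (g i).

(** [chi] stands for the weight sum_i chi_i eps_i of the diagonal matrices. *)
Definition weight_space (M : Umod) (chi : {ffun 'I_n.+1 -> k}) : set M :=
  [set v | forall h : 'rV[k]_n.+1,
     uact (ustr M) (Ugen (diag_mx h)) v = (\sum_i chi i * h 0 i) *: v].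

Definition Pcat (M : Umod) : Prop :=
  [/\ Umod_fg M, internal_dsum (weight_space (M := M))
    & forall chi (v : M), weight_space chi v -> v <> 0 ->
        exists b : L, forall i, chi i = wt b i].

(** ** The inflation functor *)

(** For [i : 'I_n], [lo i] and [hi i] are the positions i and i + 1. *)
Definition lo (i : 'I_n) : 'I_n.+1 := widen_ord (leqnSn n) i.
Definition hi (i : 'I_n) : 'I_n.+1 := lift ord0 i.

Definition gl_e (i : 'I_n) : U := Ugen (delta_mx (lo i) (hi i)).
Definition gl_f (i : 'I_n) : U := Ugen (delta_mx (hi i) (lo i)).

Definition add_root (i : 'I_n) (b c : L) : Prop :=
  forall j, wt c j = wt b j + ((j == lo i)%:R - (j == hi i)%:R).

Definition qdiag (i : 'I_n) (l : L) : 'M[k]_n.+1 :=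
  diag_mx (\row_j (wt l j - (j == hi i)%:R)).
Definition qplus (i : 'I_n) (l : L) := qdiag i l + delta_mx (lo i) (hi i).
Definition qminus (i : 'I_n) (l : L) := qdiag i l + delta_mx (hi i) (lo i).

Record is_inflation (M : Smod) (W : Ustruct M) : Prop := IsInflation {
  inflation_h : forall (b : L) m (h : 'rV[k]_n.+1),
    range (sact (sstr M) (Salg_id b)) m ->
    uact W (Ugen (diag_mx h)) m = (\sum_i wt b i * h 0 i) *: m;
  inflation_e : forall (b : L) m i, range (sact (sstr M) (Salg_id b)) m ->
    (forall c, add_root i b c ->
       uact W (gl_e i) m = sact (sstr M) (xi c b (qplus i b)) m) /\
    ((forall c, ~ add_root i b c) -> uact W (gl_e i) m = 0);
  inflation_f : forall (b : L) m i, range (sact (sstr M) (Salg_id b)) m ->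
    (forall c, add_root i c b ->
       uact W (gl_f i) m = sact (sstr M) (xi c b (qminus i c)) m) /\
    ((forall c, ~ add_root i c b) -> uact W (gl_f i) m = 0)
}.

Section Inflation.
Variables (W : forall M : Smod, Ustruct M)
  (H : forall (M N : Smod) (f : Shom M N) u m,
     f (uact (W M) u m) = uact (W N) u (f m)).

Definition inflation_hom (M N : Smod) (f : Shom M N) :
    Uhom (MkUmod (W M)) (MkUmod (W N)) :=
  @MkUhom (MkUmod (W M)) (MkUmod (W N)) f (@shom_linear M N f) (H f).

Lemma inflation_id (M : Smod) :
  inflation_hom (Shom_id M) = Uhom_id (MkUmod (W M)).
Proof. exact: UhomP. Qed.
Lemma inflation_comp (M N P : Smod) (g : Shom N P) (f : Shom M N) :
  inflation_hom (Shom_comp g f) = Uhom_comp (inflation_hom g) (inflation_hom f).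
Proof. exact: UhomP. Qed.

(** The functor that is [M |-> W M] on objects and the identity on the
    underlying linear maps. *)
Definition inflation : functor Smod_cat Umod_cat :=
  @Functor Smod_cat Umod_cat (fun M => MkUmod (W M)) inflation_hom
    inflation_id inflation_comp.

End Inflation.

End Modules.

(* Main.v *)
(** A point of X^b is a colouring of Omega by 1, ..., n in which colour i >= 2
    occurs b_i times, and E_{i,j}, for i <> j, acts through the indicator of the
    pairs (z, x) such that z is obtained from x by giving one point of colour j the
    colour i.  In a composite of two such kernels, the pairs of distinct recoloured
    points do not depend on the order of the factors; the remaining ones, where the
    same point is recoloured twice, give the bracket of gl_n, because the set of
    colourings obtained from x by recolouring a point of colour j has measure b_j
    even if j = 1.  Hence S(n, t)-modules are gl_n-modules.

    Conversely the products of the matrix units span: if (z, x) differ at m points,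
    one of them having colours (i, j), then composing E_{i,j} with the orbit of the
    pair where this difference has been undone gives a nonzero multiple of the orbit
    of (z, x) plus a combination of orbits at distance less than m.  In
    characteristic zero weights are separated by U(h), so every element of S(n, t)
    acts on a given vector as an element of U(gl_n).  This gives both finite
    generation of the inflation and fullness. *)

From HB Require Import structures.
From mathcomp Require Import all_boot all_algebra finmap zify.
From mathcomp Require Import mathcomp_extra boolp classical_sets functions.
From mathcomp Require Import cardinality fsbigop.
Require Import Defs.

Set Implicit Arguments.
Unset Strict Implicit.
Unset Printing Implicit Defensive.

Import GRing.Theory Num.Theory.

Local Open Scope classical_set_scope.
Local Open Scope ring_scope.
Local Open Scope card_scope.

(** * Colourings of Omega with finitely many points off the default colour *)

(** The matrix unit E_{i,j} is not itself an element of S(n, t): it would be a sum over all weights,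
    in general infinitely many. Its action is therefore defined weight by weight. Conversely,
    [realized b a] asks for one [u] in U(gl_n) that works on the weight space of [b] in every module
    simultaneously; this uniformity makes a gl_n-map commute with S(n, t), because the same [u] acts
    on source and target. Only two kinds of measure are computed: cardinals of finite sets, and the
    measure of all one-point recolourings of a fixed [x], where the counting polynomial may have
    degree one and [t] enters. In a commutator the second kind occurs only at the entries with z =
    x, where it gives the Cartan part of the bracket; for z <> x there are finitely many
    intermediate colourings. The inflation is prescribed on h, the e_i and the f_i only, but their
    brackets yield all of gl_n, so the structure built from all matrix units is the only one that
    satisfies [is_inflation]. *)

Section Colourings.

Lemma Sinf_of_bij (g : nat -> nat) :
  injective g -> (forall w, exists v, g v = w) -> exists s : Sinf, s =1 g.
Proof.
move=> gI /boolp.choice[h hK].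
by exists (@MkSinf g h (fun v => gI _ _ (hK (g v))) hK).
Qed.

(** Bijections between the classes of equal colour glue to a permutation of Omega. *)
Lemma recolouring_perm (I : Type) (c c' : nat -> I) :
    (forall i, [set w | c w = i] #= [set w | c' w = i]) ->
  exists g : Sinf, forall w, c' (g w) = c w.
Proof.
move=> cc'; have /boolp.choice[f fP] i : exists f : nat -> nat,
    set_bij [set w | c w = i] [set w | c' w = i] f.
  exact/card_set_bijP.
have fc w : c' (f (c w) w) = c w by have [+ _ _] := fP (c w); apply.
have [||s sE] := @Sinf_of_bij (fun w => f (c w) w); last 1 first.
- by exists s => w; rewrite sE.
- move=> v w e; have vw : c v = c w by rewrite -fc e fc.
  have [_ fI _] := fP (c w); apply: fI; rewrite ?inE//=.
  by rewrite -{1}vw.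
move=> w; have [_ _ /(_ w erefl)[v /= cv <-]] := fP (c' w).
by exists v; rewrite cv.
Qed.

(** A sum of booleans rather than a cardinal, so that a change at one point affects a single term of
    a big operator. *)
Definition count_below (p : nat) (P : pred nat) : nat := (\sum_(w < p) P w)%N.

Lemma card_seq (T : choiceType) (s : seq T) :
  uniq s -> [set x | x \in s] #= `I_(size s).
Proof.
move=> us; rewrite -(undup_id us) -card_fseq -/(`I_ _).
have -> : [set x | x \in undup s] = [set` [fset x in s]%fset].
  by apply/seteqP; split=> x /=; rewrite mem_undup inE.
exact/card_eq_fsetP.
Qed.

Lemma card_below (P : pred nat) (p : nat) :
  (forall w, P w -> (w < p)%N) -> [set w | P w] #= `I_(count_below p P).
Proof.
move=> Pp; have -> : count_below p P = size (filter P (iota 0 p)).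
  rewrite size_filter -sum1_count big_mkcond /= /count_below.
  rewrite -(big_mkord xpredT (fun w => nat_of_bool (P w))) /index_iota subn0.
  by apply: eq_bigr => w _; case: (P w).
have -> : [set w | P w] = [set w | w \in filter P (iota 0 p)].
  apply/seteqP; split=> w /=; rewrite mem_filter mem_iota /=.
    by move=> Pw; rewrite Pw Pp.
  by case/andP.
by apply: card_seq; rewrite filter_uniq // iota_uniq.
Qed.


Definition supported (I : Type) (i0 : I) (p : nat) (c : nat -> I) : Prop :=
  forall w, (p <= w)%N -> c w = i0.

Lemma supported_leq (I : Type) (i0 : I) p q (c : nat -> I) :
  (p <= q)%N -> supported i0 p c -> supported i0 q c.
Proof. by move=> pq cp w qw; apply: cp; apply: leq_trans qw. Qed.

Lemma card_supported_default (I : Type) (i0 : I) p (c : nat -> I) :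
  supported i0 p c -> [set w | c w = i0] #= [set: nat].
Proof.
move=> cp; apply: eq_card_nat; first exact: countableP.
move=> /finite_set_nat_bound[N cN].
by have /= := cN (maxn N p) (cp _ (leq_maxr _ _)); rewrite ltnNge leq_maxl.
Qed.

(** The default class is countably infinite for both colourings, so the sizes of the finite classes
    decide. *)
Lemma recolouring_below (I : eqType) (i0 : I) p (c c' : nat -> I) :
    supported i0 p c -> supported i0 p c' ->
    (forall i, i != i0 ->
      count_below p (fun w => c w == i) = count_below p (fun w => c' w == i)) ->
  exists g : Sinf, forall w, c' (g w) = c w.
Proof.
move=> cp cp' cc'; apply: recolouring_perm => i.
have [->|ni] := eqVneq i i0.
  apply: (card_eq_trans (card_supported_default cp)).
  by rewrite card_eq_sym; exact: card_supported_default cp'.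
have cardE (d : nat -> I) : supported i0 p d ->
    [set w | d w = i] #= `I_(count_below p (fun w => d w == i)).
  move=> dp; have -> : [set w | d w = i] = [set w | d w == i].
    by apply/seteqP; split=> w /= /eqP.
  apply: card_below => w; apply: contraTT; rewrite -leqNgt => /dp->.
  by rewrite eq_sym.
by rewrite (card_eqr (cardE _ cp')) -cc'//; exact: cardE.
Qed.

Definition upd (I : Type) (c : nat -> I) (w : nat) (a : I) : nat -> I :=
  fun v => if v == w then a else c v.

End Colourings.

(** * Points of X^b as colourings with prescribed class sizes *)

Section Cosets.
Variables (k : fieldType) (t : k) (n : nat).
Local Notation L := (Lambda t n).
Local Notation I := 'I_n.+1.

(** The colouring of the coset of 1: its classes are the blocks of [b]. *)
Definition base (b : L) (w : nat) : I :=
  if [pick j : 'I_n | (\sum_(i < n | (i < j)%N) wtail b i <= w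
            < \sum_(i < n | (i <= j)%N) wtail b i)%N] is Some j
  then lift ord0 j else ord0.

Lemma tail_block_uniq (b : L) (i j : 'I_n) w :
  tail_block b i w -> tail_block b j w -> i = j.
Proof.
have ltF (u v : 'I_n) : tail_block b u w -> tail_block b v w -> ~~ (u < v)%N.
  move=> /andP[_ wu] /andP[wv _]; apply/negP => uv.
  have := leq_trans wu (leq_trans _ wv); rewrite ltnn => H.
  apply: notF; apply: H; rewrite [leqRHS](bigID (fun i : 'I_n =>
    (i <= u)%N)) /=.
  apply: leq_trans (leq_addr _ _); rewrite leq_eqVlt; apply/orP; left;
    apply/eqP.
  apply: eq_bigl => l; case: (leqP l u) => [lu|]; last by rewrite andbF.
  by rewrite (leq_ltn_trans lu uv).
move=> bi bj; apply/val_inj/eqP.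
by rewrite eqn_leq leqNgt ltF // leqNgt ltF.
Qed.

Lemma blockP (b : L) i w : block b i w <-> base b w = i.
Proof.
rewrite /block /base; case: pickP => [j bj|bN]; case: unliftP => [l ->|->].
- split=> [bl|/lift_inj<-//]; congr lift; exact: tail_block_uniq bl.
- by split=> [[]|//]; exists j.
- by split=> // bl; have := bN l; move: bl; rewrite /tail_block /= => ->.
- by split=> // _ [l _]; rewrite /tail_block /= bN.
Qed.

Lemma youngP (b : L) s : young b s <-> forall w, base b (s w) = base b w.
Proof.
split=> [bs w|bs i].
  apply/blockP; rewrite -[X in X (s w)]bs; exists w => //; exact/blockP.
apply/seteqP; split=> [_ [w /blockP wi <-]|w /blockP wi].
  by apply/blockP; rewrite bs.
exists (s^-1%g w); last by rewrite /= sinvK.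
by apply/blockP; rewrite -bs /= sinvK.
Qed.

Definition coset_rep (b : L) (x : Xset b) : Sinf := sval (cid (svalP x)).

Lemma coset_repK (b : L) (x : Xset b) : coset b (coset_rep x) = x.
Proof.
by apply: cosetsP; rewrite /coset_rep; case: cid => s /= ->.
Qed.

(** The coset [s S_b] is encoded by the colouring of Omega that gives the points
    of [s {b}_i] the colour [i]. *)
Definition colour (b : L) (x : Xset b) (w : nat) : I :=
  base b ((coset_rep x)^-1%g w).

(** The chosen representative differs from [s] by an element of the Young subgroup, which preserves
    [base b]; so the colouring depends on the coset alone. *)
Lemma colour_coset (b : L) s w :
  colour (coset b s : Xset b) w = base b (s^-1%g w).
Proof.
rewrite /colour; set u := coset_rep _.
have : young_coset u b s.
  have -> : young_coset u b = young_coset s b.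
    exact: (congr1 (fun A : Xset b =>
      sval A) (coset_repK (coset b s : Xset b))).
  by exists 1%g; [exact: young1|rewrite mulg1].
move=> [v /youngP vb <-].
by rewrite invgM SinfM -[in RHS]vb /= sinvK.
Qed.

Lemma colour_fact (b : L) (g : Sinf) (x : Xset b) w :
  colour (fact g x) w = colour x (g^-1%g w).
Proof.
rewrite -{1}(coset_repK x) [fact _ _]coset_act_coset colour_coset.
by rewrite invgM.
Qed.

Lemma colour_inj (b : L) (x y : Xset b) : colour x =1 colour y -> x = y.
Proof.
move=> xy; rewrite -(coset_repK x) -(coset_repK y).
set s := coset_rep x; set u := coset_rep y.
have -> : u = (s * (s^-1 * u))%g by rewrite mulgA mulgV mul1g.
rewrite coset_young//; apply/youngP => w; have := xy (u w).
by rewrite /colour -/s -/u /= sfunK.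
Qed.

(** Only the finite classes are prescribed; the head coordinate is forced by the total [t]. *)
Definition has_weight (c : nat -> I) (b : L) : Prop :=
  forall j, [set w | c w = lift ord0 j] #= `I_(wtail b j).

Lemma base_weight (b : L) : has_weight (base b) b.
Proof.
move=> j; pose m := (\sum_(i < n | (i < j)%N) wtail b i)%N.
have mE : (\sum_(i < n | (i <= j)%N) wtail b i = wtail b j + m)%N.
  rewrite (bigD1 j)//=; congr addn; apply: eq_bigl => i.
  by rewrite [RHS]ltn_neqAle andbC.
have -> : [set w | base b w = lift ord0 j] = `I_(wtail b j + m) `\` `I_m.
  rewrite -mE; apply/seteqP; split=> w /=.
    move=> /blockP; rewrite /block liftK /tail_block /= -/m.
    by move=> /andP[mw ->]; split=> //; apply/negP; rewrite -leqNgt.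
  move=> [wm /negP]; rewrite -leqNgt => mw; apply/blockP.
  by rewrite /block liftK /tail_block /= mw.
by have := @card_IID (wtail b j + m)%N m; rewrite addnK.
Qed.

Lemma colour_weight (b : L) (x : Xset b) : has_weight (colour x) b.
Proof.
move=> j; rewrite -(card_eqr (base_weight b j)).
have -> : [set w | colour x w = lift ord0 j]
    = coset_rep x @` [set w | base b w = lift ord0 j].
  apply/seteqP; split=> [w /= xw|_ [w bw <-]];
    last by rewrite /= /colour /= sfunK.
  by exists ((coset_rep x)^-1%g w) => //=; rewrite sinvK.
exact/card_inj_image/(can_inj (@sfunK _)).
Qed.

Lemma has_weight_supported c (b : L) :
  has_weight c b -> exists p, supported ord0 p c.
Proof.
move=> cb; have : finite_set (\bigcup_(j in [set: 'I_n]) [set w | c w =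
  lift ord0 j]).
  apply: bigcup_finite => // j _; apply/finite_setP; exists (wtail b j);
    exact: cb.
move=> /finite_set_nat_bound[p cp]; exists p => w pw.
case: (unliftP ord0 (c w)) => [j cj|//].
have /cp wp : (\bigcup_(j in [set: 'I_n]) [set w | c w = lift ord0 j]) w.
  by exists j.
by move: pw; rewrite leqNgt wp.
Qed.

Lemma has_weight_below c (b : L) p :
  supported ord0 p c -> (has_weight c b <->
    forall j, count_below p (fun w => c w == lift ord0 j) = wtail b j).
Proof.
move=> cp; have cE j : [set w | c w = lift ord0 j]
     #= `I_(count_below p (fun w => c w == lift ord0 j)).
  have -> : [set w | c w = lift ord0 j] = [set w | c w == lift ord0 j].
    by apply/seteqP; split=> w /= /eqP.
  by apply: card_below => w; apply: contraTT; rewrite -leqNgt => /cp->.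
split=> cb j; last by rewrite -cb; exact: cE.
apply/card_eq_II; rewrite -(card_eql (cE j)); exact: cb.
Qed.

Lemma colour_supported (b : L) (x : Xset b) :
  exists p, supported ord0 p (colour x).
Proof. exact/has_weight_supported/colour_weight. Qed.

Lemma colour_below (b : L) (x : Xset b) p j :
  supported ord0 p (colour x) ->
  count_below p (fun w => colour x w == lift ord0 j) = wtail b j.
Proof. by move=> xp; apply: (has_weight_below b xp).1;
  exact: colour_weight. Qed.

(** Colourings with the same finite class sizes are conjugate, so each one is a translate of
    [base b], that is, a coset. *)
Lemma has_weight_colour c (b : L) :
  has_weight c b -> exists x : Xset b, colour x =1 c.
Proof.
move=> cb; have [p cp] := has_weight_supported cb.
have [q bq] := has_weight_supported (base_weight b).
have [||i|g gE] := @recolouring_below _ ord0 (maxn p q) c (base b).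
- exact: supported_leq (leq_maxl _ _) cp.
- exact: supported_leq (leq_maxr _ _) bq.
- case: (unliftP ord0 i) => [j -> _|-> /eqP//].
  rewrite ((has_weight_below b (supported_leq (leq_maxl _ _) cp)).1 cb).
  by rewrite ((has_weight_below b (supported_leq (leq_maxr _ _) bq)).1
    (base_weight b)).
exists (coset b g^-1%g : Xset b) => w; rewrite colour_coset invgK; exact: gE.
Qed.

Lemma colouring_has_weight c p : supported ord0 p c -> exists b, has_weight c b.
Proof.
move=> cp; pose u := [ffun j : 'I_n => count_below p (fun w =>
  c w == lift ord0 j)].
have hi : exists z : int, t - \sum_(i < n) (u i)%:R = t - z%:~R.
  by exists (\sum_(i < n) u i)%N; rewrite -natr_sum.
have hs : t - \sum_(i < n) (u i)%:R + \sum_(i < n) (u i)%:R =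
  t by rewrite subrK.
exists (MkLambda hi hs); apply/(has_weight_below _ cp) => j /=.
by rewrite ffunE.
Qed.

End Cosets.

(** * Change of weight when one point is recoloured *)

Section Weights.
Variables (k : fieldType) (hk : [pchar k] =i pred0) (t : k) (n : nat).
Local Notation L := (Lambda t n).
Local Notation I := 'I_n.+1.

Lemma natr_inj_pchar0 : injective (fun m : nat => m%:R : k).
Proof.
suff H (a b : nat) : (a <= b)%N -> a%:R = b%:R :> k -> a = b.
  move=> a b e; case: (leqP a b) => [ab|/ltnW ba]; first exact: H.
  by apply/esym/H.
move=> ab /esym/eqP; rewrite -subr_eq0 -natrB // ((pcharf0P k).1 hk) => e.
by apply/eqP; rewrite eqn_leq ab.
Qed.

(** [R] sees the position as well as the colour, so this count serves for colours, for pairs with a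
    second colouring and for distances. The additive form avoids truncated subtraction. *)
Lemma below_upd_rel (J : Type) (R : J -> nat -> bool) (c : nat -> J) p w a :
  (w < p)%N ->
  (count_below p (fun v => R (upd c w a v) v) + R (c w) w =
   count_below p (fun v => R (c v) v) + R a w)%N.
Proof.
move=> wp; rewrite /count_below (bigD1 (Ordinal wp)) //= [in RHS](bigD1
  (Ordinal wp)) //=.
rewrite {1}/upd eqxx (eq_bigr (fun v : 'I_p => R (c v) v : nat)); last first.
  by move=> v; rewrite /upd -val_eqE /= => /negPf->.
by rewrite addnAC -addnA addnC.
Qed.

Lemma below_upd (J : eqType) (c : nat -> J) p w a i : (w < p)%N ->
  (count_below p (fun v => upd c w a v == i) + (c w == i) =
   count_below p (fun v => c v == i) + (a == i))%N.
Proof. exact: (below_upd_rel (fun b _ => b == i)). Qed.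

Lemma below_supported (J : eqType) (i0 : J) (c : nat -> J) p q i :
  (p <= q)%N -> supported i0 p c ->
  count_below q (fun v => c v == i) =
    (count_below p (fun v => c v == i) + (i0 == i) * (q - p))%N.
Proof.
move=> /subnK<- cp; rewrite addnK; move: (q - p)%N => m.
rewrite addnC /count_below big_split_ord /=; congr addn.
rewrite (eq_bigr (fun=> (i0 == i) : nat)); last by move=> v _;
  rewrite cp ?leq_addr.
by rewrite sum_nat_const card_ord mulnC.
Qed.

Lemma below_total (c : nat -> I) p :
  (\sum_a count_below p (fun v => c v == a))%N = p.
Proof.
rewrite /count_below exchange_big /= -[RHS]card_ord -sum1_card.
by apply: eq_bigr => v _; rewrite -big_mkcond /= (big_pred1 (c v)) // => a;
  rewrite eq_sym.
Qed.

(** One formula for all coordinates: the window below [p] has [p] points, and Omega behaves as a set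
    of size [t] whose remaining [t - p] points have the default colour. *)
Lemma has_weight_wt c (b : L) p : supported ord0 p c -> (has_weight c b <->
  forall a, wt b a = (count_below p (fun v =>
    c v == a))%:R + (a == ord0)%:R * (t - p%:R)).
Proof.
move=> cp; rewrite (has_weight_below _ cp); split=> cb; last first.
  move=> j; apply: natr_inj_pchar0; have := cb (lift ord0 j).
  by rewrite /wt liftK mul0r addr0.
move=> a; rewrite /wt; case: unliftP => [j ->|->];
  first by rewrite cb mul0r addr0.
have pE : p%:R = (count_below p (fun v => c v == ord0))%:R
    + \sum_(j < n) (wtail b j)%:R :> k.
  rewrite -{1}(below_total c p) (big_ord_recl n) natrD -natr_sum.
  by congr (_ + _%:R); apply: eq_bigr => j _; exact: cb.
rewrite eqxx mul1r pE -[X in _ + (X - _)](wsum b) opprD addrACA subrr addr0.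
by rewrite addrCA subrr addr0.
Qed.

Lemma colour_wt (b : L) (x : Xset b) p a : supported ord0 p (colour x) ->
  wt b a = (count_below p (fun v =>
    colour x v == a))%:R + (a == ord0)%:R * (t - p%:R).
Proof. by move=> /has_weight_wt H; apply H; exact: colour_weight. Qed.

Lemma wt_inj (b c : L) : wt b =1 wt c -> b = c.
Proof.
move=> bc; apply: LambdaP; apply/ffunP => j; apply: natr_inj_pchar0.
by have := bc (lift ord0 j); rewrite /wt liftK.
Qed.

Definition shifted (i j : I) (b c : L) : Prop :=
  forall a, wt c a = wt b a + ((a == i)%:R - (a == j)%:R).

Definition step (i j : I) (z x : nat -> I) : Prop :=
  exists w, x w = j /\ z = upd x w i.

Lemma shifted_uniq i j b c c' : shifted i j b c -> shifted i j b c' -> c = c'.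
Proof. by move=> bc bc'; apply: wt_inj => a; rewrite bc bc'. Qed.

Lemma upd_supported (c : nat -> I) p w a :
  (w < p)%N -> supported ord0 p c -> supported ord0 p (upd c w a).
Proof.
move=> wp cp v pv; rewrite /upd; case: eqP => [e|_]; last exact: cp.
by move: pv; rewrite e leqNgt wp.
Qed.

Lemma upd_wt (c : nat -> I) p w i j a : (w < p)%N -> c w = j ->
  (count_below p (fun v => upd c w i v == a))%:R =
  (count_below p (fun v => c v == a))%:R + ((a == i)%:R - (a == j)%:R) :> k.
Proof.
move=> wp cj; have /(congr1 (fun m => m%:R : k)) := below_upd c i a wp.
rewrite !natrD cj (eq_sym a i) (eq_sym a j) => e.
by rewrite addrA -e addrK.
Qed.

Lemma has_weight_upd c (b d : L) w i j :
  has_weight c b -> c w = j -> (has_weight (upd c w i) d <-> shifted i j b d).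
Proof.
move=> cb cj; have [p0 cp0] := has_weight_supported cb.
pose p := maxn p0 w.+1; have wp : (w < p)%N by rewrite leq_max leqnn orbT.
have cp : supported ord0 p c by apply: supported_leq cp0; rewrite leq_maxl.
have /= H := (has_weight_wt _ cp).1 cb.
rewrite (has_weight_wt _ (upd_supported i wp cp)); split=> H' a.
  by rewrite H' H (upd_wt _ _ wp cj) addrAC.
by rewrite H' H (upd_wt _ _ wp cj) addrAC.
Qed.

Lemma step_shifted i j b d (z : Xset d) (x : Xset b) :
  step i j (colour z) (colour x) -> shifted i j b d.
Proof.
move=> [w [xw zE]]; apply/(has_weight_upd _ _ (colour_weight x) xw).
by rewrite -zE; exact: colour_weight.
Qed.

Lemma shifted_colour i j b d (x : Xset b) w : shifted i j b d ->
  colour x w = j -> exists z : Xset d, colour z = upd (colour x) w i.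
Proof.
move=> bd xw; have [|z zE] := @has_weight_colour _ t n (upd (colour x) w i) d.
  exact/(has_weight_upd _ _ (colour_weight x) xw).
by exists z; exact/funext.
Qed.

Lemma exists_shifted i j b (x : Xset b) w : colour x w = j ->
  exists d : L, shifted i j b d.
Proof.
move=> xw; have [p0 xp0] := colour_supported x.
have [|d dP] := @colouring_has_weight k t n (upd (colour x) w i) (maxn p0 w.+1).
  apply: upd_supported; first by rewrite leq_max leqnn orbT.
  by apply: supported_leq xp0; rewrite leq_maxl.
by exists d; apply/(has_weight_upd _ _ (colour_weight x) xw).
Qed.

(** The default colour always occurs far out, so a missing colour is a tail colour with count 0.
    Together with [exists_shifted] this makes formulas vanish when there is no target weight. *)
Lemma wt_eq0 (b : L) (x : Xset b) l : (forall w, colour x w <> l) -> wt b l = 0.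
Proof.
move=> xl; have [p xp] := colour_supported x; rewrite (colour_wt _ xp).
have l0 : l != ord0 by apply/eqP => l0; apply: (xl p); rewrite l0 xp.
rewrite (negPf l0) mul0r addr0 /count_below big1 // => w _.
by apply/eqP; rewrite eqb0; apply/eqP/xl.
Qed.

End Weights.

(** * Values of the measure *)

Section MeasureValues.
Variables (k : fieldType) (t : k).

(** The difference vanishes at all integers beyond both thresholds, hence has at least as many roots
    as its size. *)
Lemma counting_poly_uniq (X : finitary) (A : set X) P Q :
  counting_poly A P -> counting_poly A Q -> P = Q.
Proof.
move=> [N NP] [M MQ]; apply/eqP; rewrite -subr_eq0; apply/eqP.
pose K := maxn N M; set R := P - Q.
apply: (@roots_geq_poly_eq0 _ R (mkseq (fun i => (K + i)%:R) (size R))).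
- apply/allP => _ /mapP[i _ ->]; rewrite rootE hornerD hornerN.
  have [|m mA ->] := NP (K + i)%N;
    first by rewrite (leq_trans (leq_maxl N M)) ?leq_addr.
  have [|m' mA' ->] := MQ (K + i)%N;
    first by rewrite (leq_trans (leq_maxr N M)) ?leq_addr.
  have -> : m = m' by apply/card_eq_II; rewrite -(card_eql mA).
  by rewrite subrr.
- by apply/mkseq_uniqP => i j _ _ /eqP; rewrite eqr_nat eqn_add2l => /eqP.
- by rewrite size_mkseq.
Qed.

Lemma mu_counting (X : finitary) (A : set X) P :
  counting_poly A P -> mu t A = (map_poly ratr P).[t].
Proof.
move=> AP; rewrite /mu; case: xgetP => [Q _ AQ|/(_ P)//].
by rewrite (counting_poly_uniq AP AQ).
Qed.

Lemma mu_constant (X : finitary) (A : set X) (m : nat) :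
  counting_poly A (m%:R)%:P -> mu t A = m%:R.
Proof.
move=> /mu_counting->; have ->
  : map_poly ratr (m%:R)%:P = (m%:R)%:P :> {poly k}.
  apply/polyP => i; rewrite coef_map_id0 ?(ratr_nat _ 0)// !coefC.
  by case: eqP => _; [exact: ratr_nat|exact: (ratr_nat _ 0)].
by rewrite hornerC.
Qed.

Lemma mu_affine (X : finitary) (A : set X) (z : int) :
  counting_poly A ('X + (z%:~R)%:P) -> mu t A = t + z%:~R.
Proof.
move=> /mu_counting->.
have -> : map_poly ratr ('X + (z%:~R)%:P) = 'X + (z%:~R)%:P :> {poly k}.
  apply/polyP => i; rewrite coef_map_id0 ?(ratr_nat _ 0)// !coefD !coefC !coefX.
  case: i => [|[|i]] /=; rewrite ?mulr0n ?add0r ?addr0 ?ratr_int //.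
    exact: (ratr_nat _ 1).
  exact: (ratr_nat _ 0).
by rewrite hornerD hornerX hornerC.
Qed.

(** Smoothness gives each point a level from which on it is fixed; finiteness gives a common
    level. *)
Lemma finite_fixed_points (X : finitary) (A : set X) : finite_set A ->
  exists N, forall p, (N <= p)%N -> fixed_points A p = A.
Proof.
move=> fA; have /boolp.choice[f fP] (x : X) : exists N : nat,
    pstab `I_N `<=` [set s | fact s x = x].
  exact: (Sinf_open_pstab (@fsmooth X x) (fact1 x)).
have /finite_set_nat_bound[N NP] : finite_set (f @` A) by exact: finite_image.
exists N => p Np; apply/seteqP; split=> [x []//|x Ax]; split=> // s sp.
apply: fP => i /= ix; apply: sp => /=; apply: leq_trans Np.
by apply: ltn_trans ix (NP _ _); exists x.
Qed.

Lemma mu_finite (X : finitary) (A : set X) m : A #= `I_m -> mu t A = m%:R.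
Proof.
move=> Am; have /finite_fixed_points[N NA] : finite_set A.
  by apply/finite_setP; exists m.
by apply: mu_constant; exists N => p /NA->; exists m; rewrite ?hornerC.
Qed.

Lemma mu_set0 (X : finitary) : mu t (set0 : set X) = 0.
Proof. by rewrite (@mu_finite _ _ 0) // II0 card_eq00. Qed.

Lemma mu_set1 (X : finitary) (x : X) : mu t [set x] = 1.
Proof. by rewrite (@mu_finite _ _ 1) // card_set1. Qed.

Lemma integral_indicator (X : finitary) (A : set X) (a : k) (f : X -> k) :
  (forall x, f x = `[<A x>]%:R * a) -> integral t f = a * mu t A.
Proof.
move=> fE; have [a0|a0] := eqVneq a 0.
  rewrite a0 mul0r; apply: fsbig1 => c [x _ <-].
  by rewrite fE a0 mulr0 mul0r.
have fA : f @^-1` [set a] = A.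
  apply/seteqP; split=> x /=; rewrite fE; last by move=> /asboolT->;
    rewrite mul1r.
  by case: asboolP => // _ /eqP; rewrite mul0r eq_sym (negPf a0).
rewrite /integral (fsbig_fwiden [:: a; 0]).
- by rewrite !big_cons big_nil /= fA mul0r !addr0.
- move=> _ [x _ <-] /=; rewrite !inE fE; case: asbool;
  first by rewrite mul1r eqxx.
  by rewrite mul0r eqxx orbT.
- by rewrite /= inE a0.
move=> c [/=]; rewrite !inE => /orP[|] /eqP-> nf; last by rewrite mul0r.
(* The value [a] is not attained, so its fibre is empty. *)
suff -> : f @^-1` [set a] = set0 by rewrite mu_set0 mulr0.
by apply/seteqP; split=> // x /= fx; apply: nf; exists x.
Qed.
End MeasureValues.

Lemma card_image_in (T U : Type) (A : set T) (f : T -> U) :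
  (forall x y, A x -> A y -> f x = f y -> x = y) -> f @` A #= A.
Proof.
move=> fI; have fA : {in A &, injective f}.
  by move=> x y /set_mem Ax /set_mem Ay; exact: fI.
have [g eg] := Pinj fA.
by rewrite eg; exact: card_image.
Qed.

(** * The measure of the set of one-point recolourings *)

Section StepMeasure.
Variables (k : fieldType) (hk : [pchar k] =i pred0) (t : k) (n : nat).
Local Notation L := (Lambda t n).
Local Notation I := 'I_n.+1.

Lemma supported_fixed (b : L) (x : Xset b) p :
  supported ord0 p (colour x) <-> (forall s, pstab `I_p s -> fact s x = x).
Proof.
split=> [xp s sp|xs v pv].
  have sVp w : (w < p)%N -> s^-1%g w = w by move=> wp;
    rewrite /= -{1}(sp _ wp) sfunK.
  apply: colour_inj => w; rewrite colour_fact;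
    case: (ltnP w p) => [/sVp-> //|pw].
  rewrite (xp w pw) xp // leqNgt; apply/negP => wp.
  by move: pw; rewrite leqNgt -{1}(sinvK s w) (sp _ wp) wp.
have [q xq] := colour_supported x; case: (leqP q v) => [/xq//|vq].
(* The transposition of [v] with [q], a point where [x] has the default colour. It lies in the
   stabilizer of level [p], so it fixes [x] and carries the default colour to [v]. *)
pose f (u : nat) := if u == v then q else if u == q then v else u.
have fK : cancel f f.
  move=> u; rewrite /f; case: (eqVneq u v) => [->|uv].
    by rewrite !eqxx; case: eqP => [->|].
  case: (eqVneq u q) => [->|uq]; first by rewrite eqxx.
  by rewrite (negPf uv) (negPf uq).
have : fact (MkSinf fK fK) x = x.
  apply: xs => u /= up; rewrite /f; case: eqP => [uv|_].
    by move: pv; rewrite -uv leqNgt up.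
  by case: eqP => // uq; have := ltn_trans (leq_trans up pv) vq;
    rewrite uq ltnn.
move=> /(congr1 (fun y => colour y v)); rewrite colour_fact /= /f eqxx => <-.
exact: xq.
Qed.

Lemma upd_inj (J : eqType) (c : nat -> J) i j v w :
  i != j -> c v = j -> c w = j -> upd c v i = upd c w i -> v = w.
Proof.
move=> ij cv cw /(congr1 (fun f => f v)); rewrite /upd eqxx.
by case: eqP => // _; rewrite cv => /eqP; rewrite (negPf ij).
Qed.

(** The fixed points of level [p] are the recolourings of a point below [p]. For a tail colour their
    number is eventually constant; for the default colour it grows by one with [p], so the
    polynomial is X + m - N, whose value at [t] is the head coordinate. *)
Lemma mu_step (i j : I) (b d : L) (x : Xset b) : i != j -> shifted i j b d ->
  mu t [set y : Xset d | step i j (colour y) (colour x)] = wt b j.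
Proof.
move=> ij bd; set A := [set y | _]; have [N xN] := colour_supported x.
have /boolp.choice[F FP] (w : nat) : exists y : Xset d, colour x w = j ->
    colour y = upd (colour x) w i.
  case: (pselect (colour x w = j)) => [xw|nxw].
    by have [y yE] := shifted_colour hk bd xw; exists y.
  by exists (coset d 1%g).
have fixE p : (N <= p)%N ->
    fixed_points A p #= `I_(count_below p (fun w => colour x w == j)).
  move=> Np; have xp := supported_leq Np xN.
  pose P w := (colour x w == j) && (w < p)%N.
  have -> : count_below p (fun w => colour x w == j) = count_below p P.
    by apply: eq_bigr => w _; rewrite /P ltn_ord andbT.
  have -> : fixed_points A p = F @` [set w | P w].
    apply/seteqP; split=> [y [[w [xw yw]] /supported_fixed yp]|_ [w /andP[/eqP
      xw wp] <-]].
      have yF : F w = y by apply: colour_inj => v; rewrite FP // yw.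
      (* A recoloured point at or beyond [p] would have the default colour before and after, against
         [i != j]. *)
      exists w => //; rewrite /= /P xw eqxx /= ltnNge; apply/negP => pw.
      move: (yp w pw); rewrite yw /upd eqxx => i0.
      by move: ij; rewrite i0 -xw xp // eqxx.
    split; first by exists w; split=> //; exact: FP.
    by apply/supported_fixed; rewrite (FP _ xw); exact: upd_supported.
  rewrite (card_eql (card_image_in _)) //.
    by apply: card_below => w /andP[].
  move=> v w /andP[/eqP xv _] /andP[/eqP xw _] /(congr1 (@colour _ _ _ _)).
  by rewrite !FP //; apply: (upd_inj ij).
rewrite (colour_wt hk j xN);
  have bE p Np := below_supported (p := N) (q := p) j Np xN.
case: (eqVneq j ord0) => j0; last first.
  rewrite mul0r addr0; apply: mu_constant; exists N => p Np.
  exists (count_below p (fun w => colour x w == j)); first exact: fixE.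
  by rewrite hornerC (bE p Np) eq_sym (negPf j0) mul0n addn0.
rewrite mul1r addrCA; set m := count_below N _.
have -> : m%:R + - N%:R = (m%:Z - N%:Z)%:~R :> k by rewrite rmorphB.
apply: mu_affine; exists N => p Np.
exists (count_below p (fun w => colour x w == j)); first exact: fixE.
rewrite hornerD hornerX hornerC rmorphB /= (bE p Np).
by rewrite -/m j0 eqxx mul1n natrD natrB // addrCA.
Qed.

End StepMeasure.

(** * Products in S(n, t) *)

Section SalgTheory.
Variables (k : fieldType) (hk : [pchar k] =i pred0) (t : k) (n : nat).
Local Notation L := (Lambda t n).
Local Notation I := 'I_n.+1.

Lemma HomD (X Y : finitary) (f g : Hom k X Y) yx : (f + g) yx = f yx + g yx.
Proof. by []. Qed.

Lemma HomZ (X Y : finitary) c (f : Hom k X Y) yx : (c *: f) yx = c * f yx.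
Proof. by []. Qed.

Lemma Hom0 (X Y : finitary) yx : (0 : Hom k X Y) yx = 0.
Proof. by []. Qed.

Lemma SalgZ c (a : Salg t n) db : (c *: a) db = c *: a db.
Proof. exact: addr0. Qed.

Lemma Salg0E db : (0 : Salg t n) db = 0.
Proof. by []. Qed.

Lemma Salg_in_diag (d b : L) (f : Hom k (Xset b) (Xset d)) :
  Salg_in f (d, b) = f.
Proof. exact: (@dfwithin _ (fun x => HomX x)). Qed.

Lemma Salg_in_off (d b : L) (f : Hom k (Xset b) (Xset d)) db :
  (d, b) != db -> Salg_in f db = 0.
Proof. by move=> ne; apply: (@dfwithout _ (fun x => HomX x)). Qed.

Lemma Salg_in_linear (d b : L) c (f g : Hom k (Xset b) (Xset d)) :
  Salg_in (c *: f + g) = c *: Salg_in f + Salg_in g.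
Proof.
apply: SalgP => db; rewrite SalgD SalgZ.
have [<-|ne] := eqVneq (d, b) db; first by rewrite !Salg_in_diag.
by rewrite !Salg_in_off // scaler0 add0r.
Qed.

Lemma Salg_in0 (d b : L) : Salg_in (0 : Hom k (Xset b) (Xset d)) = 0.
Proof.
apply: SalgP => db; rewrite Salg0E.
by have [<-|ne] := eqVneq (d, b) db; rewrite ?Salg_in_diag ?Salg_in_off.
Qed.

Lemma Hom_comp_indicator (X Y Z : finitary) (g : Hom k Y Z) (f : Hom k X Y)
    (A : set Y) (a : k) (zx : Z * X) :
    (forall y, (g (zx.1, y) : k) * f (y, zx.2) = `[<A y>]%:R * a) ->
  Hom_comp t g f zx = a * mu t A.
Proof. exact: integral_indicator. Qed.

Lemma Hom_comp_idr (X Y : finitary) (f : Hom k X Y) :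
  Hom_comp t f (Hom_id k X) = f.
Proof.
apply: HomP => -[z x]; rewrite (@Hom_comp_indicator _ _ _ _ _ [set x] (f (z,
  x))).
  by rewrite mu_set1 mulr1.
move=> y /=; have [yx|yx] := pselect (y = x).
  by rewrite yx !asboolT // [LHS]mulr1 mul1r.
by rewrite !asboolF // [LHS]mulr0 mul0r.
Qed.

Lemma Hom_comp_idl (X Y : finitary) (f : Hom k X Y) :
  Hom_comp t (Hom_id k Y) f = f.
Proof.
apply: HomP => -[z x]; rewrite (@Hom_comp_indicator _ _ _ _ _ [set z] (f (z,
  x))).
  by rewrite mu_set1 mulr1.
move=> y /=; have [yz|yz] := pselect (y = z).
  by rewrite yz !asboolT.
by rewrite !asboolF // ?[LHS]mul0r ?mul0r // => /esym.
Qed.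

Lemma Salg_mulE (a : Salg t n) (b c d : L) (f : Hom k (Xset b) (Xset c)) :
  Salg_mul a (Salg_in f) (d, b) = Hom_comp t (a (d, c)) f.
Proof.
transitivity (\sum_(c' \in [set: L]) Salg_comp a (Salg_in f) (d, b) c') => //.
rewrite (fsbigE [:: c]) //; last first.
  move=> c' _; rewrite inE => c'c;
    rewrite /Salg_comp Salg_in_off ?Hom_comp0r //.
  by apply: contra c'c => /eqP[->].
rewrite big_cons big_nil in_setT; apply: etrans (addr0 _) _.
by rewrite /Salg_comp Salg_in_diag.
Qed.

Lemma Salg_mul_off (a : Salg t n) (b c d b' : L) (f : Hom k (Xset b) (Xset c)) :
  b != b' -> Salg_mul a (Salg_in f) (d, b') = 0.
Proof.
move=> bb'; apply: fsbig1 => c' _.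
rewrite /Salg_comp Salg_in_off ?Hom_comp0r //.
by apply: contra bb' => /eqP[_ ->].
Qed.

Lemma Salg_mul_in (b c d : L) (g : Hom k (Xset c) (Xset d))
    (f : Hom k (Xset b) (Xset c)) :
  Salg_mul (Salg_in g) (Salg_in f) = Salg_in (Hom_comp t g f).
Proof.
apply: SalgP => -[d' b']; have [<-|bb'] := eqVneq b b'; last first.
  rewrite Salg_mul_off // Salg_in_off //.
  by apply: contra bb' => /eqP[_ ->].
rewrite Salg_mulE; have [<-|dd'] := eqVneq d d'; first by rewrite !Salg_in_diag.
rewrite !Salg_in_off ?Hom_comp0l //; by apply: contra dd' => /eqP[->].
Qed.

Lemma Salg_mul_in_neq (b c c' d : L) (g : Hom k (Xset c) (Xset d))
    (f : Hom k (Xset b) (Xset c')) :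
  c != c' -> Salg_mul (Salg_in g) (Salg_in f) = 0.
Proof.
move=> cc'; apply: SalgP => -[d' b']; rewrite Salg0E.
have [<-|bb'] := eqVneq b b'; last by rewrite Salg_mul_off.
rewrite Salg_mulE Salg_in_off ?Hom_comp0l //.
by apply: contra cc' => /eqP[_ ->].
Qed.

Lemma Salg_in_mulid (b d : L) (f : Hom k (Xset b) (Xset d)) :
  Salg_mul (Salg_in f) (Salg_id b) = Salg_in f.
Proof. by rewrite Salg_mul_in Hom_comp_idr. Qed.

Lemma Salg_id_mulin (b d : L) (f : Hom k (Xset b) (Xset d)) :
  Salg_mul (Salg_id d) (Salg_in f) = Salg_in f.
Proof. by rewrite Salg_mul_in Hom_comp_idl. Qed.

Section Kernels.

Definition colouring := nat -> I.

(** Kernels live on colourings, so that one formula defines morphisms between all pairs of objects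
    at once. *)
Definition perm_invariant (F : colouring -> colouring -> k) : Prop :=
  forall (g : Sinf) z x, F (z \o g) (x \o g) = F z x.

Lemma kernel_subproof (F : colouring -> colouring -> k) (Fi : perm_invariant F)
    (d b : L) :
  (fun zx : Xset d * Xset b => F (colour zx.1) (colour zx.2)) \in
    @Hom_pred k (Xset b) (Xset d).
Proof.
apply/Hom_predP => s z x /=; rewrite -[RHS](Fi s^-1%g).
by congr F; apply: funext => w; rewrite colour_fact.
Qed.

Definition kernel F (Fi : perm_invariant F) (d b : L) :
  Hom k (Xset b) (Xset d) :=
  MkHom (kernel_subproof Fi d b).

Definition stepF (i j : I) (z x : colouring) : k := `[<step i j z x>]%:R.

Lemma upd_comp (c : colouring) w a (g : Sinf) :
  upd c (g w) a \o g = upd (c \o g) w a.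
Proof.
apply: funext => v; rewrite /upd /=.
by rewrite (inj_eq (can_inj (@sfunK g))).
Qed.

Lemma step_comp_perm i j (z x : colouring) (g : Sinf) :
  step i j z x -> step i j (z \o g) (x \o g).
Proof.
move=> [w [xw ->]]; exists (g^-1%g w); rewrite /= sinvK; split=> //.
by rewrite -[w in LHS](@sinvK g) upd_comp.
Qed.

Lemma perm_invariantP (R : colouring -> colouring -> Prop) :
  (forall z x (g : Sinf), R z x -> R (z \o g) (x \o g)) ->
  perm_invariant (fun z x => `[<R z x>]%:R).
Proof.
move=> RP g z x; congr (nat_of_bool _)%:R; apply/asbool_equiv_eq.
split=> [/(RP _ _ g^-1%g)|]; last exact: RP.
have E (c : colouring) : (c \o g) \o g^-1%g = c.
  by apply: funext => w /=; rewrite sinvK.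
by rewrite !E.
Qed.

Lemma stepF_invariant i j : perm_invariant (stepF i j).
Proof. by apply: perm_invariantP => z x g; exact: step_comp_perm. Qed.

Definition step_hom i j (d b : L) := kernel (stepF_invariant i j) d b.

End Kernels.

End SalgTheory.

(** * Commutators of the matrix units in S(n, t) *)

Section Recolourings.
Variables (n : nat).
Local Notation I := 'I_n.+1.
Implicit Types (z x : nat -> I).

(** First [w] goes from [j2] to [i2], then [w'] from [j1] to [i1]: the indices follow the order of
    composition, right factor first. *)
Definition two_steps (i1 j1 i2 j2 : I) z x (w w' : nat) : bool :=
  [&& x w == j2, upd x w i2 w' == j1 & `[<z = upd (upd x w i2) w' i1>]].

Definition one_step (i j : I) z x (w : nat) : bool :=
  (x w == j) && `[<z = upd x w i>].

Lemma updC (J : Type) (c : nat -> J) v w a a' : v != w ->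
  upd (upd c v a) w a' = upd (upd c w a') v a.
Proof.
move=> vw; apply: funext => u; rewrite /upd.
by case: (eqVneq u w) => // ->; rewrite eq_sym (negPf vw).
Qed.

Lemma upd_upd (J : Type) (c : nat -> J) w a a' :
  upd (upd c w a) w a' = upd c w a'.
Proof. by apply: funext => u; rewrite /upd; case: eqP. Qed.

Lemma upd_eq (J : Type) (c : nat -> J) w a : upd c w a w = a.
Proof. by rewrite /upd eqxx. Qed.

Lemma upd_neq (J : Type) (c : nat -> J) w a v : v != w -> upd c w a v = c v.
Proof. by rewrite /upd => /negPf->. Qed.

Lemma upd_id (J : Type) (c : nat -> J) w : upd c w (c w) = c.
Proof. by apply: funext => u; rewrite /upd; case: eqP => [->|]. Qed.

Lemma two_steps_swap i1 j1 i2 j2 z x w w' : w != w' ->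
  two_steps i1 j1 i2 j2 z x w w' = two_steps i2 j2 i1 j1 z x w' w.
Proof.
move=> ww'; rewrite /two_steps updC // !upd_neq //; last by rewrite eq_sym.
by rewrite andbCA.
Qed.

Lemma two_steps_same i1 j1 i2 j2 z x w :
  two_steps i1 j1 i2 j2 z x w w = (j1 == i2) && one_step i1 j2 z x w.
Proof. by rewrite /two_steps /one_step upd_upd upd_eq andbCA eq_sym. Qed.

Lemma stepP i j z x : step i j z x <-> exists w, one_step i j z x w.
Proof.
split=> [[w [xw zE]]|[w /andP[/eqP xw /asboolP zE]]]; exists w => //.
by rewrite /one_step xw eqxx; apply/asboolP.
Qed.

(** For [i != j] the recoloured point is the only one where [z] and [x] differ. *)
Lemma one_step_count p i j z x :
    supported ord0 p z -> supported ord0 p x -> i != j ->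
  (\sum_(w < p) one_step i j z x w)%N = `[<step i j z x>].
Proof.
move=> zp xp ij; case: asboolP => [/stepP[w xw]|nS]; last first.
  rewrite big1 // => w _; apply/eqP; rewrite eqb0; apply/negP => zw.
  by apply: nS; apply/stepP; exists w.
have [/eqP xwj /asboolP zE] := andP xw; have wp : (w < p)%N.
  rewrite ltnNge; apply/negP => pw; move: (zp w pw); rewrite zE upd_eq => i0.
  by move: ij; rewrite i0 -xwj xp // eqxx.
rewrite (bigD1 (Ordinal wp)) //= xw big1 // => v vw; apply/eqP; rewrite eqb0.
apply/negP => /andP[/eqP xv /asboolP zE']; move: vw; rewrite -val_eqE /=.
by rewrite (upd_inj ij xv xwj) ?eqxx // -zE' -zE.
Qed.

Lemma one_step_same_count p i x z : z <> x ->
  (\sum_(w < p) one_step i i z x w)%N = 0%N.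
Proof.
move=> zx; apply: big1 => w _; apply/eqP; rewrite eqb0; apply/negP.
by move=> /andP[/eqP <- /asboolP zE]; apply: zx; rewrite zE upd_id.
Qed.

(** The bracket relation at one entry, as an identity of natural numbers with the negative terms
    moved across. Pairs of distinct points match after exchanging the sums; the diagonal of each
    double sum collapses by [two_steps_same]. *)
Lemma two_steps_commute p i1 j1 i2 j2 z x :
  (\sum_(w < p) \sum_(w' < p) two_steps i1 j1 i2 j2 z x w w' +
     (j2 == i1) * \sum_(w < p) one_step i2 j1 z x w =
   \sum_(w < p) \sum_(w' < p) two_steps i2 j2 i1 j1 z x w w' +
     (j1 == i2) * \sum_(w < p) one_step i1 j2 z x w)%N.
Proof.
have E a1 b1 a2 b2 :
    (\sum_(w < p) \sum_(w' < p) two_steps a1 b1 a2 b2 z x w w' =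
     \sum_(w < p) \sum_(w' < p | w' != w) two_steps a1 b1 a2 b2 z x w w' +
     (b1 == a2) * \sum_(w < p) one_step a1 b2 z x w)%N.
  rewrite big_distrr -big_split /=; apply: eq_bigr => w _.
  rewrite (bigD1 w) //= addnC; congr addn.
  by rewrite two_steps_same; case: eqP; rewrite ?mul1n ?mul0n.
rewrite !E addnAC; congr (_ + _ + _)%N.
rewrite (exchange_big_dep xpredT) //=; apply: eq_bigr => w _.
apply: eq_big => [w'|w' ww']; first by rewrite eq_sym.
by rewrite two_steps_swap // eq_sym.
Qed.

End Recolourings.

(** * Measures of the sets of intermediate colourings *)

Section MatrixUnits.
Variables (k : fieldType) (hk : [pchar k] =i pred0) (t : k) (n : nat).
Local Notation L := (Lambda t n).
Local Notation I := 'I_n.+1.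

(** Returning to the same colouring forces the second recolouring to undo the first at the same
    point. The intermediate colourings are then all steps from [x], possibly infinitely many, hence
    a weight instead of a count. *)
Lemma mu_two_steps_refl (b c d : L) i1 j1 i2 j2 (z : Xset d) (x : Xset b) :
    i2 != j2 -> shifted i2 j2 b c -> colour z = colour x ->
  mu t [set y : Xset c | step i1 j1 (colour z) (colour y) /\
                         step i2 j2 (colour y) (colour x)] =
  ((i1 == j2) && (j1 == i2))%:R * wt b j2.
Proof.
move=> ij2 bc zx; have [/andP[/eqP e1 /eqP e2]|ne] := boolP (_ && _).
  rewrite mul1r -(mu_step hk x ij2 bc); congr mu; apply/seteqP;
    split=> y [] //=.
  move=> w [xw yE]; split; last by exists w.
  exists w; rewrite yE upd_eq upd_upd e1 e2 zx; split=> //.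
  by rewrite -xw upd_id.
rewrite mul0r -[RHS](mu_set0 t (Xset c)); congr mu; apply/seteqP;
  split=> // y /=.
move=> [[w' [yw' zE]] [w [xw yE]]].
have ww' : w = w'.
  apply/eqP/negPn/negP => ww'; move: (congr1 (fun f => f w) zE).
  by rewrite upd_neq // zx yE upd_eq xw => /eqP; rewrite eq_sym (negPf ij2).
subst w'; case/negP: ne; move: (congr1 (fun f => f w) zE).
by rewrite upd_eq zx xw => ->; rewrite eqxx -yw' yE upd_eq eqxx.
Qed.

Lemma mu_two_steps (b c d : L) i1 j1 i2 j2 (z : Xset d) (x : Xset b) p :
    i1 != j1 -> i2 != j2 -> shifted i2 j2 b c ->
    supported ord0 p (colour z) -> supported ord0 p (colour x) ->
    colour z <> colour x ->
  mu t [set y : Xset c | step i1 j1 (colour z) (colour y) /\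
                         step i2 j2 (colour y) (colour x)] =
  (\sum_(w < p) \sum_(w' < p) two_steps i1 j1 i2 j2 (colour z) (colour x) w
    w')%:R.
Proof.
move=> ij1 ij2 bc zp xp zx; set A := [set y | _].
pose P (u : 'I_p * 'I_p) := two_steps i1 j1 i2 j2 (colour z) (colour x) u.1 u.2.
have -> : (\sum_(w < p) \sum_(w' < p)
    two_steps i1 j1 i2 j2 (colour z) (colour x) w w' = size (enum P))%N.
  rewrite -cardE -sum1_card [RHS]big_mkcond pair_big /=; apply: eq_bigr => u _.
  by rewrite unfold_in -/(P u); case: (P u).
apply: mu_finite.
have /boolp.choice[F FP] (u : 'I_p * 'I_p) : exists y : Xset c, P u ->
    colour y = upd (colour x) u.1 i2.
  case: (boolP (P u)) => [/and3P[/eqP xw _ _]|nPu];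
    last by exists (coset c 1%g).
  by have [y yE] := shifted_colour hk bc xw; exists y.
have -> : A = F @` [set u | u \in enum P].
  apply/seteqP; split=> [y [[w' [yw' zE]] [w [xw yE]]]|_ [u /= + <-]];
    last first.
    rewrite mem_enum => Pu; have /and3P[/eqP xw /eqP yw' /asboolP zE] := Pu.
    by rewrite /A /= FP //; split; [exists u.2|exists u.1].
  (* A point at or beyond [p] has the default colour in both [z] and [x]. Recoloured once, it
     contradicts [ij1] or [ij2]; recoloured twice, it yields z = x. *)
  have bound v : (v == w) || (v == w') -> (v < p)%N.
    move=> vww'; rewrite ltnNge; apply/negP => pv.
    case: (eqVneq w w') => ww'.
      subst w'; have {vww'} vw : v = w by case/orP: vww' => /eqP.
      subst v; have := zp _ pv; rewrite zE upd_eq => i10; apply: zx.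
      rewrite zE yE upd_upd i10 -{2}(upd_id (colour x) w); congr upd.
      by rewrite xp.
    case/orP: vww' => /eqP vE; subst v.
      have := zp _ pv; rewrite zE upd_neq // yE upd_eq => i20.
      by move: ij2; rewrite i20 -xw xp ?eqxx.
    have := zp _ pv; rewrite zE upd_eq => i10; move: yw'.
    rewrite yE upd_neq 1?eq_sym // xp // => j10.
    by move: ij1; rewrite i10 j10 eqxx.
  have wp : (w < p)%N by apply: bound; rewrite eqxx.
  have w'p : (w' < p)%N by apply: bound; rewrite eqxx orbT.
  have Pu : P (Ordinal wp, Ordinal w'p).
    by apply/and3P; split=> /=; rewrite ?xw ?eqxx //; rewrite -yE;
      [apply/eqP|apply/asboolP].
  exists (Ordinal wp, Ordinal w'p); first by rewrite /= mem_enum.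
  by apply: colour_inj => v; rewrite FP // yE.
rewrite (card_eql (card_image_in _)); first exact/card_seq/enum_uniq.
move=> [v v'] [w w'] /=; rewrite !mem_enum => Pu Pv e.
have /and3P[/eqP xv /eqP yv' /asboolP zEv] := Pu.
have /and3P[/eqP xw /eqP yw' /asboolP zEw] := Pv.
move: (congr1 (@colour _ _ _ _) e); rewrite !FP // => yE.
have vw : v = w by apply: val_inj; exact: (upd_inj ij2 xv xw yE).
congr pair => //; subst w; apply: val_inj; apply: (upd_inj ij1 yv' yw').
by rewrite -zEv -zEw.
Qed.

End MatrixUnits.

(** * The matrix units as elements of S(n, t) and their brackets *)

Section MatrixUnitElements.
Variables (k : fieldType) (hk : [pchar k] =i pred0) (t : k) (n : nat).
Local Notation L := (Lambda t n).
Local Notation I := 'I_n.+1.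

Lemma colour_eq_weight (b d : L) (x : Xset b) (z : Xset d) :
  colour z = colour x -> d = b.
Proof.
move=> zx; have [p xp] := colour_supported x; apply: (wt_inj hk) => a.
by rewrite (colour_wt hk a xp) (@colour_wt _ hk _ _ _ z p) zx.
Qed.

Lemma Salg_idE (b d b' : L) (z : Xset d) (x : Xset b') :
  Salg_id b (d, b') (z, x) = (b' == b)%:R * `[<colour z = colour x>]%:R :> k.
Proof.
have [e|bb'] := eqVneq b' b; last first.
  rewrite mul0r Salg_in_off //; by apply: contra bb' => /eqP[_ ->].
subst b'; rewrite mul1r; have [e|db] := eqVneq d b.
  subst d; rewrite Salg_in_diag /=; congr (nat_of_bool _)%:R.
  apply/asbool_equiv_eq; split=> [->//|zx].
  by apply: colour_inj => w; rewrite zx.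
rewrite Salg_in_off; last by apply: contra db => /eqP[->].
by rewrite asboolF // => /colour_eq_weight /eqP; rewrite (negPf db).
Qed.

(** The action of the matrix unit E_{i,j} on the weight space of [b]. *)
Definition Eunit (i j : I) (b : L) : Salg t n :=
  if i == j then wt b i *: Salg_id b else
  match pselect (exists d, shifted i j b d) with
  | left h => Salg_in (step_hom i j (sval (cid h)) b)
  | right _ => 0
  end.

Lemma Eunit_diag i b : Eunit i i b = wt b i *: Salg_id b.
Proof. by rewrite /Eunit eqxx. Qed.

Lemma Eunit_shifted i j b d : i != j -> shifted i j b d ->
  Eunit i j b = Salg_in (step_hom i j d b).
Proof.
move=> ij bd; rewrite /Eunit (negPf ij); case: pselect => [h|[]];
  last by exists d.
by rewrite (shifted_uniq hk (svalP (cid h)) bd).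
Qed.

Lemma shifted_refl i (b : L) : shifted i i b b.
Proof. by move=> a; rewrite subrr addr0. Qed.

Lemma Eunit_none i j b : (forall d, ~ shifted i j b d) -> Eunit i j b = 0.
Proof.
move=> nd; rewrite /Eunit; case: eqP => [e|_].
  by case: (nd b); rewrite e; exact: shifted_refl.
by case: pselect => [h|//]; have [d bd] := h; case: (nd d).
Qed.

Definition Ecoef (i j : I) (b : L) (z x : nat -> I) : k :=
  if i == j then wt b i * `[<z = x>]%:R else `[<step i j z x>]%:R.

(** Valid for every target [d]: for [i != j], if [d] is not the shifted weight, then no step joins
    the colourings and both sides vanish. This avoids transport along equalities of weights. *)
Lemma EunitE i j (b d b' : L) (z : Xset d) (x : Xset b') :
  Eunit i j b (d, b') (z, x) =
    (b' == b)%:R * Ecoef i j b (colour z) (colour x) :> k.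
Proof.
rewrite /Ecoef; have [->|ij] := eqVneq i j.
  by rewrite Eunit_diag SalgZ HomZ Salg_idE mulrCA.
have [e|bb'] := eqVneq b' b; last first.
  rewrite mul0r; case: (pselect (exists e, shifted i j b e)) =>
    [[e be]|/forallNP nd].
    rewrite (Eunit_shifted ij be) Salg_in_off //.
    by apply: contra bb' => /eqP[_ ->].
  by rewrite (Eunit_none nd) Salg0E.
subst b'; rewrite mul1r; have [bd|nbd] := pselect (shifted i j b d).
  by rewrite (Eunit_shifted ij bd) Salg_in_diag.
rewrite [in RHS]asboolF; last by move=> /(step_shifted hk).
case: (pselect (exists e, shifted i j b e)) => [[e be]|/forallNP nd].
  rewrite (Eunit_shifted ij be) Salg_in_off //; apply/eqP => -[ed].
  by apply: nbd; rewrite -ed.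
by rewrite (Eunit_none nd) Salg0E.
Qed.

Lemma Salg_mul0l (a : Salg t n) : Salg_mul 0 a = 0.
Proof.
apply: SalgP => db; rewrite Salg0E; apply: fsbig1 => c _.
by rewrite /Salg_comp Salg0E Hom_comp0l.
Qed.

(** The composite of two matrix units on the weight space of [b]. *)
Definition Eunit2 (i1 j1 i2 j2 : I) (b : L) : Salg t n :=
  match pselect (exists c, shifted i2 j2 b c) with
  | left h => Salg_mul (Eunit i1 j1 (sval (cid h))) (Eunit i2 j2 b)
  | right _ => 0
  end.

Lemma Eunit2_shifted i1 j1 i2 j2 b c : shifted i2 j2 b c ->
  Eunit2 i1 j1 i2 j2 b = Salg_mul (Eunit i1 j1 c) (Eunit i2 j2 b).
Proof.
move=> bc; rewrite /Eunit2; case: pselect => [h|[]]; last by exists c.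
by rewrite (shifted_uniq hk (svalP (cid h)) bc).
Qed.

Lemma Eunit2_none i1 j1 i2 j2 b : (forall c, ~ shifted i2 j2 b c) ->
  Eunit2 i1 j1 i2 j2 b = 0.
Proof. by move=> nc; rewrite /Eunit2; case: pselect => [h|//];
  have [c bc] := h; case: (nc c). Qed.

Lemma Eunit2E i1 j1 i2 j2 (b d b' : L) (z : Xset d) (x : Xset b') p :
    i1 != j1 -> i2 != j2 ->
    supported ord0 p (colour z) -> supported ord0 p (colour x) ->
  Eunit2 i1 j1 i2 j2 b (d, b') (z, x) = (b' == b)%:R *
    (if `[<colour z = colour x>] then ((i1 == j2) && (j1 == i2))%:R * wt b j2
     else (\sum_(w < p) \sum_(w' < p)
             two_steps i1 j1 i2 j2 (colour z) (colour x) w w')%:R) :> k.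
Proof.
move=> ij1 ij2 zp xp.
case: (pselect (exists c, shifted i2 j2 b c)) => [[c bc]|/forallNP nc];
  last first.
  rewrite (Eunit2_none i1 j1 nc) Salg0E Hom0; have [e|_] := eqVneq b' b;
    last by rewrite mul0r.
  (* Without a target weight the colour [j2] is absent from [x], so there are no double steps and
     [wt b j2] is 0. *)
  subst b'; rewrite mul1r; have nx w : colour x w <> j2.
    by move=> /(exists_shifted hk i2)[c /nc].
  case: asboolP => _; first by rewrite (wt_eq0 hk nx) mulr0.
  rewrite big1 // => w _; rewrite big1 // => w' _; rewrite /two_steps.
  by case: eqP => // /nx.
rewrite (Eunit2_shifted i1 j1 bc) (Eunit_shifted ij2 bc).
have [e|bb'] := eqVneq b' b; last first.
  by rewrite Salg_mul_off 1?eq_sym // Hom0 mul0r.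
subst b'; rewrite mul1r Salg_mulE.
rewrite (@Hom_comp_indicator _ _ _ _ _ _ _ [set y : Xset c |
   step i1 j1 (colour z) (colour y) /\ step i2 j2 (colour y) (colour x)] 1);
     last first.
  move=> y; rewrite EunitE eqxx mul1r mulr1 /Ecoef (negPf ij1) /=.
  rewrite /stepF -natrM mulnb; congr (nat_of_bool _)%:R.
  by apply/esym; rewrite asbool_and.
rewrite mul1r; case: asboolP => [zx|zx]; first exact: mu_two_steps_refl.
exact: mu_two_steps.
Qed.

Lemma step_irrefl i j (x : nat -> I) : i != j -> ~ step i j x x.
Proof.
move=> ij [w [xw /(congr1 (fun f : nat -> I => f w))]].
by rewrite upd_eq xw => /eqP; rewrite eq_sym (negPf ij).
Qed.

Lemma Ecoef_count i j b (z x : nat -> I) p :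
    supported ord0 p z -> supported ord0 p x -> z <> x ->
  Ecoef i j b z x = (\sum_(w < p) one_step i j z x w)%:R.
Proof.
move=> zp xp zx; rewrite /Ecoef; have [->|ij] := eqVneq i j.
  by rewrite one_step_same_count // asboolF // mulr0.
by rewrite one_step_count.
Qed.

Lemma Eunit2_commute i1 j1 i2 j2 b : i1 != j1 -> i2 != j2 ->
  Eunit2 i1 j1 i2 j2 b + (j2 == i1)%:R *: Eunit i2 j1 b =
  Eunit2 i2 j2 i1 j1 b + (j1 == i2)%:R *: Eunit i1 j2 b.
Proof.
move=> ij1 ij2; apply: SalgP => -[d b']; apply: HomP => -[z x].
rewrite !SalgD !SalgZ !HomD !HomZ !EunitE.
have [p0 zp0] := colour_supported z; have [p1 xp1] := colour_supported x.
pose p := maxn p0 p1.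
have zp : supported ord0 p (colour z) := supported_leq (leq_maxl _ _) zp0.
have xp : supported ord0 p (colour x) := supported_leq (leq_maxr _ _) xp1.
rewrite (Eunit2E b ij1 ij2 zp xp) (Eunit2E b ij2 ij1 zp xp).
rewrite [_ * (_ * Ecoef i2 j1 _ _ _)]mulrCA.
rewrite [_ * (_ * Ecoef i1 j2 _ _ _)]mulrCA -!mulrDr; congr (_ * _).
(* At z = x both sides are b_{i1} + b_{i2} if [j2 = i1] and [j1 = i2], and 0 otherwise. At z <> x
   all entries are counts. *)
case: asboolP => [zx|zx].
  rewrite zx /Ecoef asboolT // !mulr1.
  have [e1|n1] := eqVneq j2 i1; have [e2|n2] := eqVneq j1 i2.
  - by rewrite e1 e2 addrC.
  - by rewrite /= !mul0r !mul1r asboolF ?mulr0 ?addr0 //; apply: step_irrefl;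
    rewrite eq_sym.
  - by rewrite /= !mul0r !mul1r asboolF ?mulr0 ?addr0 //; apply: step_irrefl;
    rewrite eq_sym.
  - by rewrite /= !mul0r.
rewrite !(Ecoef_count _ _ b zp xp zx) -!natrM -!natrD; congr _%:R.
exact: two_steps_commute.
Qed.

End MatrixUnitElements.

(** * The action of gl_n on an S(n, t)-module *)

Section SmodTheory.
Variables (k : fieldType) (t : k) (n : nat) (M : Smod t n).
Local Notation L := (Lambda t n).
Local Notation A := (sact (sstr M)).

Lemma sact0l m : A 0 m = 0.
Proof. by have := sact_linl (sstr M) (-1) 0 0 m;
  rewrite scaler0 addr0 scaleN1r addNr. Qed.

Lemma sactDl a b m : A (a + b) m = A a m + A b m.
Proof. by have := sact_linl (sstr M) 1 a b m; rewrite !scale1r. Qed.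

Lemma sactZl c a m : A (c *: a) m = c *: A a m.
Proof. by have := sact_linl (sstr M) c a 0 m; rewrite sact0l !addr0. Qed.

Lemma sact0r a : A a 0 = 0.
Proof. by have := sact_linr (sstr M) (-1) a 0 0;
  rewrite scaler0 addr0 scaleN1r addNr. Qed.

Lemma sactDr a m m' : A a (m + m') = A a m + A a m'.
Proof. by have := sact_linr (sstr M) 1 a m m'; rewrite !scale1r. Qed.

Lemma sactZr c a m : A a (c *: m) = c *: A a m.
Proof. by have := sact_linr (sstr M) c a m 0; rewrite sact0r !addr0. Qed.

Lemma sact_sum (J : Type) (r : seq J) (P : pred J) a (F : J -> M) :
  A a (\sum_(j <- r | P j) F j) = \sum_(j <- r | P j) A a (F j).
Proof. by apply: big_morph; [exact: sactDr|exact: sact0r]. Qed.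

Definition wproj (b : L) (m : M) : M := A (Salg_id b) m.

Lemma wprojK b m : wproj b (wproj b m) = wproj b m.
Proof. by rewrite /wproj -sactM Salg_in_mulid. Qed.

Lemma wproj_neq b c m : b != c -> wproj b (wproj c m) = 0.
Proof. by move=> bc; rewrite /wproj -sactM Salg_mul_in_neq // sact0l. Qed.

Lemma wprojP b m : range (A (Salg_id b)) m <-> wproj b m = m.
Proof. by split=> [[m' _ <-]|mb]; [exact: wprojK|exists m]. Qed.

Lemma wproj_decomp m : exists s : seq L,
  [/\ uniq s, m = \sum_(b <- s) wproj b m & forall b, b \notin s ->
    wproj b m = 0].
Proof.
have [u [[uW uf mE] _]] := sact_dsum (sstr M) m.
pose s := fset_set [set b | u b <> 0].
have us : uniq s by exact: fset_uniq.
have u0 b : b \notin s -> u b = 0.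
  by rewrite in_fset_set // notin_setE /= => /contrapT.
have mE' : m = \sum_(b <- s) u b by rewrite {1}mE (fsbigTE s).
(* The idempotents are orthogonal, so the abstract component at [b] is the projection. *)
have ub b : wproj b m = u b.
  rewrite mE' /wproj sact_sum; have [bs|bs] := boolP (b \in s).
    rewrite (bigD1_seq b) //= [X in _ + X]big1 ?addr0; first exact/wprojP.
    by move=> c cb; have /wprojP <- := uW c; apply: wproj_neq; rewrite eq_sym.
  rewrite u0 // big_seq big1 // => c cs; have /wprojP <- := uW c.
  by apply: wproj_neq; apply: contraNneq bs => ->.
exists s; split=> // [|b bs]; last by rewrite ub u0.
by rewrite {1}mE'; apply: eq_bigr => b _; rewrite ub.
Qed.

Lemma wproj_ind (P : M -> Prop) :
    P 0 -> (forall m m', P m -> P m' -> P (m + m')) ->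
    (forall b m, wproj b m = m -> P m) ->
  forall m, P m.
Proof.
move=> P0 PD Pb m; have [s [_ -> _]] := wproj_decomp m.
by apply: big_ind => // b _; apply: (Pb b); exact: wprojK.
Qed.

Lemma wproj_ext m m' : (forall b, wproj b m = wproj b m') -> m = m'.
Proof.
move=> mm'; apply/eqP; rewrite -subr_eq0;
  have [s [_ -> _]] := wproj_decomp (m - m').
rewrite big1 // => b _.
by rewrite /wproj sactDr -scaleN1r sactZr -!/(wproj _ _) mm' scaleN1r subrr.
Qed.

End SmodTheory.

(** * From the matrix units to a U(gl_n)-module structure *)

Section GlAction.
Variables (k : fieldType) (hk : [pchar k] =i pred0) (t : k) (n : nat).
Variable M : Smod t n.
Local Notation L := (Lambda t n).
Local Notation I := 'I_n.+1.
Local Notation A := (sact (sstr M)).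

(** An infinite family summed pointwise: a vector has finitely many nonzero weight components, and
    the other terms are 0. *)
Definition unit_act (i j : I) (m : M) : M :=
  \sum_(b \in [set: L]) A (Eunit i j b) m.

Lemma Eunit_mulid i j (b : L) : Salg_mul (Eunit i j b) (Salg_id b) =
  Eunit i j b.
Proof.
rewrite /Eunit; case: eqP => _; last first.
  by case: pselect => h; rewrite ?Salg_in_mulid ?Salg_mul0l.
have -> : wt b i *: Salg_id b = Salg_in (wt b i *: Hom_id k (Xset b)).
  have := Salg_in_linear (wt b i) (Hom_id k (Xset b)) 0.
  by rewrite Salg_in0 !addr0 => ->.
exact: Salg_in_mulid.
Qed.

Lemma Eunit_act i j b m : A (Eunit i j b) m = A (Eunit i j b) (wproj b m).
Proof. by rewrite /wproj -sactM Eunit_mulid. Qed.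

Lemma unit_act_seq i j m (s : seq L) : uniq s ->
    (forall b, b \notin s -> wproj b m = 0) ->
  unit_act i j m = \sum_(b <- s) A (Eunit i j b) m.
Proof.
move=> us ms; rewrite /unit_act (fsbigE s) //; last first.
  by move=> b _ bs; rewrite Eunit_act ms // sact0r.
by apply: eq_bigl => b; rewrite in_setT.
Qed.

Lemma unit_act_weight i j b m : wproj b m = m ->
  unit_act i j m = A (Eunit i j b) m.
Proof.
move=> mb; rewrite (@unit_act_seq _ _ _ [:: b]) //; first by rewrite big_seq1.
by move=> c; rewrite inE -mb => cb; exact: wproj_neq.
Qed.

Lemma unit_act_linear i j c m m' :
  unit_act i j (c *: m + m') = c *: unit_act i j m + unit_act i j m'.
Proof.
have [s [us _ ms]] := wproj_decomp m; have [s' [us' _ ms']] := wproj_decomp m'.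
pose r := undup (s ++ s'); have ur : uniq r := undup_uniq _.
have mr b : b \notin r -> wproj b m = 0.
  by rewrite mem_undup mem_cat negb_or => /andP[/ms].
have mr' b : b \notin r -> wproj b m' = 0.
  by rewrite mem_undup mem_cat negb_or => /andP[_ /ms'].
rewrite (unit_act_seq i j ur mr) (unit_act_seq i j ur mr').
rewrite (@unit_act_seq _ _ _ r) //.
  rewrite scaler_sumr -big_split; apply: eq_bigr => b _; exact: sact_linr.
by move=> b br; rewrite /wproj sact_linr -!/(wproj _ _) mr // scaler0 add0r mr'.
Qed.

Lemma unit_act0 i j : unit_act i j 0 = 0.
Proof.
have := unit_act_linear i j (-1) 0 0.
by rewrite scaler0 addr0 scaleN1r addNr.
Qed.

Lemma unit_actZ i j c m : unit_act i j (c *: m) = c *: unit_act i j m.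
Proof. by have := unit_act_linear i j c m 0; rewrite unit_act0 !addr0. Qed.

Lemma unit_actD i j m m' :
  unit_act i j (m + m') = unit_act i j m + unit_act i j m'.
Proof. by have := unit_act_linear i j 1 m m'; rewrite !scale1r. Qed.

Definition mx_act (X : 'M[k]_n.+1) (m : M) : M :=
  \sum_i \sum_j X i j *: unit_act i j m.

Lemma mx_act_linl c X Y m : mx_act (c *: X + Y) m =
  c *: mx_act X m + mx_act Y m.
Proof.
rewrite /mx_act scaler_sumr -big_split; apply: eq_bigr => i _.
rewrite scaler_sumr -big_split; apply: eq_bigr => j _.
by rewrite !mxE scalerDl scalerA.
Qed.

Lemma mx_act_linr c X m m' : mx_act X (c *: m + m') =
  c *: mx_act X m + mx_act X m'.
Proof.
rewrite /mx_act scaler_sumr -big_split; apply: eq_bigr => i _.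
rewrite scaler_sumr -big_split; apply: eq_bigr => j _.
by rewrite unit_act_linear scalerDr !scalerA mulrC.
Qed.

Lemma mx_act0l m : mx_act 0 m = 0.
Proof.
have := mx_act_linl (-1) 0 0 m.
by rewrite scaler0 addr0 scaleN1r addNr.
Qed.

Lemma mx_actZl c X m : mx_act (c *: X) m = c *: mx_act X m.
Proof. by have := mx_act_linl c X 0 m; rewrite mx_act0l !addr0. Qed.

Lemma mx_actDl X Y m : mx_act (X + Y) m = mx_act X m + mx_act Y m.
Proof. by have := mx_act_linl 1 X Y m; rewrite !scale1r. Qed.

Lemma mx_actNl X m : mx_act (- X) m = - mx_act X m.
Proof. by rewrite -!scaleN1r mx_actZl. Qed.

Lemma mx_act_delta i j m : mx_act (delta_mx i j) m = unit_act i j m.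
Proof.
rewrite /mx_act (bigD1 i) //= (bigD1 j) //= mxE !eqxx scale1r.
rewrite big1 ?addr0 => [|j' j'j]; last by rewrite mxE (negPf j'j) andbF scale0r.
rewrite big1 ?addr0 // => i' i'i; apply: big1 => j' _.
by rewrite mxE (negPf i'i) scale0r.
Qed.

Lemma mx_act_diag (h : 'rV[k]_n.+1) b m : wproj b m = m ->
  mx_act (diag_mx h) m = (\sum_i wt b i * h 0 i) *: m.
Proof.
move=> mb; rewrite /mx_act scaler_suml; apply: eq_bigr => i _.
rewrite (bigD1 i) //= !mxE eqxx big1 ?addr0 => [|j ji]; last first.
  by rewrite mxE eq_sym (negPf ji) scale0r.
rewrite (unit_act_weight _ _ mb) Eunit_diag sactZl -/(wproj b m) mb.
by rewrite scalerA mulrC.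
Qed.

Lemma unit_act_shifted i j b c m : shifted i j b c -> wproj b m = m ->
  wproj c (unit_act i j m) = unit_act i j m.
Proof.
move=> bc mb; rewrite (unit_act_weight _ _ mb); have [e|ij] := eqVneq i j.
  subst j; rewrite (shifted_uniq hk bc (shifted_refl i b)).
  by rewrite Eunit_diag sactZl -/(wproj b m) mb /wproj sactZr -/(wproj b m) mb.
by rewrite (Eunit_shifted hk ij bc) /wproj -sactM Salg_id_mulin.
Qed.

Lemma unit_act_none i j b m : (forall c, ~ shifted i j b c) -> wproj b m = m ->
  unit_act i j m = 0.
Proof. by move=> nc mb; rewrite (unit_act_weight _ _ mb) (Eunit_none nc)
  sact0l. Qed.

Lemma unit_act2 i1 j1 i2 j2 b m : wproj b m = m ->
  unit_act i1 j1 (unit_act i2 j2 m) = A (Eunit2 i1 j1 i2 j2 b) m.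
Proof.
move=> mb; case: (pselect (exists c, shifted i2 j2 b c)) =>
  [[c bc]|/forallNP nc].
  rewrite (unit_act_weight _ _ (unit_act_shifted bc mb)) (unit_act_weight _ _
    mb).
  by rewrite -sactM (Eunit2_shifted hk i1 j1 bc).
by rewrite (Eunit2_none i1 j1 nc) (unit_act_none nc mb) sact0l unit_act0.
Qed.

(** A diagonal unit multiplies by a coordinate of the weight, and [unit_act i2 j2] shifts that
    coordinate by [i1 = i2] - [i1 = j2]. *)
Lemma unit_act_diag2 i1 i2 j2 b m : wproj b m = m ->
  unit_act i1 i1 (unit_act i2 j2 m) =
  unit_act i2 j2 (unit_act i1 i1 m) +
   ((i1 == i2)%:R *: unit_act i1 j2 m - (j2 == i1)%:R *: unit_act i2 i1 m).
Proof.
move=> mb; have diag c m' : wproj c m' = m' ->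
  unit_act i1 i1 m' = wt c i1 *: m'.
  by move=> mc; rewrite (unit_act_weight _ _ mc) Eunit_diag sactZl -/(wproj _
    _) mc.
have -> : (i1 == i2)%:R *: unit_act i1 j2 m = (i1 == i2)%:R *: unit_act i2 j2 m.
  by case: eqP => [->//|_]; rewrite !scale0r.
have -> : (j2 == i1)%:R *: unit_act i2 i1 m = (i1 == j2)%:R *: unit_act i2 j2 m.
  by rewrite eq_sym; case: eqP => [->//|_]; rewrite !scale0r.
rewrite (diag _ _ mb) unit_actZ.
case: (pselect (exists c, shifted i2 j2 b c)) => [[c bc]|/forallNP nc].
  by rewrite (diag _ _ (unit_act_shifted bc mb)) bc -scalerBl -scalerDl.
by rewrite (unit_act_none nc mb) !scaler0 subrr addr0 unit_act0.
Qed.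

Lemma unit_act_bracket i1 j1 i2 j2 m :
  unit_act i1 j1 (unit_act i2 j2 m) =
  unit_act i2 j2 (unit_act i1 j1 m) +
   ((j1 == i2)%:R *: unit_act i1 j2 m - (j2 == i1)%:R *: unit_act i2 j1 m).
Proof.
elim/wproj_ind: m => [|m m' Hm Hm'|b m mb].
- by rewrite !unit_act0 !scaler0 subrr addr0.
- rewrite !unit_actD Hm Hm' !scalerDr opprD addrACA; congr +%R.
  exact: addrACA.
have [e1|n1] := eqVneq i1 j1; first by subst j1;
  exact: (unit_act_diag2 _ _ _ mb).
(* A diagonal second factor is the preceding case read with the two factors exchanged. *)
have [e2|n2] := eqVneq i2 j2.
  subst j2; rewrite (unit_act_diag2 i2 i1 j1 mb) -addrA.
  by rewrite [X in _ + X]addrA subrK subrr addr0.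
rewrite !(unit_act2 _ _ _ _ mb) addrA; apply/eqP; rewrite eq_sym subr_eq.
rewrite !(unit_act_weight _ _ mb) -!sactZl -!sactDl.
by rewrite (Eunit2_commute hk b n1 n2).
Qed.

Lemma mx_linear_ind (P : 'M[k]_n.+1 -> Prop) :
    (forall c X Y, P X -> P Y -> P (c *: X + Y)) ->
    (forall i j, P (delta_mx i j)) ->
  forall X, P X.
Proof.
move=> Plin Pdelta X.
have P0 : P 0 by have := Plin (-1) _ _ (Pdelta ord0 ord0) (Pdelta ord0 ord0);
  rewrite scaleN1r addNr.
have PD Y Z : P Y -> P Z -> P (Y + Z) by move=> PY /(Plin 1 _ _ PY);
  rewrite scale1r.
rewrite (matrix_sum_delta X); apply: big_ind => // i _;
  apply: big_ind => // j _.
by rewrite -[_ *: _]addr0; exact: Plin.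
Qed.

Lemma mx_act_bracket X Y m :
  mx_act X (mx_act Y m) = mx_act Y (mx_act X m) + mx_act (X *m Y - Y *m X) m.
Proof.
elim/mx_linear_ind: X => [c X X' HX HX'|i1 j1].
  rewrite mx_act_linl HX HX' mx_act_linl mx_act_linr.
  rewrite mulmxDl mulmxDr -scalemxAl -scalemxAr opprD addrACA -scalerBr
    mx_act_linl.
  by rewrite scalerDr addrACA.
elim/mx_linear_ind: Y => [c Y Y' HY HY'|i2 j2].
  rewrite !(mx_act_linl c Y Y') mx_act_linr HY HY'.
  rewrite mulmxDl mulmxDr -scalemxAl -scalemxAr opprD addrACA -scalerBr
    mx_act_linl.
  by rewrite scalerDr addrACA.
rewrite !mx_act_delta unit_act_bracket; congr +%R.
rewrite !mul_delta_mx_cond -!scaler_nat mx_actDl mx_actNl !mx_actZl.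
by rewrite !mx_act_delta.
Qed.

Fixpoint term_act (x : uterm k n.+1) (m : M) : M :=
  match x with
  | UScal c => c *: m
  | UGen X => mx_act X m
  | UAdd x y => term_act x m + term_act y m
  | UMul x y => term_act x (term_act y m)
  end.

Lemma term_act_linear x c m m' :
  term_act x (c *: m + m') = c *: term_act x m + term_act x m'.
Proof.
elim: x m m' => [a|X|x IHx y IHy|x IHx y IHy] m m' /=.
- by rewrite scalerDr !scalerA mulrC.
- exact: mx_act_linr.
- by rewrite IHx IHy scalerDr addrACA.
- by rewrite IHy IHx.
Qed.

Lemma term_actD x m m' : term_act x (m + m') = term_act x m + term_act x m'.
Proof. by have := term_act_linear x 1 m m'; rewrite !scale1r. Qed.

Lemma term_actZ x c m : term_act x (c *: m) = c *: term_act x m.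
Proof.
have := term_act_linear x c m 0; rewrite addr0 => ->.
by have := term_act_linear x (-1) 0 0;
  rewrite scaler0 addr0 scaleN1r addNr => ->; rewrite addr0.
Qed.

Lemma term_act_ueq x y : ueq x y -> forall m, term_act x m = term_act y m.
Proof.
elim=> {x y} /=.
- by [].
- by move=> x y _ H m; rewrite H.
- by move=> y x z _ H1 _ H2 m; rewrite H1 H2.
- by move=> x x' y y' _ Hx _ Hy m; rewrite Hx Hy.
- by move=> x x' y y' _ Hx _ Hy m; rewrite Hy Hx.
- by move=> x y z m; rewrite addrA.
- by move=> x y m; rewrite addrC.
- by move=> x m; rewrite scale0r add0r.
- by move=> x m; rewrite scaleN1r addNr scale0r.
- by [].
- by move=> x m; rewrite scale1r.
- by [].
- by move=> x y z m; rewrite term_actD.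
- by move=> c d m; rewrite scalerDl.
- by move=> c d m; rewrite scalerA.
- by move=> c x m; rewrite term_actZ.
- exact: mx_actDl.
- exact: mx_actZl.
- exact: mx_act_bracket.
Qed.

Definition gl_act (u : Ugl k n.+1) (m : M) : M := term_act (repr u) m.

Lemma gl_act_Ucl x m : gl_act (Ucl x) m = term_act x m.
Proof. exact: (term_act_ueq (repr_Ucl x)). Qed.

Lemma gl_act_linl c a b m : gl_act (c *: a + b) m =
  c *: gl_act a m + gl_act b m.
Proof.
elim/Ucl_ind: a => x; elim/Ucl_ind: b => y.
have -> : c *: (Ucl x : Ugl k n.+1) + Ucl y =
  Uadd (Umul (Uscal n.+1 c) (Ucl x)) (Ucl y).
  by [].
by rewrite UmulE UaddE !gl_act_Ucl.
Qed.

Lemma gl_act_linr c a m m' : gl_act a (c *: m + m') =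
  c *: gl_act a m + gl_act a m'.
Proof. exact: term_act_linear. Qed.

Lemma gl_act1 m : gl_act 1 m = m.
Proof. by rewrite -[1]/(Ucl (UScal _ 1)) gl_act_Ucl /= scale1r. Qed.

Lemma gl_actM a b m : gl_act (a * b) m = gl_act a (gl_act b m).
Proof.
elim/Ucl_ind: a => x; elim/Ucl_ind: b => y.
have -> : (Ucl x : Ugl k n.+1) * Ucl y = Umul (Ucl x) (Ucl y) by [].
by rewrite UmulE !gl_act_Ucl.
Qed.

Definition gl_struct : Ustruct n M :=
  MkUstruct gl_act_linl gl_act_linr gl_act1 gl_actM.

Lemma gl_act_gen X m : gl_act (Ugen X) m = mx_act X m.
Proof. by rewrite gl_act_Ucl. Qed.

End GlAction.

(** * Uniqueness of the inflation *)

Section XiStep.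
Variables (k : fieldType) (hk : [pchar k] =i pred0) (t : k) (n : nat).
Local Notation L := (Lambda t n).
Local Notation I := 'I_n.+1.

(** Translation by [g] turns the block intersections into classes of pairs of colours, so the orbit
    can be read off from two colourings. *)
Lemma xi_setP (d b : L) (q : 'M[k]_n.+1) (y : Xset d) (x : Xset b) :
  xi_set q (y, x) <-> forall a e, (a, e) != (ord0, ord0) ->
    exists2 m, [set w | colour y w = a /\ colour x w = e] #= `I_m & q a e =
      m%:R.
Proof.
have cardE (g s : Sinf) a e :
    [set w | colour (fact g (coset d 1%g : Xset d)) w = a /\
             colour (fact g (coset b s : Xset b)) w = e]
    #= (block d a `&` [set s w | w in block b e]).
  have -> : [set w | colour (fact g (coset d 1%g : Xset d)) w = a /\
                colour (fact g (coset b s : Xset b)) w = e]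
      = g @` (block d a `&` [set s w | w in block b e]).
    apply/seteqP; split=> [w /=|_ [v [dv [u bu uv]] <-]].
      rewrite !colour_fact !colour_coset => -[/blockP dw /blockP bw].
      exists (g^-1%g w); last by rewrite /= sinvK.
      split; first by move: dw; rewrite /=.
      by exists (s^-1%g (g^-1%g w)) => //; rewrite /= sinvK.
    rewrite /= !colour_fact !colour_coset /= sfunK.
    by split; apply/blockP => //; rewrite -uv sfunK.
  exact/card_inj_image/(can_inj (@sfunK _)).
split=> [[s [g [H e]]] a c ac|H].
  have ey : y = fact g (coset d 1%g : Xset d) := congr1 fst e.
  have ex : x = fact g (coset b s : Xset b) := congr1 snd e.
  have [m Hm qm] := H a c ac; exists m => //.
  by rewrite ey ex (card_eql (cardE g s a c)).
(* Translating by [u^-1] moves [y] to the coset of 1 and [x] to the coset of the first witness. *)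
pose u := coset_rep y; exists (u^-1 * coset_rep x)%g, u.
have ey : fact u (coset d 1%g : Xset d) = y.
  by rewrite [fact _ _]coset_act_coset mulg1 coset_repK.
have ex : fact u (coset b (u^-1 * coset_rep x)%g : Xset b) = x.
  by rewrite [fact _ _]coset_act_coset mulgA mulgV mul1g coset_repK.
split=> [a c ac|]; last by rewrite ey ex.
have [m Hm qm] := H a c ac; exists m => //.
by rewrite -(card_eql (cardE u _ a c)) ey ex.
Qed.

Lemma card_pair_below p (y x : nat -> I) a e :
    supported ord0 p y -> supported ord0 p x -> (a, e) != (ord0, ord0) ->
  [set w | y w = a /\ x w = e] #= `I_(count_below p (fun w =>
    (y w == a) && (x w == e))).
Proof.
move=> yp xp ae.
have -> : [set w | y w = a /\ x w = e] = [set w | (y w == a) && (x w == e)].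
  by apply/seteqP; split=> w /= => [[-> ->]|/andP[/eqP -> /eqP ->]];
    rewrite ?eqxx.
apply: card_below => w; apply: contraTT; rewrite -leqNgt => pw.
by rewrite yp // xp //; move: ae; rewrite xpair_eqE (eq_sym a) (eq_sym e).
Qed.

Lemma below_ge2 p (P : pred nat) v w : (v < p)%N -> (w < p)%N -> v != w ->
  P v -> P w -> (1 < count_below p P)%N.
Proof.
move=> vp wp vw Pv Pw; rewrite /count_below (bigD1 (Ordinal vp)) //= Pv.
by rewrite (bigD1 (Ordinal wp)) /= ?Pw // -val_eqE /= eq_sym.
Qed.

(** The off-diagonal entries of [q] say that exactly one point has the pair of colours [(i, j)] and
    that all others agree, which is a step; conversely, a step leaves on the diagonal the colours of
    [x] with one [j] removed. *)
Lemma xi_set_step i j (b d : L) (q : 'M[k]_n.+1) (y : Xset d) (x : Xset b) :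
    i != j ->
    (forall a e, q a e = (wt b a - (a == j)%:R) *+ (a == e) + ((a == i) && (e
      == j))%:R) ->
  xi_set q (y, x) <-> step i j (colour y) (colour x).
Proof.
move=> ij qE; rewrite xi_setP.
have [p0 yp0] := colour_supported y; have [p1 xp1] := colour_supported x.
split=> [H|[w [xw yE]] a e ae].
  pose p := maxn p0 p1.
  have yp : supported ord0 p (colour y) := supported_leq (leq_maxl _ _) yp0.
  have xp : supported ord0 p (colour x) := supported_leq (leq_maxr _ _) xp1.
  have cE a e : (a, e) != (ord0, ord0) ->
      (count_below p (fun w => (colour y w == a) && (colour x w == e)))%:R =
        q a e.
    move=> ae; have [m Hm ->] := H a e ae; congr _%:R.
    by apply/card_eq_II; rewrite -(card_eql (card_pair_below yp xp ae)).
  have nd (a e : I) : a != e -> (a, e) != (ord0, ord0).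
    by apply: contraNneq => -[-> ->].
  have := cE i j (nd _ _ ij); rewrite qE (negPf ij) mulr0n add0r !eqxx.
  move=> /(natr_inj_pchar0 hk) c1.
  have [w wp /andP[/eqP yw /eqP xw]] : exists2 w : 'I_p, true &
      (colour y w == i) && (colour x w == j).
    apply: contrapT => nw; move: c1; rewrite /count_below big1 // => w _;
      apply/eqP.
    by rewrite eqb0; apply/negP => yxw; apply: nw; exists w.
  exists w; split=> //; apply: funext => v; rewrite /upd;
    case: eqP => [->//|/eqP vw].
  (* A second differing point would be counted by the entry [(i, j)], which is 1, or by another
     off-diagonal entry, which is 0. *)
  apply/eqP/negPn/negP => yxv; have vp : (v < p)%N.
    rewrite ltnNge; apply/negP => pv; move: yxv.
    by rewrite yp // xp // eqxx.
  have := cE _ _ (nd _ _ yxv); rewrite qE (negPf yxv) mulr0n add0r.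
  move=> /(natr_inj_pchar0 hk);
    case: (boolP (_ && _)) => [/andP[/eqP yv /eqP xv] _|_ cv].
    have : (1 < count_below p (fun w =>
      (colour y w == i) && (colour x w == j)))%N.
      by apply: (below_ge2 vp (ltn_ord w) vw); rewrite ?yv ?xv ?yw ?xw !eqxx.
    by rewrite c1.
  have : (0 < count_below p (fun w =>
    (colour y w == colour y v) && (colour x w == colour x v)))%N.
    by rewrite /count_below (bigD1 (Ordinal vp)) //= !eqxx.
  by rewrite cv.
pose p := maxn w.+1 (maxn p0 p1).
have wp : (w < p)%N by rewrite leq_maxl.
have yp : supported ord0 p (colour y).
  by apply: supported_leq yp0; rewrite !leq_max leqnn orbT.
have xp : supported ord0 p (colour x).
  by apply: supported_leq xp1; rewrite !leq_max leqnn !orbT.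
exists (count_below p (fun w => (colour y w == a) && (colour x w == e))).
  exact: card_pair_below.
have rest : (\sum_(v < p | v != Ordinal wp) (colour y v == a) && (colour x v ==
  e) =
    (a == e) * \sum_(v < p | v != Ordinal wp) (colour x v == a))%N.
  rewrite big_distrr; apply: eq_bigr => v; rewrite -val_eqE /= => vw.
  rewrite yE upd_neq // mulnb; congr (nat_of_bool _).
  case: (eqVneq (colour x v) a) => [->|_]; last by rewrite andbF.
  by rewrite andbT.
rewrite qE /count_below (bigD1 (Ordinal wp)) //= rest yE upd_eq xw natrD natrM
  addrC.
rewrite (eq_sym i) (eq_sym j) -mulr_natl; congr (_ + _).
case: (eqVneq a e) => [ae'|_]; last by rewrite !mul0r.
rewrite !mul1r; subst e; have a0 : a != ord0 by move: ae;
  rewrite xpair_eqE andbb.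
rewrite (colour_wt hk a xp) (negPf a0) mul0r addr0 /count_below (bigD1 (Ordinal
  wp)) //=.
by rewrite xw (eq_sym j) natrD addrAC subrr add0r.
Qed.

Lemma xi_step i j (b d : L) (q : 'M[k]_n.+1) : i != j ->
    (forall a e, q a e = (wt b a - (a == j)%:R) *+ (a == e) + ((a == i) && (e
      == j))%:R) ->
  xi d b q = Salg_in (step_hom i j d b).
Proof.
move=> ij qE; congr Salg_in; apply: HomP => -[y x] /=.
by congr (nat_of_bool _)%:R; apply/asbool_equiv_eq; exact: xi_set_step.
Qed.

Lemma lo_neq_hi (i : 'I_n) : lo i != hi i.
Proof. by rewrite -val_eqE /= neq_ltn leqnn. Qed.

Lemma qplusE (i : 'I_n) (b : L) a e : qplus i b a e =
  (wt b a - (a == hi i)%:R) *+ (a == e) + ((a == lo i) && (e == hi i))%:R.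
Proof. by rewrite /qplus /qdiag !mxE. Qed.

(** The matrix is built from the target [c = b - alpha_i]; in terms of the source [b] its diagonal
    is b - eps_{lo i}, the shape that [xi_step] expects. *)
Lemma qminusE (i : 'I_n) (b c : L) a e : add_root i c b -> qminus i c a e =
  (wt b a - (a == lo i)%:R) *+ (a == e) + ((a == hi i) && (e == lo i))%:R.
Proof. by move=> cb; rewrite /qminus /qdiag !mxE cb addrA addrAC addrK. Qed.

End XiStep.

(** * Generation of gl_n by h, the e_i and the f_i *)

Section Inflations.
Variables (k : fieldType) (hk : [pchar k] =i pred0) (t : k) (n : nat).
Local Notation L := (Lambda t n).
Local Notation I := 'I_n.+1.

Section OneModule.
Variable M : Smod t n.
Local Notation A := (sact (sstr M)).

Lemma add_root_lower i (b c : L) : add_root i c b <-> shifted (hi i) (lo i) b c.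
Proof.
by split=> H a; rewrite H -addrA [X in _ + X]addrA subrK subrr addr0.
Qed.

Lemma gl_struct_inflation : is_inflation (gl_struct hk M).
Proof.
split=> [b m h /wprojP mb|b m i /wprojP mb|b m i /wprojP mb] /=.
- by rewrite (gl_act_gen hk) (mx_act_diag _ mb).
- rewrite (gl_act_gen hk) mx_act_delta; split=> [c bc|nc].
    rewrite (unit_act_weight _ _ mb) (Eunit_shifted hk (lo_neq_hi i) bc).
    by rewrite (xi_step hk _ (lo_neq_hi i)) // => a e; exact: qplusE.
  exact: (unit_act_none nc mb).
rewrite (gl_act_gen hk) mx_act_delta; split=> [c cb|nc].
  have bc := (add_root_lower i b c).1 cb; have ij := lo_neq_hi i.
  rewrite eq_sym in ij; rewrite (unit_act_weight _ _ mb) (Eunit_shifted hk ij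
    bc).
  by rewrite (xi_step hk _ ij) // => a e; exact: qminusE.
by apply: (unit_act_none _ mb) => c /(add_root_lower i b c).2; exact: nc.
Qed.

Lemma Ustruct_ext (V V' : Ustruct n M) :
  (forall u m, uact V u m = uact V' u m) -> V = V'.
Proof.
case: V V' => [a ll lr a1 aM] [a' ll' lr' a1' aM'] /= aa'.
have e : a = a' by apply: funext => u; apply: funext => m.
by subst a'; congr MkUstruct; exact: Prop_irrelevance.
Qed.

Local Notation U := (Ugl k n.+1).

Lemma UgenD X Y : Ugen (X + Y) = Ugen X + Ugen Y :> U.
Proof.
have -> : Ugen X + Ugen Y = Uadd (Ugen X) (Ugen Y) :> U by [].
by rewrite UaddE; apply/Ucl_eq; constructor.
Qed.

Lemma UgenZ c X : Ugen (c *: X) = c *: Ugen X :> U.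
Proof.
have -> : c *: Ugen X = Umul (Uscal n.+1 c) (Ugen X) :> U by [].
by rewrite UmulE; apply/Ucl_eq; constructor.
Qed.

Lemma Ugen_bracket X Y : Ugen X * Ugen Y =
  Ugen Y * Ugen X + Ugen (X *m Y - Y *m X) :> U.
Proof.
have -> : Ugen X * Ugen Y = Umul (Ugen X) (Ugen Y) :> U by [].
have -> : Ugen Y * Ugen X + Ugen (X *m Y - Y *m X) =
  Uadd (Umul (Ugen Y) (Ugen X)) (Ugen (X *m Y - Y *m X)) :> U by [].
by rewrite !UmulE UaddE; apply/Ucl_eq; constructor.
Qed.

Lemma uactD (V : Ustruct n M) u v m : uact V (u + v) m =
  uact V u m + uact V v m.
Proof. by have := uact_linl V 1 u v m; rewrite !scale1r. Qed.

Lemma uact0 (V : Ustruct n M) m : uact V 0 m = 0.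
Proof. by have := uact_linl V (-1) 0 0 m;
  rewrite scaler0 addr0 scaleN1r addNr. Qed.

Lemma uactZ (V : Ustruct n M) c u m : uact V (c *: u) m = c *: uact V u m.
Proof. by have := uact_linl V c u 0 m; rewrite uact0 !addr0. Qed.

Lemma uact0r (V : Ustruct n M) u : uact V u 0 = 0.
Proof. by have := uact_linr V (-1) u 0 0;
  rewrite scaler0 addr0 scaleN1r addNr. Qed.

Lemma uactDr (V : Ustruct n M) u m m' : uact V u (m + m') =
  uact V u m + uact V u m'.
Proof. by have := uact_linr V 1 u m m'; rewrite !scale1r. Qed.

Section Uniqueness.
Variables (V : Ustruct n M) (HV : is_inflation V).

Definition agrees (X : 'M[k]_n.+1) : Prop := forall m, uact V (Ugen X) m =
  mx_act X m.

Lemma agrees_weight X :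
  (forall b m, wproj b m = m -> uact V (Ugen X) m = mx_act X m) -> agrees X.
Proof.
move=> H; elim/wproj_ind => [|m m' Hm Hm'|]; last exact: H.
  rewrite uact0r; have := mx_act_linr (-1) X (0 : M) 0.
  by rewrite scaler0 addr0 scaleN1r addNr.
by rewrite uactDr Hm Hm'; have := mx_act_linr 1 X m m'; rewrite !scale1r.
Qed.

Lemma agrees_linear c X Y : agrees X -> agrees Y -> agrees (c *: X + Y).
Proof. by move=> HX HY m; rewrite UgenD UgenZ uactD uactZ HX HY mx_act_linl.
  Qed.

Lemma agrees_bracket X Y : agrees X -> agrees Y -> agrees (X *m Y - Y *m X).
Proof.
move=> HX HY m; apply: (addrI (mx_act Y (mx_act X m))).
by rewrite -(mx_act_bracket hk) -!HY -!HX -!uactM (Ugen_bracket X Y) uactD.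
Qed.

Lemma agrees_diag i : agrees (delta_mx i i).
Proof.
apply: agrees_weight => b m mb.
have <- : diag_mx (delta_mx 0 i) = delta_mx i i :> 'M[k]_n.+1.
  apply/matrixP => a e; rewrite !mxE eqxx /=.
  case: (eqVneq a e) => [->|ae]; first by rewrite andbb.
  by rewrite mulr0n; case: eqP => //= <-; rewrite eq_sym (negPf ae).
rewrite (mx_act_diag _ mb); apply: inflation_h => //; exact/wprojP.
Qed.

Lemma agrees_upper i : agrees (delta_mx (lo i) (hi i)).
Proof.
apply: agrees_weight => b m mb; rewrite -(gl_act_gen hk).
have /wprojP mb' := mb.
have [e1 n1] := inflation_e HV i mb'.
have [e2 n2] := inflation_e gl_struct_inflation i mb'.
case: (pselect (exists c, add_root i b c)) => [[c bc]|/forallNP nc].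
  by rewrite -/(gl_e k i) (e1 _ bc) -(e2 _ bc).
by rewrite -/(gl_e k i) (n1 nc) -(n2 nc).
Qed.

Lemma agrees_lower i : agrees (delta_mx (hi i) (lo i)).
Proof.
apply: agrees_weight => b m mb; rewrite -(gl_act_gen hk).
have /wprojP mb' := mb.
have [e1 n1] := inflation_f HV i mb'.
have [e2 n2] := inflation_f gl_struct_inflation i mb'.
case: (pselect (exists c, add_root i c b)) => [[c bc]|/forallNP nc].
  by rewrite -/(gl_f k i) (e1 _ bc) -(e2 _ bc).
by rewrite -/(gl_f k i) (n1 nc) -(n2 nc).
Qed.

Lemma delta_bracket (i j l : I) : i != l ->
  delta_mx i j *m delta_mx j l - delta_mx j l *m delta_mx i j =
    delta_mx i l :> 'M[k]_n.+1.
Proof.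
by move=> il; rewrite !mul_delta_mx_cond eqxx (eq_sym l) (negPf il) mulr0n
  subr0.
Qed.

(** E_{i,j} is the bracket of E_{i,i+1} and E_{i+1,j}, and likewise below the diagonal; the
    induction starts at the e_i and f_i. *)
Lemma agrees_delta_dist (d : nat) (i j : I) : (j = i + d.+1 :> nat)%N ->
  agrees (delta_mx i j) /\ agrees (delta_mx j i).
Proof.
elim: d i j => [|d IHd] i j ij.
  have i_n : (i < n)%N by rewrite -ltnS; apply: leq_trans (ltn_ord j);
    rewrite ij addn1.
  have -> : i = lo (Ordinal i_n) by exact: val_inj.
  have -> : j = hi (Ordinal i_n) by apply: val_inj; rewrite /= ij addn1.
  by split; [exact: agrees_upper|exact: agrees_lower].
have i_n : (i < n)%N.
  by rewrite -ltnS; apply: leq_trans (ltn_ord j);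
    rewrite ij !ltnS addnS ltnS leq_addr.
pose l := hi (Ordinal i_n);
  have [H1 H2] := IHd l j (etrans ij (esym (addSnnS i d.+1))).
have [ul lu] : agrees (delta_mx i l) /\ agrees (delta_mx l i).
  have -> : i = lo (Ordinal i_n) by exact: val_inj.
  by split; [exact: agrees_upper|exact: agrees_lower].
have neij : i != j by rewrite -val_eqE /= ij -[X in X == _]addn0 eqn_add2l.
split; first by rewrite -(@delta_bracket i l j) //; exact: agrees_bracket.
by rewrite -(@delta_bracket j l i) 1?eq_sym //; exact: agrees_bracket.
Qed.

Lemma agrees_all X : agrees X.
Proof.
elim/mx_linear_ind: X => [c X Y|i j]; first exact: agrees_linear.
case: (ltngtP i j) => [ij|ji|/val_inj->]; last exact: agrees_diag.
  by have [] // := @agrees_delta_dist (j - i.+1) i j;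
    rewrite addnS -addSn subnKC.
by have [] // := @agrees_delta_dist (i - j.+1) j i; rewrite addnS -addSn subnKC.
Qed.

Lemma inflation_uniq : V = gl_struct hk M.
Proof.
apply: Ustruct_ext; elim/Ucl_ind; elim=> [c|X|x IHx y IHy|x IHx y IHy] m.
- have -> : Ucl (UScal n.+1 c) = c *: 1 :> U.
    exact: (esym (mulr1 (Uscal n.+1 c : U))).
  by rewrite uactZ uact1 [RHS]uactZ uact1.
- by rewrite [LHS]agrees_all [RHS](gl_act_gen hk).
- by rewrite -UaddE [LHS]uactD [RHS]uactD IHx IHy.
- by rewrite -UmulE [LHS]uactM [RHS]uactM IHx IHy.
Qed.
End Uniqueness.
End OneModule.

End Inflations.

(** * Functoriality of the gl_n-action *)

Section Morphisms.
Variables (k : fieldType) (t : k) (n : nat).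
Variables (M N : Smod t n) (f : Shom M N).

Lemma shomD m m' : f (m + m') = f m + f m'.
Proof. by have := shom_linear f 1 m m'; rewrite !scale1r. Qed.

Lemma shom0 : f 0 = 0.
Proof. by have := shom_linear f (-1) 0 0;
  rewrite scaler0 addr0 scaleN1r addNr. Qed.

Lemma shomZ c m : f (c *: m) = c *: f m.
Proof. by have := shom_linear f c m 0; rewrite shom0 !addr0. Qed.

Lemma shom_sum (J : Type) (r : seq J) (P : pred J) (F : J -> M) :
  f (\sum_(j <- r | P j) F j) = \sum_(j <- r | P j) f (F j).
Proof. by apply: big_morph; [exact: shomD|exact: shom0]. Qed.

(** A list containing the weights of [m] also contains those of [f m], so both sums run over it. *)
Lemma shom_unit_act i j m : f (unit_act i j m) = unit_act i j (f m).
Proof.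
have [s [us _ ms]] := wproj_decomp m.
rewrite (unit_act_seq i j us ms) (unit_act_seq i j us).
  by rewrite shom_sum; apply: eq_bigr => b _; exact: shom_act.
by move=> b bs; rewrite /wproj -shom_act -/(wproj b m) ms // shom0.
Qed.

Lemma shom_gl_act u m : f (gl_act u m) = gl_act u (f m).
Proof.
rewrite /gl_act; elim: (repr u) m => [c|X|x IHx y IHy|x IHx y IHy] m /=.
- exact: shomZ.
- rewrite shom_sum; apply: eq_bigr => i _; rewrite shom_sum;
  apply: eq_bigr => j _.
  by rewrite shomZ shom_unit_act.
- by rewrite shomD IHx IHy.
- by rewrite IHx IHy.
Qed.

End Morphisms.

(** * Generation of S(n, t) by the matrix units *)

Section PairTypes.
Variables (n : nat).
Local Notation I := 'I_n.+1.
Implicit Types (z x y : nat -> I) (q : I -> I -> nat).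

(** The class of the pair of default colours is infinite; its entry is set to 0, so that a type is a
    matrix of natural numbers. *)
Definition pair_count p z x (a e : I) : nat :=
  if (a, e) == (ord0, ord0) then 0%N else count_below p (fun w =>
    (z w == a) && (x w == e)).

Definition pair_type q z x : Prop := forall a e,
  if (a, e) == (ord0, ord0) then q a e = 0%N
  else [set w | z w = a /\ x w = e] #= `I_(q a e).

Lemma pair_typeP p q z x : supported ord0 p z -> supported ord0 p x ->
  pair_type q z x <-> q =2 pair_count p z x.
Proof.
move=> zp xp; split=> H a e; have := H a e; rewrite /pair_count;
  case: ifPn => // ae.
  by move=> qae; apply/card_eq_II; rewrite -(card_eql qae);
    exact: card_pair_below.
by move=> ->; exact: card_pair_below.
Qed.

Lemma pair_type_uniq q q' p z x : supported ord0 p z -> supported ord0 p x ->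
  pair_type q z x -> pair_type q' z x -> q =2 q'.
Proof.
move=> zp xp /(pair_typeP _ zp xp) H /(pair_typeP _ zp xp) H' a e.
by rewrite H H'.
Qed.

Lemma pair_type_perm q z x (g : Sinf) :
  pair_type q z x -> pair_type q (z \o g) (x \o g).
Proof.
move=> H a e; have := H a e; case: ifP => // _ qae; apply: card_eq_trans qae.
have -> : [set w | z w = a /\ x w = e]
    = g @` [set w | (z \o g) w = a /\ (x \o g) w = e].
  apply/seteqP; split=> [w /= H'|_ [w H' <-] //].
  by exists (g^-1%g w); rewrite /= sinvK.
by rewrite card_eq_sym; exact/card_inj_image/(can_inj (@sfunK _)).
Qed.

(** Types classify orbits: a pair of colourings is one colouring by pairs, with default colour
    [(ord0, ord0)]. *)
Lemma pair_type_orbit p q z x z' x' :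
    supported ord0 p z -> supported ord0 p x ->
    supported ord0 p z' -> supported ord0 p x' ->
    pair_type q z x -> pair_type q z' x' ->
  exists g : Sinf, forall w, z' (g w) = z w /\ x' (g w) = x w.
Proof.
move=> zp xp zp' xp' H H'.
have [||[a e] ae|g gE] := @recolouring_below _ (ord0 : I, ord0 : I) p
    (fun w => (z w, x w)) (fun w => (z' w, x' w)).
- by move=> w pw; rewrite zp ?xp.
- by move=> w pw; rewrite zp' ?xp'.
- have := (pair_typeP q zp xp).1 H a e.
  rewrite ((pair_typeP q zp' xp').1 H' a e) /pair_count (negPf ae) => E.
  by apply: etrans (etrans (esym E) _); apply: eq_bigr => w _;
    rewrite xpair_eqE.
by exists g => w; have [] := gE w.
Qed.

(** For the type [q] of a pair of colourings, the number of points where they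
    differ. *)
Definition distance q : nat := (\sum_a \sum_(e | e != a) q a e)%N.

Lemma distance_below p q z x : supported ord0 p z -> supported ord0 p x ->
  pair_type q z x -> distance q = count_below p (fun w => z w != x w).
Proof.
move=> zp xp /(pair_typeP q zp xp) qE.
transitivity (\sum_a \sum_(e | e != a) count_below p (fun w =>
  (z w == a) && (x w == e)))%N.
  apply: eq_bigr => a _; apply: eq_bigr => e ea; rewrite qE /pair_count ifN //.
  by apply: contraNneq ea => -[-> ->].
rewrite /count_below; under eq_bigr do rewrite exchange_big.
rewrite exchange_big; apply: eq_bigr => w _ /=.
rewrite (bigD1 (z w)) //= [X in (_ + X)%N]big1 ?addn0 => [|a az]; last first.
  by apply: big1 => e _; rewrite eq_sym (negPf az).
rewrite eqxx /=; have [zx|zx] := eqVneq (z w) (x w).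
  by apply: big1 => e; rewrite zx eq_sym => /negPf->.
rewrite (bigD1 (x w)) 1?eq_sym //= eqxx big1 // => e /andP[_].
by rewrite eq_sym => /negPf->.
Qed.

(** The subtraction never truncates: when its term is 1, the point [v] is itself counted in
    [q' a e]. *)
Lemma pair_type_upd p q q' y x v i :
    (v < p)%N -> supported ord0 p y -> supported ord0 p x ->
    pair_type q' y x ->
  pair_type q (upd y v i) x <-> forall a e, (q a e =
    if (a, e) == (ord0, ord0) then 0
    else q' a e + (i == a) && (x v == e) - (y v == a) && (x v == e))%N.
Proof.
move=> vp yp xp /(pair_typeP _ yp xp) q'E.
rewrite (pair_typeP q (upd_supported i vp yp) xp).
have E a e : pair_count p (upd y v i) x a e = (if (a, e) == (ord0, ord0) then 0
    else q' a e + (i == a) && (x v == e) - (y v == a) && (x v == e))%N.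
  rewrite q'E /pair_count; case: ifP => // _.
  have := below_upd_rel (fun b w => (b == a) && (x w == e)) y i vp => <-.
  by rewrite addnK.
by split=> H a e; rewrite H E.
Qed.

Lemma distance_upd p q q' y x v i :
    (v < p)%N -> supported ord0 p y -> supported ord0 p x ->
    pair_type q' y x -> pair_type q (upd y v i) x ->
  (distance q + (y v != x v) = distance q' + (i != x v))%N.
Proof.
move=> vp yp xp H' H.
rewrite (distance_below (upd_supported i vp yp) xp H) (distance_below yp xp H').
exact: (below_upd_rel (fun b w => b != x w)).
Qed.

End PairTypes.

(** * Orbit indicators and the leading term of a product *)

Section Generation.
Variables (k : fieldType) (hk : [pchar k] =i pred0) (t : k) (n : nat).
Local Notation L := (Lambda t n).
Local Notation I := 'I_n.+1.
Local Notation S := (Salg t n).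
Local Notation U := (Ugl k n.+1).

Lemma pair_type_invariant (q : I -> I -> nat) :
  perm_invariant (fun z x => `[<pair_type q z x>]%:R : k).
Proof. by apply: perm_invariantP => z x g; exact: pair_type_perm. Qed.

Definition type_hom q (d b : L) : Hom k (Xset b) (Xset d) :=
  kernel (pair_type_invariant q) d b.

Lemma type_homE q (d b : L) (z : Xset d) (x : Xset b) :
  type_hom q d b (z, x) = `[<pair_type q (colour z) (colour x)>]%:R :> k.
Proof. by []. Qed.

Lemma colour_supported2 (d b : L) (z : Xset d) (x : Xset b) : exists p,
  supported ord0 p (colour z) /\ supported ord0 p (colour x).
Proof.
have [p zp] := colour_supported z; have [p' xp] := colour_supported x.
by exists (maxn p p'); split; [apply: supported_leq zp; exact: leq_maxl|
  apply: supported_leq xp; exact: leq_maxr].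
Qed.

Lemma pair_type_hom (d b : L) q (z z' : Xset d) (x x' : Xset b)
    (f : Hom k (Xset b) (Xset d)) :
  pair_type q (colour z) (colour x) -> pair_type q (colour z') (colour x') ->
  f (z, x) = f (z', x').
Proof.
move=> H H'; have [p [zp xp]] := colour_supported2 z x.
have [p' [zp' xp']] := colour_supported2 z' x'; pose r := maxn p p'.
have [g gE] := pair_type_orbit (supported_leq (leq_maxl p p') zp)
  (supported_leq (leq_maxl p p') xp) (supported_leq (leq_maxr p p') zp')
  (supported_leq (leq_maxr p p') xp') H H'.
have -> : z' = fact g z.
  apply: colour_inj => w; rewrite colour_fact; have [<- _] := gE (g^-1%g w).
  by rewrite /= sinvK.
have -> : x' = fact g x.
  apply: colour_inj => w; rewrite colour_fact; have [_ <-] := gE (g^-1%g w).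
  by rewrite /= sinvK.
by have /Hom_predP -> := hfun_inv f.
Qed.

(** In a non-default pair one colour is a tail colour, which bounds the entry. So only finitely many
    types occur between two given objects. *)
Definition type_bound (d b : L) : nat :=
  (\sum_j wtail d j + \sum_j wtail b j)%N.

Lemma leq_below p (P Q : pred nat) : (forall w, P w -> Q w) ->
  (count_below p P <= count_below p Q)%N.
Proof.
by move=> PQ; apply: leq_sum => w _; case: (boolP (P w)) => // /PQ->.
Qed.

Lemma pair_count_bound (d b : L) p (z : Xset d) (x : Xset b) a e :
    supported ord0 p (colour z) -> supported ord0 p (colour x) ->
  (pair_count p (colour z) (colour x) a e <= type_bound d b)%N.
Proof.
move=> zp xp; rewrite /pair_count; case: ifPn => // ae.
have bound (c : L) (y : Xset c) (j : 'I_n) (R : pred nat) :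
  supported ord0 p (colour y) ->
    (forall w, R w -> colour y w = lift ord0 j) ->
      (count_below p R <= \sum_j wtail c j)%N.
  move=> yp Ry; rewrite (bigD1 j) //=; apply: leq_trans (leq_addr _ _).
  by rewrite -(colour_below j yp); apply: leq_below => w /Ry ->.
case: (unliftP ord0 a) ae => [j aE _|-> ].
  apply: leq_trans (leq_addr _ _); apply: (bound _ z j) => // w /andP[/eqP-> _].
  exact: aE.
case: (unliftP ord0 e) => [j eE _|-> /eqP//].
apply: leq_trans (leq_addl _ _); apply: (bound _ x j) => // w /andP[_ /eqP->].
exact: eE.
Qed.

Lemma pair_type_finite (d b : L) (z : Xset d) (x : Xset b) :
  exists q : {ffun I * I -> 'I_(type_bound d b).+1},
    pair_type (fun a e => q (a, e)) (colour z) (colour x).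
Proof.
have [p [zp xp]] := colour_supported2 z x.
exists [ffun u => inord (pair_count p (colour z) (colour x) u.1 u.2)].
apply/(pair_typeP _ zp xp) => a e; rewrite ffunE inordK // ltnS.
exact: pair_count_bound.
Qed.

Lemma hom_sum (X Y : finitary) (J : Type) (r : seq J) (P : pred J)
    (F : J -> Hom k X Y) yx :
  (\sum_(j <- r | P j) F j) yx = \sum_(j <- r | P j) (F j yx : k).
Proof. by apply: (big_morph (fun f : Hom k X Y => f yx : k)). Qed.

Lemma type_hom_ind (d b : L) (P : Hom k (Xset b) (Xset d) -> Prop)
    (f : Hom k (Xset b) (Xset d)) :
    P 0 -> (forall c g h, P g -> P h -> P (c *: g + h)) ->
    (forall q z x, pair_type q (colour z) (colour x) -> f (z, x) <> 0 ->
       P (type_hom q d b)) ->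
  P f.
Proof.
move=> P0 Plin Ptype.
pose Q (q : {ffun I * I -> 'I_(type_bound d b).+1}) (zx : Xset d * Xset b) :=
  pair_type (fun a e => q (a, e)) (colour zx.1) (colour zx.2).
(* [c q] is the value of [f] on the orbit of type [q], and 0 when that type does not occur. *)
have /boolp.choice[c cP] q : exists c : k,
    (forall zx, Q q zx -> f zx = c) /\ (c <> 0 ->
      exists zx, Q q zx /\ f zx <> 0).
  case: (pselect (exists zx, Q q zx)) => [[[z x] zxq]|/forallNP nq].
    exists (f (z, x)); split=> [[z' x'] zxq'|fzx];
      first exact: pair_type_hom zxq' zxq.
    by exists (z, x).
  by exists 0; split=> // zx /nq.
have -> : f = \sum_q c q *: type_hom (fun a e => q (a, e)) d b.
  apply: HomP => -[z x]; rewrite hom_sum; have [q zxq] := pair_type_finite z x.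
  rewrite (bigD1 q) // big1 => [|q' /andP[_ q'q]].
    apply: etrans _ (esym (addr0 _)); rewrite HomZ type_homE asboolT // mulr1.
    by have [/(_ (z, x)) -> //] := cP q.
  rewrite HomZ type_homE asboolF ?mulr0 // => zxq';
    have [p [zp xp]] := colour_supported2 z x.
  case/eqP: q'q; apply/ffunP => -[a e]; apply: val_inj.
  exact: (pair_type_uniq zp xp zxq' zxq).
have PD g h : P g -> P h -> P (g + h).
  by move=> Pg; rewrite -[g]scale1r; exact: Plin.
apply: big_ind => // q _; have [->|cq] := eqVneq (c q) 0;
  first by rewrite scale0r.
rewrite -[_ *: _]addr0; apply: Plin => //.
have [_ /(_ (elimN eqP cq))[[z x] [zxq fzx]]] := cP q.
exact: Ptype zxq fzx.
Qed.

(** [u] may depend on [b], but neither on the module nor on the vector. *)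
Definition realized (b : L) (a : S) : Prop :=
  exists u : U, forall (M : Smod t n) (m : M), wproj b m = m ->
    sact (sstr M) a m = gl_act u m.

Lemma realized0 b : realized b 0.
Proof.
exists 0 => M m _; rewrite sact0l.
by have := gl_act_linl hk (-1) 0 0 m; rewrite scaler0 addr0 scaleN1r addNr.
Qed.

Lemma realized_linear b c a a' : realized b a -> realized b a' ->
  realized b (c *: a + a').
Proof.
move=> [u uP] [u' u'P]; exists (c *: u + u') => M m mb.
by rewrite sact_linl (gl_act_linl hk) uP // u'P.
Qed.

Lemma realized_id b : realized b (Salg_id b).
Proof. by exists 1 => M m mb; rewrite (gl_act1 hk). Qed.

Lemma realized_Eunit b c i j (f : Hom k (Xset b) (Xset c)) :
  realized b (Salg_in f) -> realized b (Salg_mul (Eunit i j c) (Salg_in f)).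
Proof.
move=> [u uP]; exists (Ugen (delta_mx i j) * u) => M m mb.
rewrite (gl_actM hk) (gl_act_gen hk) mx_act_delta -uP // sactM.
rewrite (@unit_act_weight _ _ _ _ _ _ c) //.
by rewrite /wproj -sactM Salg_id_mulin.
Qed.

Lemma step_type_value (b c d : L) i j q (z : Xset d) (x : Xset b) :
  Hom_comp t (step_hom i j d c) (type_hom q c b) (z, x) =
  mu t [set y : Xset c | step i j (colour z) (colour y) /\
                         pair_type q (colour y) (colour x)].
Proof.
rewrite -[RHS]mul1r; apply: Hom_comp_indicator => y /=.
by rewrite asbool_and mulr1 /stepF -natrM mulnb.
Qed.

(** Recolouring [upd z0 w j] at [w] recovers [z0], so that the product of the
    corresponding matrix unit with the orbit of [(upd z0 w j, x0)] is the orbit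
      of
    [(z0, x0)], up to a nonzero factor and to pairs of smaller distance. *)
Lemma step_type_leading (b c d : L) i j q q' p (z0 x0 : nat -> I) w :
    i != j -> shifted j i d c ->
    (w < p)%N -> supported ord0 p z0 -> supported ord0 p x0 ->
    z0 w = i -> x0 w = j ->
    pair_type q z0 x0 -> pair_type q' (upd z0 w j) x0 ->
  distance q = (distance q').+1 /\
  forall (z : Xset d) (x : Xset b) q1,
    pair_type q1 (colour z) (colour x) -> (distance q <= distance q1)%N ->
  Hom_comp t (step_hom i j d c) (type_hom q' c b) (z, x) =
  (q i j)%:R * type_hom q d b (z, x).
Proof.
move=> ij dc wp z0p x0p z0w x0w H0 H0'.
have D0 : distance q = (distance q').+1.
  have := distance_upd wp z0p x0p H0 H0'.
  by rewrite z0w x0w ij eqxx /= addn1 addn0.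
split=> // z x q1 H1 qq1.
have q'E := (pair_type_upd q' j wp z0p x0p H0).1 H0'.
have qE : forall a e, (q a e = if (a, e) == (ord0, ord0) then 0
    else q' a e + (i == a) && (j == e) - (j == a) && (j == e))%N.
  have z0E : upd (upd z0 w j) w i = z0 by rewrite upd_upd -z0w upd_id.
  have := (pair_type_upd q i wp (upd_supported j wp z0p) x0p H0').1.
  by rewrite z0E x0w upd_eq; apply.
rewrite z0w x0w in q'E.
have [p1 [zp1 xp1]] := colour_supported2 z x.
rewrite step_type_value.
(* If [colour x v] were not [j], then [y] would already differ from [x] at [v], and [distance q1]
   would be at most [distance q'], below the assumed bound [distance q]. *)
have key (y : Xset c) v : colour y v = j -> colour z = upd (colour y) v i ->
    pair_type q' (colour y) (colour x) ->
      pair_type q (colour z) (colour x) /\ colour x v = j.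
  move=> yv zE Hy; have [p2 [yp2 _]] := colour_supported2 y x.
  pose r := maxn v.+1 (maxn p1 p2).
  have vr : (v < r)%N by rewrite leq_maxl.
  have yr : supported ord0 r (colour y).
    by apply: supported_leq yp2; rewrite !leq_max leqnn !orbT.
  have xr : supported ord0 r (colour x).
    by apply: supported_leq xp1; rewrite !leq_max leqnn orbT.
  have xv : colour x v = j.
    apply/eqP; apply: contraLR qq1 => xv; rewrite -ltnNge D0 ltnS.
    rewrite zE in H1; have := distance_upd vr yr xr Hy H1.
    rewrite yv eq_sym xv addn1 => D1.
    by move: (leq_b1 (i != colour x v)) => ?; lia.
  split=> //; rewrite zE; apply/(pair_type_upd q i vr yr xr Hy) => a e.
  by rewrite qE yv xv.
have [Hz|nHz] := pselect (pair_type q (colour z) (colour x)); last first.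
  rewrite type_homE asboolF // mulr0 -[RHS](mu_set0 t (Xset c)); congr mu.
  by apply/seteqP; split=> // y /= [[v [yv zE]] /(key y v yv zE)[]].
rewrite type_homE asboolT // mulr1; apply: mu_finite.
have := Hz i j; rewrite ifN; last first.
  by apply: contraNneq ij => -[-> ->].
apply: card_eq_trans; rewrite card_eq_sym.
have /boolp.choice[F FP] (v : nat) : exists y : Xset c,
    colour z v = i -> colour y = upd (colour z) v j.
  case: (pselect (colour z v = i)) => [zv|nzv]; last by exists (coset c 1%g).
  by have [y yE] := shifted_colour hk dc zv; exists y.
(* The intermediate colourings correspond to the points with the pair of colours [(i, j)], whence
   the factor [q i j]. *)
suff -> : [set y : Xset c | step i j (colour z) (colour y) /\
      pair_type q' (colour y) (colour x)] =
    F @` [set v | colour z v = i /\ colour x v = j].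
  rewrite card_eq_sym; apply: card_image_in => v v' [zv _] [zv' _].
  by move=> /(congr1 (@colour _ _ _ _)); rewrite !FP //;
    apply: (upd_inj _ zv zv'); rewrite eq_sym.
apply/seteqP; split=> [y [[v [yv zE]] Hy]|_ [v [zv xv] <-]].
  have [_ xv] := key y v yv zE Hy;
    have zv : colour z v = i by rewrite zE upd_eq.
  exists v => //; apply: colour_inj => u; rewrite FP // zE upd_upd -yv.
  by rewrite upd_id.
split; first by exists v; rewrite FP // upd_eq upd_upd -zv upd_id.
pose r := maxn v.+1 p1.
have vr : (v < r)%N by rewrite leq_maxl.
have zr : supported ord0 r (colour z) by apply: supported_leq zp1;
  exact: leq_maxr.
have xr : supported ord0 r (colour x) by apply: supported_leq xp1;
  exact: leq_maxr.
rewrite FP //; apply/(pair_type_upd q' j vr zr xr Hz) => a e.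
by rewrite q'E zv xv.
Qed.

End Generation.

(** * Elements of S(n, t) acting through U(gl_n) *)

Section Realization.
Variables (k : fieldType) (hk : [pchar k] =i pred0) (t : k) (n : nat).
Local Notation L := (Lambda t n).
Local Notation I := 'I_n.+1.
Local Notation S := (Salg t n).
Local Notation U := (Ugl k n.+1).

Lemma shifted_sym i j (b c : L) : shifted i j b c -> shifted j i c b.
Proof. by move=> bc a; rewrite bc -addrA [X in _ + X]addrA subrK subrr addr0.
  Qed.

Lemma distance_eq (q q' : I -> I -> nat) : q =2 q' -> distance q = distance q'.
Proof. by move=> qq'; apply: eq_bigr => a _; apply: eq_bigr => e _. Qed.

Lemma coset_transitive (b : L) (x y : Xset b) : exists g, y = fact g x.
Proof.
exists (coset_rep y * (coset_rep x)^-1)%g.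
have := coset_act_coset b (coset_rep y * (coset_rep x)^-1)%g (coset_rep x).
by rewrite mulgVK !coset_repK.
Qed.

(** The identity is constant on orbits, so an orbit meeting the diagonal lies in it; by transitivity
    it is the whole diagonal. *)
Lemma type_hom_refl q (b : L) (x0 : Xset b) :
  pair_type q (colour x0) (colour x0) -> type_hom q b b = Hom_id k (Xset b).
Proof.
move=> H0; apply: HomP => -[z x]; rewrite type_homE /=.
congr (nat_of_bool _)%:R; apply/asbool_equiv_eq; split=> [H|->].
  have := pair_type_hom (Hom_id k (Xset b)) H H0.
  rewrite /= [in RHS]asboolT //; case: asboolP => // _ /eqP.
  by rewrite eq_sym oner_eq0.
have [g ->] := coset_transitive x0 x.
have -> : colour (fact g x0) = colour x0 \o g^-1%g.
  by apply: funext => w; rewrite colour_fact.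
exact: pair_type_perm.
Qed.

Lemma realized_distance (b : L) m (d : L) (f : Hom k (Xset b) (Xset d)) :
    (forall q z x, pair_type q (colour z) (colour x) -> f (z, x) <> 0 ->
       (distance q < m)%N) ->
  realized b (Salg_in f).
Proof.
elim: m d f => [|m IHm] d f Hf.
  suff -> : f = 0 by rewrite Salg_in0; exact: realized0.
  apply: HomP => -[z x]; rewrite Hom0; apply: contrapT => fzx.
  by have [q /Hf/(_ fzx)] := pair_type_finite z x.
apply: (type_hom_ind (P := fun g => realized b (Salg_in g)) (f := f)) =>
  [|c g h Hg Hh|q z0 x0 H0 fzx].
- by rewrite Salg_in0; exact: realized0.
- by rewrite Salg_in_linear; exact: realized_linear.
have qm := Hf _ _ _ H0 fzx.
case: (pselect (colour z0 = colour x0)) => [zx|zx].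
  have db := colour_eq_weight hk zx; subst d.
  by rewrite zx in H0; rewrite (type_hom_refl H0); exact: realized_id.
have [w zxw] : exists w, colour z0 w <> colour x0 w.
  by apply: contrapT => /forallNP nw; apply: zx; apply: funext => w;
    apply: contrapT.
set i := colour z0 w in zxw *; set j := colour x0 w in zxw *.
have [p0 [zp0 xp0]] := colour_supported2 z0 x0; pose p := maxn w.+1 p0.
have wp : (w < p)%N by rewrite leq_maxl.
have zp : supported ord0 p (colour z0) := supported_leq (leq_maxr _ _) zp0.
have xp : supported ord0 p (colour x0) := supported_leq (leq_maxr _ _) xp0.
have [c dc] : exists c, shifted j i d c by exact: (exists_shifted hk j (x :=
  z0)).
have ij : i != j by apply/eqP.
pose q' := pair_count p (upd (colour z0) w j) (colour x0).
have H0' : pair_type q' (upd (colour z0) w j) (colour x0).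
  by apply/(pair_typeP _ (upd_supported j wp zp) xp).
have [D0 value] := step_type_leading hk b ij dc wp zp xp erefl erefl H0 H0'.
pose N : k := (q i j)%:R.
(* Characteristic zero, and [w] is counted in [q i j]. *)
have N0 : N != 0.
  apply/eqP => /(natr_inj_pchar0 hk (x1 := q i j) (x2 := 0%N)).
  rewrite (pair_typeP q zp xp).1 // /pair_count ifN; last first.
    by apply: contraNneq ij => -[-> ->].
  by rewrite /count_below (bigD1 (Ordinal wp)) //= !eqxx.
pose psi := Hom_comp t (step_hom i j d c) (type_hom q' c b).
have Rpsi : realized b (Salg_in psi).
  rewrite /psi -Salg_mul_in -(Eunit_shifted hk ij (shifted_sym dc)).
  apply: realized_Eunit => //; apply: IHm => q1 y x H1; rewrite type_homE.
  case: asboolP => // H' _; have [p1 [yp1 xp1]] := colour_supported2 y x.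
  by rewrite (distance_eq (pair_type_uniq yp1 xp1 H1 H')) -ltnS -D0.
(* [N^-1 *: psi] and [type_hom q d b] agree at distances [m] and above, so the induction hypothesis
   applies to their difference. *)
have Rrest : realized b (Salg_in ((- N^-1) *: psi + type_hom q d b)).
  apply: IHm => q1 z x H1 ne0; rewrite ltnNge; apply/negP => mq1; apply: ne0.
  rewrite HomD HomZ (value _ _ _ H1); last by apply: leq_trans mq1.
  by rewrite mulrA mulNr mulVf // mulN1r addNr.
have -> : type_hom q d b = N^-1 *: psi + ((- N^-1) *: psi + type_hom q d b).
  by rewrite addrA -scalerDl subrr scale0r add0r.
by rewrite Salg_in_linear; exact: realized_linear.
Qed.

Lemma realized_hom (b d : L) (f : Hom k (Xset b) (Xset d)) :
  realized b (Salg_in f).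
Proof.
pose D (q : {ffun I * I -> 'I_(type_bound d b).+1}) :=
  distance (fun a e => q (a, e)).
apply: (@realized_distance _ (\max_q D q).+1) => q1 z x H1 _.
have [q H] := pair_type_finite z x; have [p [zp xp]] := colour_supported2 z x.
by rewrite (distance_eq (pair_type_uniq zp xp H1 H)) ltnS (leq_bigmax q).
Qed.

Lemma Salg_mulid_sum (a : S) (b : L) : exists s : seq L,
  Salg_mul a (Salg_id b) = \sum_(d <- s) Salg_in (a (d, b)).
Proof.
pose s := fset_set [set db.1 | db in [set db | a db <> 0]].
have fs : finite_set [set db.1 | db in [set db | a db <> 0]].
  exact/finite_image/sfinite.
exists s; apply: SalgP => -[d b'].
have sumE (r : seq L) : (\sum_(d <- r) Salg_in (a (d, b))) (d, b') =
    \sum_(d' <- r) Salg_in (a (d', b)) (d, b').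
  by apply: (big_morph (fun a : S => a (d, b'))) => // x y; exact: SalgD.
rewrite sumE; have [e|bb'] := eqVneq b b'; last first.
  rewrite Salg_mul_off // big1 // => d' _; rewrite Salg_in_off //.
  by apply: contra bb' => /eqP[_ ->].
subst b'; rewrite Salg_mulE Hom_comp_idr; have [ds|ds] := boolP (d \in s).
  rewrite (bigD1_seq d) ?fset_uniq // Salg_in_diag big1 => [|d' d'd];
    first exact/esym/addr0.
  by rewrite Salg_in_off //; apply: contra d'd => /eqP[->].
rewrite big_seq big1 => [|d' d's]; last first.
  by rewrite Salg_in_off //; apply: contraNneq ds => -[<-].
apply: contrapT => ad; move: ds; rewrite in_fset_set // notin_setE; apply.
by exists (d, b).
Qed.

Lemma realized_all (b : L) (a : S) : realized b a.
Proof.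
suff [u uP] : realized b (Salg_mul a (Salg_id b)).
  by exists u => M m mb; rewrite -uP // sactM -/(wproj b m) mb.
have [s ->] := Salg_mulid_sum a b.
apply: big_ind => [|x y Hx Hy|d _]; first exact: realized0.
  by rewrite -[x]scale1r; exact: realized_linear.
exact: realized_hom.
Qed.

Section OneModule.
Variable M : Smod t n.

Lemma gl_act0 (m : M) : gl_act 0 m = 0.
Proof. exact: (uact0 (gl_struct hk M)). Qed.

Lemma gl_actD u v (m : M) : gl_act (u + v) m = gl_act u m + gl_act v m.
Proof. exact: (uactD (gl_struct hk M)). Qed.

Lemma gl_actZ c u (m : M) : gl_act (c *: u) m = c *: gl_act u m.
Proof. exact: (uactZ (gl_struct hk M)). Qed.

Lemma gl_actDr u (m m' : M) : gl_act u (m + m') = gl_act u m + gl_act u m'.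
Proof. exact: (uactDr (gl_struct hk M)). Qed.

Lemma gl_act_diag (h : 'rV[k]_n.+1) b (m : M) : wproj b m = m ->
  gl_act (Ugen (diag_mx h)) m = (\sum_i wt b i * h 0 i) *: m.
Proof. by move=> mb; rewrite (gl_act_gen hk) (mx_act_diag _ mb). Qed.

Lemma sum_delta_row (c : I ->
  k) i : \sum_j c j * (delta_mx 0 i : 'rV[k]_n.+1) 0 j = c i.
Proof.
rewrite (bigD1 i) //= mxE !eqxx mulr1 big1 ?addr0 // => j ji.
by rewrite mxE (negPf ji) andbF mulr0.
Qed.

Lemma wproj_gl_diag (h : 'rV[k]_n.+1) b (m : M) :
  wproj b (gl_act (Ugen (diag_mx h)) m) = (\sum_i wt b i * h 0 i) *: wproj b m.
Proof.
elim/wproj_ind: m => [|m m' Hm Hm'|c m mc].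
- by rewrite [gl_act _ 0](uact0r (gl_struct hk M)) /wproj sact0r scaler0.
- by rewrite gl_actDr /wproj !sactDr -!/(wproj _ _) Hm Hm' scalerDr.
rewrite (gl_act_diag _ mc) /wproj sactZr -/(wproj b m).
have [->//|bc] := eqVneq b c.
by rewrite -mc wproj_neq // !scaler0.
Qed.

End OneModule.

(** Lagrange interpolation in U(h). *)
Lemma weight_separation (s : seq L) (b : L) : b \notin s ->
  exists (u : U) (a : L -> k), [/\ a b = 1, forall c, c \in s -> a c = 0 &
    forall (M : Smod t n) c (m : M), wproj c m = m -> gl_act u m = a c *: m].
Proof.
elim: s => [_|c0 s IHs].
  by exists 1, (fun=> 1); split=> // M c m _; rewrite (gl_act1 hk) scale1r.
rewrite inE negb_or => /andP[bc0 /IHs[u [a [ab as0 uP]]]].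
have [i bi] : exists i, wt b i != wt c0 i.
  apply: contrapT => /forallNP ni; case/eqP: bc0; apply: (wt_inj hk) => i.
  by apply/eqP/negPn/negP; exact: ni.
pose r := (wt b i - wt c0 i)^-1.
(* The new factor is (E_{i,i} - c0_i) / (b_i - c0_i), for a coordinate where the two weights
   differ. *)
exists ((r *: (Ugen (diag_mx (delta_mx 0 i)) - wt c0 i *: 1)) * u).
exists (fun c => r * (wt c i - wt c0 i) * a c); split=> [|c|M c m mc].
- by rewrite ab mulr1 mulVf // subr_eq0.
- rewrite inE => /orP[/eqP->|/as0->]; last by rewrite mulr0.
  by rewrite subrr mulr0 mul0r.
rewrite (gl_actM hk) (uP _ _ _ mc) gl_actZ gl_actD -scaleNr gl_actZ (gl_act1
  hk).
have amc : wproj c (a c *: m) =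
  a c *: m by rewrite /wproj sactZr -/(wproj _ _) mc.
by rewrite (gl_act_diag _ amc) sum_delta_row -scalerDl !scalerA.
Qed.

(** Only the finitely many weights of [m] have to be separated from [b]; unlike in [realized], [u]
    depends on [m]. *)
Lemma wproj_gl (M : Smod t n) (m : M) (b : L) : exists u : U, wproj b m =
  gl_act u m.
Proof.
have [s [us mE _]] := wproj_decomp m.
have [u [a [ab as0 uP]]] : exists (u : U) (a : L -> k),
    [/\ a b = 1, forall c, c \in rem b s -> a c = 0 &
    forall (M : Smod t n) c (m : M), wproj c m = m -> gl_act u m = a c *: m].
  (* Separating [b] from [rem b s] treats at once the cases where [b] occurs in [s] and where it
     does not. *)
  by apply: weight_separation; rewrite mem_rem_uniqF.
exists u; rewrite [in LHS]mE [in RHS]mE /wproj sact_sum.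
have glsum : gl_act u (\sum_(c <- s) wproj c m) =
  \sum_(c <- s) gl_act u (wproj c m).
  apply: (big_morph (gl_act u)) => [x y|]; first exact: gl_actDr.
  exact: (uact0r (gl_struct hk M)).
rewrite glsum; apply: eq_big_seq => c cs; rewrite -/(wproj b _).
rewrite (uP _ c _ (wprojK _ _)); have [->|cb] := eqVneq c b.
  by rewrite ab scale1r wprojK.
rewrite as0 ?scale0r; last by rewrite mem_rem_uniq // !inE cb.
by rewrite wproj_neq // eq_sym.
Qed.

(** Each weight component of [m] lies in U(gl_n) m, and on it [a] is realized. *)
Lemma sact_gl (M : Smod t n) (m : M) (a : S) :
  exists u : U, sact (sstr M) a m = gl_act u m.
Proof.
have [s [_ mE _]] := wproj_decomp m.
rewrite [in X in exists u, X u = _]mE sact_sum.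
apply: (big_ind (fun v => exists u : U, v = gl_act u m)).
- by exists 0; rewrite gl_act0.
- by move=> _ _ [u ->] [v ->]; exists (u + v); rewrite gl_actD.
move=> b _; have [u uP] := realized_all b a; have [v vE] := wproj_gl m b.
by exists (u * v); rewrite (gl_actM hk) -vE uP // wprojK.
Qed.

End Realization.

(** * Weight spaces, finite generation and fullness *)

Section Inflation.
Variables (k : fieldType) (hk : [pchar k] =i pred0) (t : k) (n : nat).
Local Notation L := (Lambda t n).
Local Notation I := 'I_n.+1.
Local Notation W M := (MkUmod (gl_struct hk M)).

Definition wt_ffun (b : L) : {ffun I -> k} := [ffun i => wt b i].

Lemma wt_ffun_inj : injective wt_ffun.
Proof.
by move=> b c /ffunP bc; apply: (wt_inj hk) => i; have := bc i; rewrite !ffunE.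
Qed.

Section OneModule.
Variable M : Smod t n.

(** Projecting the eigenvalue equation of E_{i,i} to the weight [b] leaves a nonzero vector with
    both eigenvalues [chi i] and [wt b i]. *)
Lemma weight_space_wproj (chi : {ffun I -> k}) (v : M) b :
  weight_space (M := W M) chi v -> wproj b v <> 0 -> chi = wt_ffun b.
Proof.
move=> vchi /eqP bv; apply/ffunP => i; rewrite ffunE.
have := vchi (delta_mx 0 i); rewrite sum_delta_row => /(congr1 (wproj b)).
rewrite [LHS](wproj_gl_diag hk) sum_delta_row /wproj [RHS]sactZr => /eqP.
by rewrite -subr_eq0 -scalerBl scaler_eq0 (negPf bv) orbF subr_eq0 => /eqP.
Qed.

Lemma weight_spaceP b (v : M) :
  weight_space (M := W M) (wt_ffun b) v <-> wproj b v = v.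
Proof.
split=> [vb|vb h]; last first.
  rewrite [LHS](gl_act_diag hk _ vb); congr (_ *: _).
  by apply: eq_bigr => i _; rewrite ffunE.
apply: wproj_ext => c; have [<-|cb] := eqVneq c b; first exact: wprojK.
rewrite wproj_neq //; apply: esym; apply: contrapT => cv.
by move: cb; rewrite -(inj_eq wt_ffun_inj) -(weight_space_wproj vb cv) eqxx.
Qed.

Lemma weight_space_neq0 (chi : {ffun I -> k}) (v : M) :
  weight_space (M := W M) chi v -> v <> 0 -> exists b, chi = wt_ffun b.
Proof.
move=> vchi v0; apply: contrapT => /forallNP nb; apply: v0;
  apply: wproj_ext => b.
rewrite [RHS](_ : _ = 0); last exact: sact0r.
by apply: contrapT => /(weight_space_wproj vchi); exact: nb.
Qed.

Lemma weight_space_dsum : internal_dsum (weight_space (M := W M)).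
Proof.
move=> v; have [s [us vE vs]] := wproj_decomp (v : M).
(* The index ranges over all functionals: the component is [wproj b v] at [wt_ffun b], and 0 at
   functionals outside Lambda. *)
have /boolp.choice[u uP] chi : exists m : M,
    (forall b, chi = wt_ffun b ->
      m = wproj b v) /\ ((forall b, chi <> wt_ffun b) -> m = 0).
  case: (pselect (exists b, chi = wt_ffun b)) => [[b ->]|/forallNP nb].
    by exists (wproj b v); split=> [c /wt_ffun_inj->|/(_ b)].
  by exists 0; split=> // b /nb.
have ub b : u (wt_ffun b) = wproj b v by have [/(_ b erefl)] := uP (wt_ffun b).
have u0 chi : u chi <> 0 -> exists b, chi = wt_ffun b.
  move=> uchi; apply: contrapT => /forallNP nb; apply: uchi.
  by have [_ ->] := uP chi.
have us0 chi : chi \notin map wt_ffun s -> u chi = 0.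
  move=> chis; apply: contrapT => uchi; have [b chib] := u0 chi uchi.
  apply: uchi; rewrite chib ub vs //; apply: contra chis => bs.
  by rewrite chib map_f.
exists u; split=> [|u' [u'W u'f vE']].
  split=> [chi||].
  - case: (pselect (u chi = 0)) => [-> h|/u0[b ->]].
      by rewrite scaler0; exact: (uact0r (gl_struct hk M)).
    by rewrite ub; apply/weight_spaceP; exact: wprojK.
  - apply: (@sub_finite_set _ _ [set` map wt_ffun s]); last exact: finite_seq.
    by move=> chi /= uchi; apply: contrapT => /negP /us0.
  rewrite (fsbigE (map wt_ffun s)) //; last 2 first.
  - by rewrite map_inj_uniq //; exact: wt_ffun_inj.
  - by move=> chi _; exact: us0.
  rewrite {1}vE big_map; apply: eq_big => [b|b _]; first by rewrite in_setT.
  by rewrite ub.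
apply: funext => chi; case: (pselect (exists b, chi = wt_ffun b)) =>
  [[b ->]|/forallNP nb].
  rewrite ub; pose r := fset_set [set chi | u' chi <> 0].
  have r0 chi' : chi' \notin r -> u' chi' = 0.
    by rewrite in_fset_set // notin_setE /= => /contrapT.
  rewrite vE' (fsbigTE r) // /wproj sact_sum.
  have u'b : wproj b (u' (wt_ffun b)) = u' (wt_ffun b) by apply/weight_spaceP;
    exact: u'W.
  have off chi' : chi' != wt_ffun b -> wproj b (u' chi') = 0.
    by move=> ne; apply: contrapT => /(weight_space_wproj (u'W chi'))/eqP;
      apply/negP.
  have [br|br] := boolP (wt_ffun b \in r).
    rewrite (bigD1_seq (wt_ffun b)) ?fset_uniq //= -/(wproj b _) u'b.
    by rewrite big1 ?addr0 // => chi' /off.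
  rewrite r0 // big_seq big1 // => chi' chi'r; apply: off.
  by apply: contraNneq br => <-.
have [_ ->//] := uP chi; apply/esym; apply: contrapT => u'chi.
by have [b /nb] := weight_space_neq0 (u'W chi) u'chi.
Qed.

Lemma gl_struct_fg : Smod_fg M -> Umod_fg (W M).
Proof.
move=> [r [g gP]]; exists r, g => m; have [a ->] := gP m.
have /boolp.choice[u uP] i : exists u, sact (sstr M) (a i) (g i) =
  gl_act u (g i).
  exact: sact_gl.
by exists u; apply: eq_bigr => i _; exact: uP.
Qed.

Lemma gl_struct_Pcat : Smod_fg M -> Pcat t (W M).
Proof.
move=> Mfg; split; [exact: gl_struct_fg|exact: weight_space_dsum|].
move=> chi v vchi v0; have [b ->] := weight_space_neq0 vchi v0.
by exists b => i; rewrite ffunE.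
Qed.

End OneModule.

(** Fullness: [h] preserves weights, as these are eigenvalues of diagonal matrices; on a weight
    space the same [u] realizes [a] in both modules, and [h] commutes with [u]. *)
Lemma uhom_sact (M N : Smod t n) (h : Uhom (W M) (W N)) a (m : M) :
  h (sact (sstr M) a m) = sact (sstr N) a (h m).
Proof.
have hD m1 m2 : h (m1 + m2) = h m1 + h m2.
  by have := uhom_linear h 1 m1 m2; rewrite !scale1r.
have h0 : h 0 = 0.
  by have := uhom_linear h (-1) 0 0; rewrite scaler0 addr0 scaleN1r addNr.
elim/wproj_ind: m => [|m1 m2 H1 H2|b m mb].
- by rewrite sact0r h0 [RHS]sact0r.
- by rewrite sactDr hD H1 H2 hD [RHS]sactDr.
have hmb : wproj b (h m : N) = h m.
  apply/weight_spaceP => d; rewrite -uhom_act.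
  have /weight_spaceP/(_ d) -> := mb.
  by have := uhom_linear h (\sum_i wt_ffun b i * d 0 i) m 0;
    rewrite !addr0 h0 addr0.
have [u uP] := realized_all hk b a.
by rewrite (uP N (h m) hmb) (uP M m mb); exact: (uhom_act h).
Qed.

Definition uhom_shom (M N : Smod t n) (h : Uhom (W M) (W N)) : Shom M N :=
  @MkShom _ _ _ M N h (uhom_linear h) (uhom_sact h).

End Inflation.

Theorem lemma8p7p2 (k : fieldType) (hk : [pchar k]%R =i pred0) (t : k) (n : nat) :
  exists W : forall M : Smod t n, Ustruct n M,
    (forall (M : Smod t n) (V : Ustruct n M), is_inflation V <-> V = W M) /\
    exists (WH : forall (M N : Smod t n) (f : Shom M N) u m,
              f (uact (W M) u m) = uact (W N) u (f m))
           (WP : forall M : Smod_cat t n, Smod_fg M -> Pcat t (inflation WH M)),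
      fully_faithful (restrict_functor WP).
Proof.
exists (fun M => gl_struct hk M); split=> [M V|].
  by split=> [|->]; [exact: inflation_uniq|exact: gl_struct_inflation].
exists (fun M N f u m => shom_gl_act f u m), (fun M => @gl_struct_Pcat _ hk _ _ M).
move=> [M Mfg] [N Nfg] /=.
exists (@uhom_shom _ hk _ _ M N) => f.
  exact: ShomP.
exact: UhomP.
Qed.
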